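(* Let $A$ be a finite-dimensional $\mathbb{Z}$-graded algebra over a field $K$ with a triangular decomposition $(A^-,T,A^+)$. If $T$ is semisimple, then the category $\mathcal{G}(A)$ of finitely generated graded left $A$-modules is a highest weight category, with simple objects $L(\lambda)$ indexed by the poset $(\operatorname{Irr}\mathcal{G}(T),\le)$, where $\lambda<\mu$ if and only if $\deg\lambda<\deg\mu$, and with standard objects $\Delta(\lambda)=A\otimes_{B^+}\lambda$.
   Context: **Triangular decomposition.** A triangular decomposition of $A$ is a triple $(A^-,T,A^+)$ of graded subalgebras such that: (a) multiplication $A^-\otimes_K T\otimes_K A^+\to A$ is an isomorphism of vector spaces; (b) $T$ is concentrated in degree $0$, $A^+$ is supported in degrees $\ge 0$ and $A^-$ in degrees $\le 0$; (c) $A^-_0=K=A^+_0$; (d) $A^+T=TA^+$ and $A^-T=TA^-$ as subspaces of $A$; (e) $T$ is split over $K$, i.e. $\operatorname{End}_T(\lambda)=K$ for every simple $T$-module $\lambda$. **Notation.** $\mathcal{G}(A)$ has degree-preserving morphisms; $\operatorname{Irr}$ denotes the set of isomorphism classes of simple objects. $B^{+}=A^{+}T$, a graded subalgebra. It has a quotient map $B^+\to T$ with kernel the elements of positive degree, through which $T$-modules become $B^+$-modules. Since $T$ is in degree $0$, each $\lambda\in\operatorname{Irr}\mathcal{G}(T)$ is concentrated in a single degree $\deg\lambda\in\mathbb{Z}$. For $\lambda\in\operatorname{Irr}\mathcal{G}(T)$ the module $A\otimes_{B^+}\lambda$ has a simple head $L(\lambda)$, and $\lambda\mapsto L(\lambda)$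 is a bijection $\operatorname{Irr}\mathcal{G}(T)\to\operatorname{Irr}\mathcal{G}(A)$. $P(\lambda)$ denotes the projective cover of $L(\lambda)$ in $\mathcal{G}(A)$. **Highest weight category.** Let $\mathcal{C}$ be a $K$-linear finite length abelian category with enough projectives, with all simple objects absolutely simple, with simple objects $L(\lambda)$, $\lambda\in\Lambda$, and projective covers $P(\lambda)$. Let $d:\Lambda\to\Xi$ be a map with finite fibres to an interval-finite poset, and order $\Lambda$ by $\lambda<\mu$ iff $d(\lambda)<d(\mu)$. Let $\mathcal{C}_{\le\xi}$ (resp. $\mathcal{C}_{<\xi}$) be the Serre subcategory generated by the $L(\lambda)$ with $d(\lambda)\le\xi$ (resp. $<\xi$), let $\mathcal{C}_\xi=\mathcal{C}_{\le\xi}/\mathcal{C}_{<\xi}$, with quotient functor $\pi_\xi$. Suppose each $\pi_\xi$ has an exact left adjoint $\Delta_\xi$. For $d(\lambda)=\xi$ let $L_\xi(\lambda)$ be the simple object of $\mathcal{C}_\xi$ corresponding to $\lambda$ and $P_\xi(\lambda)$ its projective cover in $\mathcal{C}_\xi$; put $\Delta(\lambda)=\Delta_\xi(P_\xi(\lambda))$ and $\overline{\Delta}(\lambda)=\Delta_\xi(L_\xi(\lambda))$. $\mathcal{C}$ is standardly stratified if for every $\lambda$ there is an epimorphism $P(\lambda)\to\Delta(\lambda)$ whose kernel has a finite filtration with subquotients of the form $\Delta(\mu)$, $\mu>\lambda$. It is a highest weight category if moreover $\Delta(\lambda)=\overline{\Delta}(\lambda)$ for all $\lambda$. Here $\Lambda=\operatorname{Irr}\mathcal{G}(T)$,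 $\Xi=\mathbb{Z}$, $d=\deg$. *)

(* Defs.v *)
From HB Require Import structures.
From mathcomp Require Import all_boot all_order all_algebra falgebra.
From mathcomp Require Import boolp classical_sets.

Set Implicit Arguments.
Unset Strict Implicit.
Unset Printing Implicit Defensive.

Import Order.TTheory GRing.Theory Num.Theory.
Local Open Scope ring_scope.

Record lincat (K : fieldType) := LinCat {
  ob :> Type;
  hom : ob -> ob -> lmodType K;
  idm : forall X, hom X X;
  cmp : forall X Y Z, hom Y Z -> hom X Y -> hom X Z;
  cmpA : forall X Y Z W (h : hom Z W) (g : hom Y Z) (f : hom X Y),
    cmp h (cmp g f) = cmp (cmp h g) f;
  cmp1m : forall X Y (f : hom X Y), cmp (idm Y) f = f;
  cmpm1 : forall X Y (f : hom X Y), cmp f (idm X) = f;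
  cmp_linl : forall X Y Z (k : K) (g g' : hom Y Z) (f : hom X Y),
    cmp (k *: g + g') f = k *: cmp g f + cmp g' f;
  cmp_linr : forall X Y Z (k : K) (g : hom Y Z) (f f' : hom X Y),
    cmp g (k *: f + f') = k *: cmp g f + cmp g f' }.

Arguments hom {K l} X Y.
Arguments idm {K l} X.
Arguments cmp {K l X Y Z} g f.

Notation "g \oc f" := (cmp g f) (at level 40, left associativity).

Section Abelian.
Variables (K : fieldType) (C : lincat K).
Implicit Types X Y Z W : C.

Definition mono X Y (f : hom X Y) :=
  forall W (g h : hom W X), f \oc g = f \oc h -> g = h.

Definition epi X Y (f : hom X Y) :=
  forall W (g h : hom Y W), g \oc f = h \oc f -> g = h.

Definition isom X Y (f : hom X Y) :=
  exists g : hom Y X, g \oc f = idm X /\ f \oc g = idm Y.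

Definition isomorphic X Y := exists f : hom X Y, isom f.

Definition is_zero X := idm X = 0.

Definition is_kernel X Y (f : hom X Y) N (i : hom N X) :=
  f \oc i = 0 /\
  forall W (g : hom W X), f \oc g = 0 -> exists! h : hom W N, i \oc h = g.

Definition is_cokernel X Y (f : hom X Y) Q (p : hom Y Q) :=
  p \oc f = 0 /\
  forall W (g : hom Y W), g \oc f = 0 -> exists! h : hom Q W, h \oc p = g.

Definition is_biproduct X Y Z :=
  exists (i1 : hom X Z) (i2 : hom Y Z) (p1 : hom Z X) (p2 : hom Z Y),
  [/\ p1 \oc i1 = idm X, p2 \oc i2 = idm Y, p1 \oc i2 = 0, p2 \oc i1 = 0
    & i1 \oc p1 + i2 \oc p2 = idm Z].

Record abelian : Prop := Abelian {
  ab_zero : exists X, is_zero X;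
  ab_biproduct : forall X Y, exists Z, is_biproduct X Y Z;
  ab_kernel : forall X Y (f : hom X Y), exists N (i : hom N X), is_kernel f i;
  ab_cokernel : forall X Y (f : hom X Y),
    exists Q (p : hom Y Q), is_cokernel f p;
  ab_mono : forall X Y (f : hom X Y), mono f ->
    exists Z (g : hom Y Z), is_kernel g f;
  ab_epi : forall X Y (f : hom X Y), epi f ->
    exists Z (g : hom Z X), is_cokernel g f }.

Definition ses X Y Z (i : hom X Y) (p : hom Y Z) :=
  is_kernel p i /\ is_cokernel i p.

Definition simple X :=
  ~ is_zero X /\
  forall Y (f : hom Y X), mono f -> is_zero Y \/ isom f.

Definition absolutely_simple X :=
  simple X /\ forall f : hom X X, exists k : K, f = k *: idm X.

(** Objects with a finite filtration all of whose subquotients satisfy [P]. *)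
Inductive filtered (P : C -> Prop) : C -> Prop :=
| filtered_zero X : is_zero X -> filtered P X
| filtered_ext X Y Z (i : hom X Y) (p : hom Y Z) :
    ses i p -> filtered P X -> P Z -> filtered P Y.

Definition finite_length := forall X, filtered simple X.

Definition projective X :=
  forall Y Z (e : hom Y Z) (f : hom X Z), epi e ->
  exists g : hom X Y, e \oc g = f.

Definition enough_projectives :=
  forall X, exists P (p : hom P X), projective P /\ epi p.

Definition projective_cover P X :=
  projective P /\
  exists p : hom P X, epi p /\
    forall Y (g : hom Y P), epi (p \oc g) -> epi g.

(** [H] is the head [V / rad V] of [V], where [rad V] is the intersection of
    the kernels of all morphisms from [V] to simple objects. *)
Definition is_head V H :=
  exists p : hom V H, epi p /\
    forall X (f : hom X V), p \oc f = 0 <->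
      (forall S (q : hom V S), simple S -> q \oc f = 0).

Definition serre (S : C -> Prop) :=
  (forall X, is_zero X -> S X) /\
  (forall X Y Z (i : hom X Y) (p : hom Y Z), ses i p -> (S Y <-> S X /\ S Z)).

Definition serre_gen (G : C -> Prop) : C -> Prop := fun X =>
  forall S, serre S -> (forall Y, G Y -> S Y) -> S X.

Lemma serre_gen_sub (G : C -> Prop) X : G X -> serre_gen G X.
Proof. by move=> GX S _; apply. Qed.

Definition Irr :=
  {c : C -> Prop | exists X, simple X /\ c = isomorphic X}.

End Abelian.

Section FullSubcategory.
Variables (K : fieldType) (C : lincat K) (S : C -> Prop).

Definition fullsub : lincat K :=
  @LinCat K {X : C | S X} (fun X Y => hom (sval X) (sval Y))
    (fun X => idm (sval X)) (fun _ _ _ g f => g \oc f)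
    (fun _ _ _ _ h g f => cmpA h g f)
    (fun _ _ f => cmp1m f) (fun _ _ f => cmpm1 f)
    (fun _ _ _ k g g' f => cmp_linl k g g' f)
    (fun _ _ _ k g f f' => cmp_linr k g f f').

End FullSubcategory.

Record functor (K : fieldType) (C D : lincat K) := Functor {
  fob :> C -> D;
  fmap : forall X Y, hom X Y -> hom (fob X) (fob Y);
  fmap1 : forall X, fmap (idm X) = idm (fob X);
  fmapM : forall X Y Z (g : hom Y Z) (f : hom X Y),
    fmap (g \oc f) = fmap g \oc fmap f;
  fmap_lin : forall X Y (k : K) (f g : hom X Y),
    fmap (k *: f + g) = k *: fmap f + fmap g }.

Arguments fmap {K C D} F {X Y} f : rename.

Section Functors.
Variable K : fieldType.
Implicit Types C D E : lincat K.

Definition fcomp C D E (G : functor D E) (F : functor C D) : functor C E.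
Proof.
exists (fun X => G (F X)) (fun X Y f => fmap G (fmap F f)).
- by move=> X; rewrite !fmap1.
- by move=> X Y Z g f; rewrite !fmapM.
- by move=> X Y k f g; rewrite !fmap_lin.
Defined.

Definition fid C : functor C C.
Proof. by exists (fun X => X) (fun X Y f => f). Defined.

Definition nattrans C D (F G : functor C D) (a : forall X, hom (F X) (G X)) :=
  forall X Y (f : hom X Y), a Y \oc fmap F f = fmap G f \oc a X.

Definition natiso C D (F G : functor C D) :=
  exists a : forall X, hom (F X) (G X), nattrans a /\ forall X, isom (a X).

Definition exact C D (F : functor C D) :=
  forall X Y Z (i : hom X Y) (p : hom Y Z),
    ses i p -> ses (fmap F i) (fmap F p).

Definition left_adjoint C D (F : functor D C) (G : functor C D) :=
  exists eta : forall X : D, hom X (G (F X)),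
    @nattrans D D (fid D) (fcomp G F) eta /\
    forall (X : D) (Y : C) (f : hom X (G Y)),
      exists! g : hom (F X) Y, fmap G g \oc eta X = f.

(** [pi : C -> D] exhibits [D] as the quotient [C / S]: an exact functor that
    kills [S] factors through [pi], uniquely up to unique isomorphism (the last
    clause: precomposition with [pi] is fully faithful on exact functors). *)
Record serre_quotient C (S : C -> Prop) D (pi : functor C D) : Prop :=
  SerreQuotient {
    sq_abelian : abelian D;
    sq_exact : exact pi;
    sq_kills : forall X, S X -> is_zero (pi X);
    sq_factor : forall E (F : functor C E), abelian E -> exact F ->
      (forall X, S X -> is_zero (F X)) ->
      exists G : functor D E, exact G /\ natiso (fcomp G pi) F;
    sq_unique : forall E (G G' : functor D E), abelian E ->
      exact G -> exact G' ->
      forall a : forall X, hom (G (pi X)) (G' (pi X)),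
      @nattrans C E (fcomp G pi) (fcomp G' pi) a ->
      exists b : forall Y, hom (G Y) (G' Y),
        [/\ nattrans b, forall X, b (pi X) = a X
          & forall b' : forall Y, hom (G Y) (G' Y),
            nattrans b' -> (forall X, b' (pi X) = a X) ->
            forall Y, b' Y = b Y] }.

End Functors.

(* [finite_set] is not used here because of universe constraints: [I] may be a
   type of isomorphism classes of modules. *)
Definition finitely_many (I : Type) (P : I -> Prop) :=
  exists (n : nat) (e : 'I_n -> I), forall i, P i -> exists j, e j = i.

Section HighestWeight.
Variables (K : fieldType) (C : lincat K) (Lam : Type).
Variables (disp : Order.disp_t) (Xi : porderType disp).
Variables (d : Lam -> Xi) (L : Lam -> C).

Definition C_le (xi : Xi) : C -> Prop :=
  serre_gen (fun X => exists2 l, (d l <= xi)%O & X = L l).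

Definition C_lt (xi : Xi) : C -> Prop :=
  serre_gen (fun X => exists2 l, (d l < xi)%O & X = L l).

Lemma C_leL l : C_le (d l) (L l).
Proof.
have Gl : exists2 m, (d m <= d l)%O & L l = L m by exists l.
exact (serre_gen_sub (G := fun X => exists2 m, (d m <= d l)%O & X = L m) Gl).
Qed.

Definition L_le l : fullsub (C_le (d l)) := exist _ (L l) (@C_leL l).

Record hw_setting : Prop := HWSetting {
  hw_abelian : abelian C;
  hw_finlen : finite_length C;
  hw_proj : enough_projectives C;
  hw_abs : forall X : C, simple X -> absolutely_simple X;
  hw_simple : forall l, simple (L l);
  hw_all : forall X : C, simple X -> exists l, isomorphic X (L l);
  hw_inj : forall l m, isomorphic (L l) (L m) -> l = m;
  hw_fibres : forall xi, finitely_many (fun l => d l = xi);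
  hw_interval : forall x y : Xi, finitely_many (fun z => (x <= z <= y)%O) }.

(** The choices on which the standard objects depend; each of them is unique up
    to equivalence or isomorphism. [quo xi] is [C_le xi / C_lt xi], [quoD] is
    the left adjoint Delta_xi, and [quopi (d l) (L_le l)] is L_xi(l). *)
Record strat_data := StratData {
  quo : Xi -> lincat K;
  quopi : forall xi, functor (fullsub (C_le xi)) (quo xi);
  quopiP : forall xi, serre_quotient
    (fun X : fullsub (C_le xi) => C_lt xi (sval X)) (quopi xi);
  quoD : forall xi, functor (quo xi) (fullsub (C_le xi));
  quoD_adj : forall xi, left_adjoint (quoD xi) (quopi xi);
  quoD_exact : forall xi, exact (quoD xi);
  projC : Lam -> C;
  projCP : forall l, projective_cover (projC l) (L l);
  projQ : forall l, quo (d l);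
  projQP : forall l, projective_cover (projQ l) (quopi (d l) (L_le l)) }.

Variable S : strat_data.

Definition Std l : C := sval (quoD S (d l) (projQ S l)).

Definition PropStd l : C := sval (quoD S (d l) (quopi S (d l) (L_le l))).

Definition standardly_stratified :=
  hw_setting /\
  forall l, exists (p : hom (projC S l) (Std l)) (N : C)
                   (i : hom N (projC S l)),
    [/\ epi p, is_kernel p i
      & filtered (fun X => exists2 m, (d l < d m)%O & isomorphic X (Std m)) N].

Definition highest_weight :=
  standardly_stratified /\ forall l, isomorphic (Std l) (PropStd l).

End HighestWeight.

(** Elements of the sum of the [V i] with [P i]. *)
Definition in_gsum (M : zmodType) (V : int -> M -> Prop) (P : pred int) (m : M) :=
  exists (s : seq int) (f : int -> M),
    [/\ all P s, forall i, V i (f i) & m = \sum_(i <- s) f i].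

(** The additive group [M] is the internal direct sum of the [V i]. *)
Definition direct_sum (M : zmodType) (V : int -> M -> Prop) :=
  (forall m, in_gsum V predT m) /\
  (forall (s : seq int) (f : int -> M), uniq s -> (forall i, V i (f i)) ->
     \sum_(i <- s) f i = 0 -> forall i, i \in s -> f i = 0).

Section GradedAlgebra.
Variables (K : fieldType) (A : falgType K) (Ac : int -> {vspace A}).

Definition graded_algebra :=
  [/\ direct_sum (fun i a => a \in Ac i), 1 \in Ac 0
    & forall i j, (Ac i * Ac j <= Ac (i + j))%VS].

Definition graded_subalgebra (B : {aspace A}) :=
  1 \in B /\
  forall b, b \in B -> in_gsum (fun i a => a \in (B :&: Ac i)%VS) predT b.

Definition sub_grading (B : {aspace A}) (i : int) : {vspace subvs_of B} :=
  (linfun vsval @^-1: Ac i)%VS.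

Record gmod := GMod {
  gcar :> lmodType A;
  gdeg : int -> gcar -> Prop;
  gdeg0 : forall i, gdeg i 0;
  gdegP : forall i (k : K) x y,
    gdeg i x -> gdeg i y -> gdeg i (k%:A *: x + y);
  gdeg_direct : direct_sum gdeg;
  gdegZ : forall i j a x, a \in Ac i -> gdeg j x -> gdeg (i + j) (a *: x);
  gfg : exists s : seq gcar, forall x, exists c : gcar -> A,
    x = \sum_(g <- s) c g *: g }.

Record gmor (M N : gmod) := GMor {
  gfun :> M -> N;
  glin : linear gfun;
  gmor_deg : forall i x, gdeg i x -> gdeg i (gfun x) }.

End GradedAlgebra.

Section GradedCategory.
Variables (K : fieldType) (A : falgType K) (Ac : int -> {vspace A}).
Implicit Types M N P : gmod Ac.

HB.instance Definition _ M N := gen_eqMixin (gmor M N).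
HB.instance Definition _ M N := gen_choiceMixin (gmor M N).

Lemma gmor_ext M N (f g : gmor M N) : gfun f =1 gfun g -> f = g.
Proof.
case: f g => [f fl fd] [g gl gd] /= /funext E; rewrite -{}E in gl gd *.
by rewrite (Prop_irrelevance fl gl) (Prop_irrelevance fd gd).
Qed.

Lemma gdegD M i (x y : M) : gdeg i x -> gdeg i y -> gdeg i (x + y).
Proof. by move=> xi yi; have := gdegP 1 xi yi; rewrite !scale1r. Qed.

Lemma gdegK M i (k : K) (x : M) : gdeg i x -> gdeg i (k%:A *: x).
Proof. by move=> xi; rewrite -[_ *: _]addr0; apply/gdegP/gdeg0. Qed.

Lemma gdegN M i (x : M) : gdeg i x -> gdeg i (- x).
Proof. by move=> /(gdegK (-1)); rewrite !scaleN1r. Qed.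

Definition gmor0 M N : gmor M N.
Proof.
exists (fun _ => 0) => [a x y|i x _]; last exact: gdeg0.
by rewrite scaler0 addr0.
Defined.

Definition gmorD M N (f g : gmor M N) : gmor M N.
Proof.
exists (fun x => f x + g x) => [a x y|i x xi].
  by rewrite !glin scalerDr addrACA.
by apply: gdegD; apply: gmor_deg.
Defined.

Definition gmorN M N (f : gmor M N) : gmor M N.
Proof.
exists (fun x => - f x) => [a x y|i x xi].
  by rewrite glin opprD scalerN.
by apply/gdegN/gmor_deg.
Defined.

Definition gmorZ M N (k : K) (f : gmor M N) : gmor M N.
Proof.
exists (fun x => k%:A *: f x) => [a x y|i x xi].
  rewrite glin scalerDr !scalerA; congr (_ *: _ + _).
  by rewrite -scalerAl -scalerAr mul1r mulr1.
by apply/gdegK/gmor_deg.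
Defined.

Fact gmor_addA M N : associative (@gmorD M N).
Proof. by move=> f g h; apply: gmor_ext => x /=; rewrite addrA. Qed.
Fact gmor_addC M N : commutative (@gmorD M N).
Proof. by move=> f g; apply: gmor_ext => x /=; rewrite addrC. Qed.
Fact gmor_add0 M N : left_id (gmor0 M N) (@gmorD M N).
Proof. by move=> f; apply: gmor_ext => x /=; rewrite add0r. Qed.
Fact gmor_addN M N : left_inverse (gmor0 M N) (@gmorN M N) (@gmorD M N).
Proof. by move=> f; apply: gmor_ext => x /=; rewrite addNr. Qed.

HB.instance Definition _ M N := GRing.isZmodule.Build (gmor M N)
  (@gmor_addA M N) (@gmor_addC M N) (@gmor_add0 M N) (@gmor_addN M N).

Fact gmor_scaleA M N a b (f : gmor M N) :
  gmorZ a (gmorZ b f) = gmorZ (a * b) f.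
Proof.
by apply: gmor_ext => x /=; rewrite scalerA -scalerAl mul1r scalerA.
Qed.
Fact gmor_scale1 M N : left_id 1 (@gmorZ M N).
Proof. by move=> f; apply: gmor_ext => x /=; rewrite !scale1r. Qed.
Fact gmor_scaleDr M N : right_distributive (@gmorZ M N) +%R.
Proof. by move=> k f g; apply: gmor_ext => x /=; rewrite scalerDr. Qed.
Fact gmor_scaleDl M N (f : gmor M N) :
  {morph (@gmorZ M N)^~ f : a b / a + b}.
Proof. by move=> a b; apply: gmor_ext => x /=; rewrite !scalerDl. Qed.

HB.instance Definition _ M N := GRing.Zmodule_isLmodule.Build K (gmor M N)
  (@gmor_scaleA M N) (@gmor_scale1 M N)
  (@gmor_scaleDr M N) (@gmor_scaleDl M N).

Definition gmor1 M : gmor M M.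
Proof. by exists id. Defined.

Definition gmor_comp M N P (g : gmor N P) (f : gmor M N) : gmor M P.
Proof.
exists (fun x => g (f x)) => [a x y|i x xi]; first by rewrite !glin.
by do 2 apply: gmor_deg.
Defined.

Definition gcat : lincat K.
Proof.
refine (@LinCat K (gmod Ac) (fun M N => gmor M N) gmor1 gmor_comp _ _ _ _ _).
- by move=> M N P Q h g f; apply: gmor_ext.
- by move=> M N f; apply: gmor_ext.
- by move=> M N f; apply: gmor_ext.
- by move=> M N P k g g' f; apply: gmor_ext.
- move=> M N P k g f f'; apply: gmor_ext => x /=.
  exact: glin.
Defined.

(** The degree in which a simple graded module is concentrated; this is
    meaningful only when the algebra is concentrated in degree 0. *)
Definition irr_deg (l : Irr gcat) : int :=
  xget 0 [set i : int |
    forall M : gmod Ac, sval l M -> forall x : M, gdeg i x].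

End GradedCategory.

Section FiniteDimensionalAlgebra.
Variables (K : fieldType) (B : falgType K).

Definition simple_module (M : lmodType B) :=
  (exists x : M, x != 0) /\
  forall P : M -> Prop, P 0 ->
    (forall a x y, P x -> P y -> P (a *: x + y)) ->
    (forall x, P x -> x = 0) \/ (forall x, P x).

Definition split_algebra :=
  forall M : lmodType B, simple_module M ->
  forall f : {linear M -> M}, exists k : K, forall x, f x = k%:A *: x.

Definition left_ideal (U : {vspace B}) := (fullv * U <= U)%VS.

Definition minimal_left_ideal (U : {vspace B}) :=
  [/\ left_ideal U, (U != 0)%VS
    & forall V, left_ideal V -> (V <= U)%VS -> V = 0%VS \/ V = U].

(** The left regular module is a direct sum of simple submodules. *)
Definition semisimple_algebra :=
  exists (n : nat) (S : 'I_n -> {vspace B}),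
    [/\ forall i, minimal_left_ideal (S i),
        (\sum_i S i)%VS = fullv & directv (\sum_i S i)].

End FiniteDimensionalAlgebra.

Section Triangular.
Variables (K : fieldType) (A : falgType K) (Ac : int -> {vspace A}).
Variables (Am T Ap : {aspace A}).

Definition trilinear (W : lmodType K)
    (phi : subvs_of Am -> subvs_of T -> subvs_of Ap -> W) :=
  [/\ forall t y, linear (fun x => phi x t y),
      forall x y, linear (fun t => phi x t y)
    & forall x t, linear (fun y => phi x t y)].

(** [Am (x) T (x) Ap -> A] is an isomorphism: [A], with the multiplication
    map [Am * T * Ap -> A], has the universal property of the tensor product
    over [K]. *)
Definition mult_iso :=
  forall (W : lmodType K) (phi : subvs_of Am -> subvs_of T -> subvs_of Ap -> W),
  trilinear phi ->
  exists h : {linear A -> W},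
    (forall x t y, h (vsval x * vsval t * vsval y) = phi x t y) /\
    (forall h' : {linear A -> W},
       (forall x t y, h' (vsval x * vsval t * vsval y) = phi x t y) ->
       h' =1 h).

Record triangular_decomposition : Prop := TriangularDecomposition {
  td_Am : graded_subalgebra Ac Am;
  td_T : graded_subalgebra Ac T;
  td_Ap : graded_subalgebra Ac Ap;
  td_mult : mult_iso;
  td_T0 : (T <= Ac 0)%VS;
  td_Ap_ge0 : forall i, i < 0 -> (Ap :&: Ac i)%VS = 0%VS;
  td_Am_le0 : forall i, 0 < i -> (Am :&: Ac i)%VS = 0%VS;
  td_Am0 : (Am :&: Ac 0)%VS = <[1]>%VS;
  td_Ap0 : (Ap :&: Ac 0)%VS = <[1]>%VS;
  td_ApT : (Ap * T)%VS = (T * Ap)%VS;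
  td_AmT : (Am * T)%VS = (T * Am)%VS;
  td_split : split_algebra (subvs_of T) }.

(** [b] lies in [B+ = Ap T] and [t] is its image under [B+ -> T], the quotient
    map by the elements of positive degree. *)
Definition Bp_to_T (b : A) (t : subvs_of T) :=
  b \in (Ap * T)%VS /\
  in_gsum (fun i a => a \in ((Ap * T) :&: Ac i)%VS) (fun i => 0 < i)
    (b - vsval t).

Notation GT := (gcat (sub_grading Ac T)).
Notation GA := (gcat Ac).

(** Biadditive maps that are balanced over [B+], acting on the [T]-module [X]
    through [B+ -> T]. *)
Definition balanced (X : GT) (W : zmodType)
    (phi : A -> gcar X -> W) :=
  [/\ forall a a' x, phi (a + a') x = phi a x + phi a' x,
      forall a x x', phi a (x + x') = phi a x + phi a x'
    & forall a b t x, Bp_to_T b t -> phi (a * b) x = phi a (t *: x)].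

(** [V] is the graded module [A (x)_{B+} X]. *)
Definition is_induced (X : GT) (V : GA) :=
  exists phi : A -> gcar X -> gcar V,
  [/\ balanced phi,
      forall (W : zmodType) (psi : A -> gcar X -> W), balanced psi ->
      exists h : {additive gcar V -> W},
        (forall a x, h (phi a x) = psi a x) /\
        (forall h' : {additive gcar V -> W},
           (forall a x, h' (phi a x) = psi a x) -> h' =1 h),
      forall a b x, phi (a * b) x = a *: phi b x
    & forall i j a x, a \in Ac i -> gdeg j x -> gdeg (i + j) (phi a x)].

End Triangular.

(* Main.v *)
From HB Require Import structures.
From mathcomp Require Import all_boot all_order all_algebra falgebra.
From mathcomp Require Import boolp classical_sets zify.
Require Import Defs.

(** Put [Bp = Ap T]. In each degree [xi], restriction and induction connect the
    graded [A]-modules supported in degrees at most [xi] with the [T]-modules of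
    degree [xi]: a module [M] is sent to its top part [M_xi], and a [T]-module [X]
    to [A (x)_{Bp} X], where positive degrees of [Bp] act by zero. The second
    functor is left adjoint to the first ([ind_adj]), and the unit is invertible
    because [X] is the whole top degree of [A (x)_{Bp} X] ([adj_unit_isom]). An
    exact functor with a fully faithful exact left adjoint is the quotient by the
    objects that it kills ([adjoint_serre_quotient]), so the [T]-modules of
    degree [xi] form the stratum of [xi], and the left adjoint is induction
    ([hw_quotient]). Over the semisimple algebra [T] every short exact sequence
    splits ([puremod_ses_split]). Hence induction is exact, every object of the
    stratum is its own projective cover, and standard and proper standard objects
    coincide: both are [Delta l = A (x)_{Bp} l].

    For a simple [X] the module [A (x)_{Bp} X] has a largest submodule avoiding
    the top degree, and this is its largest proper submodule
    ([ind_rad_max]). Its head [Lsimple l] has [l] as its top degree, so that [l]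
    and its endomorphisms can be read off from it ([Lsimple_inj], [Lmod_end]),
    and a simple module is the head of the module induced from any simple
    submodule of its top degree ([simple_classify]).

    The standard filtration of projective covers comes from counting dimensions.
    Let [J] be the part of [Am] in negative degrees. For every graded module [M],
    let [M(k)] be the submodule generated in degrees at least [k]. As
    [A = Am Bp], the space [M(k)] is spanned by [M(k+1)] and the products of [Am]
    with a complement of [M(k+1)] in the part of degree [k]. Summing over [k]
    gives [dim M <= dim Am * dim (M / J M)] ([rad_dim_bound]). For the free module
    of rank one both sides are equal, because [A] has the dimension of
    [Am (x) T (x) Ap] ([free1_balanced]), and equality passes to direct summands
    ([balanced_retract]), in particular to the projective cover [N] of
    [Lsimple l], which is a summand of [A] with its generator in degree
    [deg l]. Equality means that each [N(k) / N(k+1)] is as large as the module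
    induced from its part of degree [k], which maps onto it; so it is this induced
    module, a successive extension of standard objects of degree [k]
    ([layer_quotient], [Ind_filtered]). Finally [N = N(deg l)], and as [N] is a
    projective cover of [Lsimple l], the top layer [N / N(deg l + 1)] is a single
    copy of [Delta l] ([standard_filtration]).

    The same count for [A] itself shows that [T] meets the left ideal generated by
    the elements of positive degree trivially ([T_posA_trivial]); this is why [X]
    embeds in [A (x)_{Bp} X]. *)

Set Implicit Arguments.
Unset Strict Implicit.
Unset Printing Implicit Defensive.

Import Order.TTheory GRing.Theory Num.Theory.
Local Open Scope ring_scope.

(** * Linear categories *)

Section Lincat.
Variables (K : fieldType) (C : lincat K).
Implicit Types X Y Z W : C.

Lemma cmpDl X Y Z (g g' : hom Y Z) (f : hom X Y) :
  (g + g') \oc f = g \oc f + g' \oc f.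
Proof. by have := cmp_linl 1 g g' f; rewrite !scale1r. Qed.

Lemma cmpDr X Y Z (g : hom Y Z) (f f' : hom X Y) :
  g \oc (f + f') = g \oc f + g \oc f'.
Proof. by have := cmp_linr 1 g f f'; rewrite !scale1r. Qed.

Lemma cmp0m X Y Z (f : hom X Y) : (0 : hom Y Z) \oc f = 0.
Proof. by apply: (addrI (0 \oc f)); rewrite -cmpDl !addr0. Qed.

Lemma cmpm0 X Y Z (g : hom Y Z) : g \oc (0 : hom X Y) = 0.
Proof. by apply: (addrI (g \oc 0)); rewrite -cmpDr !addr0. Qed.

Lemma cmpNm X Y Z (g : hom Y Z) (f : hom X Y) : (- g) \oc f = - (g \oc f).
Proof. by apply: (addrI (g \oc f)); rewrite -cmpDl !subrr cmp0m. Qed.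

Lemma cmpmN X Y Z (g : hom Y Z) (f : hom X Y) : g \oc (- f) = - (g \oc f).
Proof. by apply: (addrI (g \oc f)); rewrite -cmpDr !subrr cmpm0. Qed.

Lemma cmpZm X Y Z k (g : hom Y Z) (f : hom X Y) :
  (k *: g) \oc f = k *: (g \oc f).
Proof. by have := cmp_linl k g 0 f; rewrite !addr0 cmp0m addr0. Qed.

Lemma cmpmZ X Y Z k (g : hom Y Z) (f : hom X Y) :
  g \oc (k *: f) = k *: (g \oc f).
Proof. by have := cmp_linr k g f 0; rewrite !addr0 cmpm0 addr0. Qed.

Lemma zero_hom_from X Y (f : hom X Y) : is_zero X -> f = 0.
Proof. by move=> X0; rewrite -[f]cmpm1 (X0 : idm X = 0) cmpm0. Qed.

Lemma zero_hom_to X Y (f : hom X Y) : is_zero Y -> f = 0.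
Proof. by move=> Y0; rewrite -[f]cmp1m (Y0 : idm Y = 0) cmp0m. Qed.

Lemma isom_id X : isom (idm X).
Proof. by exists (idm X); rewrite cmp1m. Qed.

Lemma isom_comp X Y Z (g : hom Y Z) (f : hom X Y) :
  isom g -> isom f -> isom (g \oc f).
Proof.
move=> [g' [g'g gg']] [f' [f'f ff']]; exists (f' \oc g'); split.
  by rewrite -cmpA (cmpA g') g'g cmp1m.
by rewrite -cmpA (cmpA f) ff' cmp1m.
Qed.

Lemma isomorphic_refl X : isomorphic X X.
Proof. by exists (idm X); apply: isom_id. Qed.

Lemma isomorphic_sym X Y : isomorphic X Y -> isomorphic Y X.
Proof. by move=> [f [g [gf fg]]]; exists g; exists f. Qed.

Lemma isomorphic_trans X Y Z :
  isomorphic X Y -> isomorphic Y Z -> isomorphic X Z.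
Proof. by move=> [f If] [g Ig]; exists (g \oc f); apply: isom_comp. Qed.

Lemma isomorphic_class X Y : isomorphic X Y -> isomorphic X = isomorphic Y.
Proof.
move=> XY; apply/funext => Z; apply/propext; split; apply: isomorphic_trans.
  exact: isomorphic_sym.
exact: XY.
Qed.

Lemma is_zero_iso X Y : isomorphic X Y -> is_zero X -> is_zero Y.
Proof.
move=> [f [g [_ fg]]] X0; rewrite /is_zero -fg.
by rewrite (zero_hom_from f X0) cmp0m.
Qed.

Lemma isom_mono X Y (f : hom X Y) : isom f -> mono f.
Proof.
move=> [g [gf _]] W u v /(congr1 (cmp g)).
by rewrite !cmpA gf !cmp1m.
Qed.

Lemma isom_epi X Y (f : hom X Y) : isom f -> epi f.
Proof.
move=> [g [_ fg]] W u v /(congr1 (fun h => h \oc g)).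
by rewrite -!cmpA fg !cmpm1.
Qed.

Lemma epi_comp X Y Z (g : hom Y Z) (f : hom X Y) :
  epi g -> epi f -> epi (g \oc f).
Proof. by move=> Eg Ef W u v; rewrite !cmpA => /Ef /Eg. Qed.

Lemma mono_from0 X Y (f : hom X Y) :
  (forall W (g : hom W X), f \oc g = 0 -> g = 0) -> mono f.
Proof.
move=> f0 W g h fgh; apply/eqP; rewrite -subr_eq0; apply/eqP/f0.
by rewrite cmpDr cmpmN fgh subrr.
Qed.

Lemma kernel_mono X Y (f : hom X Y) N (i : hom N X) : is_kernel f i -> mono i.
Proof.
move=> [fi0 ker]; apply: mono_from0 => W g ig0.
have [h [_ hU]] := ker W 0 (cmpm0 _ _).
by rewrite -(hU _ ig0) -(hU 0) // cmpm0.
Qed.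

Lemma kernel_lift X Y (f : hom X Y) N (i : hom N X) W (g : hom W X) :
  is_kernel f i -> f \oc g = 0 -> exists h, i \oc h = g.
Proof. by move=> [_ ker] /ker [h [hE _]]; exists h. Qed.

Lemma is_kernel_mono X Y (f : hom X Y) N (i : hom N X) : mono i ->
  f \oc i = 0 ->
  (forall W (g : hom W X), f \oc g = 0 -> exists h, i \oc h = g) ->
  is_kernel f i.
Proof.
move=> Mi fi0 lift; split=> // W g /lift [h hE].
by exists h; split=> // h' h'E; apply: Mi; rewrite hE h'E.
Qed.

Lemma kernel_of_cokernel X Y Z Q (f : hom X Y) (g : hom Y Z) (p : hom Y Q) :
  is_kernel g f -> is_cokernel f p -> is_kernel p f.
Proof.
move=> kgf [pf0 cok]; have [gf0 _] := kgf.
have [g' [g'p _]] := cok _ g gf0.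
apply: is_kernel_mono (kernel_mono kgf) pf0 _ => W h ph0.
by apply: kernel_lift kgf _; rewrite -g'p -cmpA ph0 cmpm0.
Qed.

Lemma kernel_iso X Y (f : hom X Y) N N' (i : hom N X) (i' : hom N' X)
    (u : hom N' N) :
  is_kernel f i -> isom u -> i \oc u = i' -> is_kernel f i'.
Proof.
move=> kfi Iu <-; have [v [vu uv]] := Iu; have [fi0 _] := kfi.
apply: is_kernel_mono => [|| W g fg0].
- by move=> W g h; rewrite -!cmpA => /(kernel_mono kfi)/(isom_mono Iu).
- by rewrite cmpA fi0 cmp0m.
by have [h <-] := kernel_lift kfi fg0; exists (v \oc h); rewrite -cmpA (cmpA u) uv cmp1m.
Qed.

Lemma ses_split X Y Z (i : hom X Y) (p : hom Y Z) (r : hom Y X) (s : hom Z Y) :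
  r \oc i = idm X -> p \oc s = idm Z -> p \oc i = 0 ->
  i \oc r + s \oc p = idm Y -> ses i p.
Proof.
move=> ri ps pi0 E; split; split=> // W g g0.
  exists (r \oc g); split=> [|h <-]; last by rewrite cmpA ri cmp1m.
  by rewrite cmpA -[in RHS](cmp1m g) -E cmpDl -(cmpA s) g0 cmpm0 addr0.
exists (g \oc s); split=> [|h <-]; last by rewrite -cmpA ps cmpm1.
by rewrite -cmpA -[in RHS](cmpm1 g) -E cmpDr (cmpA g i) g0 cmp0m add0r.
Qed.

Lemma split_ses X Y Z (i : hom X Y) (p : hom Y Z) (s : hom Z Y) :
  ses i p -> p \oc s = idm Z ->
  exists r, [/\ r \oc i = idm X, p \oc i = 0 & i \oc r + s \oc p = idm Y].
Proof.
move=> [kpi cip] ps; have [pi0 _] := kpi.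
have [|r rE] := kernel_lift (g := idm Y - s \oc p) kpi.
  by rewrite cmpDr cmpmN cmpA ps cmp1m cmpm1 subrr.
exists r; split; rewrite ?rE ?subrK //.
apply: (kernel_mono kpi); rewrite cmpA rE cmpDl cmpNm cmp1m cmpm1.
by rewrite -cmpA pi0 cmpm0 subr0.
Qed.

Lemma ses_zero_l X Y Z (i : hom X Y) (p : hom Y Z) :
  ses i p -> is_zero X -> isom p.
Proof.
move=> [[pi0 _] [_ cok]] X0.
have [|g [gp _]] := cok _ (idm Y); first by rewrite cmp1m (zero_hom_from i).
have [h [_ hU]] := cok _ p pi0.
by exists g; split=> //; rewrite -(hU (p \oc g)) ?(hU (idm Z)) // ?cmp1m // -cmpA gp cmpm1.
Qed.

Lemma ses_zero_r X Y Z (i : hom X Y) (p : hom Y Z) :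
  ses i p -> is_zero Z -> isom i.
Proof.
move=> [kpi _] Z0; have [|g ig] := kernel_lift (g := idm Y) kpi.
  by rewrite cmpm1 (zero_hom_to p).
exists g; split=> //; apply: (kernel_mono kpi).
by rewrite cmpA ig cmp1m cmpm1.
Qed.

Lemma isom_ses X Y Z (f : hom X Y) : isom f -> is_zero Z ->
  ses f (0 : hom Y Z).
Proof.
move=> If Z0; have [g [gf fg]] := If; split; split; rewrite ?cmp0m // => W h h0.
  by exists (g \oc h); split=> [|h' <-]; rewrite cmpA ?fg ?gf cmp1m.
have -> : h = 0 by rewrite -[h]cmpm1 -fg cmpA h0 cmp0m.
by exists 0; split=> [|h' _]; rewrite ?cmp0m // (zero_hom_from h').
Qed.

Lemma filtered_iso (P : C -> Prop) X Y :
  isomorphic X Y -> filtered P X -> filtered P Y.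
Proof.
move=> XY FX; elim: FX Y XY => {X} [X X0 Y XY | X W' Z i p [kpi cip] FX _ PZ Y [f If]].
  exact/filtered_zero/(is_zero_iso XY).
have [g [gf fg]] := If; have [pi0 cok] := cip.
apply: (@filtered_ext _ _ _ X Y Z (f \oc i) (p \oc g)) => //; split.
  apply: is_kernel_mono.
  - by move=> W u v; rewrite -!cmpA => /(isom_mono If)/(kernel_mono kpi).
  - by rewrite -cmpA (cmpA g) gf cmp1m pi0.
  move=> W u; rewrite -cmpA => /(kernel_lift kpi) [h hE]; exists h.
  by rewrite -cmpA hE cmpA fg cmp1m.
split; first by rewrite -cmpA (cmpA g) gf cmp1m pi0.
move=> W u; rewrite cmpA => /cok [h [hE hU]]; exists h; split.
  by rewrite cmpA hE -cmpA fg cmpm1.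
by move=> h' h'E; apply: hU; rewrite -h'E -!cmpA gf cmpm1.
Qed.

Lemma filtered_sub (P Q : C -> Prop) X :
  (forall Y, P Y -> Q Y) -> filtered P X -> filtered Q X.
Proof.
move=> PQ; elim=> [Y /filtered_zero //|X' Y Z i p ip _ FX' PZ].
by apply: filtered_ext ip FX' _; apply: PQ.
Qed.

End Lincat.

(** ** Opposite category *)

Section Opposite.
Variables (K : fieldType).

(** Passing to the opposite category exchanges kernels with cokernels, so that
    only one half of each self-dual statement needs an argument. *)
Definition opcat (C : lincat K) : lincat K :=
  @LinCat K C (fun X Y => @hom K C Y X) (fun X => idm X)
    (fun X Y Z g f => f \oc g)
    (fun _ _ _ _ h g f => esym (cmpA f g h))
    (fun _ _ f => cmpm1 f) (fun _ _ f => cmp1m f)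
    (fun _ _ _ k g g' f => cmp_linr k f g g')
    (fun _ _ _ k g f f' => cmp_linl k f f' g).

Lemma abelian_op (C : lincat K) : abelian C -> abelian (opcat C).
Proof.
case=> z b k c m e; split.
- exact: z.
- move=> X Y; have [Z [i1 [i2 [p1 [p2 [? ? ? ? ?]]]]]] := b X Y.
  by exists Z, p1, p2, i1, i2; split.
- by move=> X Y f; have [Q [p]] := c Y X f; exists Q, p.
- by move=> X Y f; have [Q [p]] := k Y X f; exists Q, p.
- by move=> X Y f Mf; have [Z [g]] := e Y X f Mf; exists Z, g.
by move=> X Y f Mf; have [Z [g]] := m Y X f Mf; exists Z, g.
Qed.

Lemma ses_op (C : lincat K) X Y Z (i : @hom K C X Y) (p : @hom K C Y Z) :
  ses i p <-> @ses K (opcat C) Z Y X p i.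
Proof. by split=> -[k c]; split. Qed.

Lemma serre_op (C : lincat K) S : @serre K C S -> @serre K (opcat C) S.
Proof.
move=> [S0 Sses]; split=> // X Y Z i p ip.
have := Sses Z Y X p i; rewrite and_comm; apply.
exact/ses_op.
Qed.

End Opposite.

(** ** Serre subcategories of abelian categories *)

Section SerreFull.
Variables (K : fieldType) (C : lincat K).
Hypothesis abC : abelian C.

Lemma serre_iso (S : C -> Prop) (X Y : C) :
  serre S -> isomorphic X Y -> S X -> S Y.
Proof.
move=> [S0 Sses] [f If] SX; have [Z Z0] := ab_zero abC.
by apply/(Sses _ _ _ _ _ (isom_ses If Z0)); split=> //; apply: S0.
Qed.

Lemma mono_ses (X Y : C) (f : hom X Y) : mono f ->
  exists Q (p : hom Y Q), ses f p.
Proof.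
move=> Mf; have [Z [g kgf]] := ab_mono abC Mf.
have [Q [p cfp]] := ab_cokernel abC f; exists Q, p; split=> //.
exact: kernel_of_cokernel kgf cfp.
Qed.

Lemma serre_sub (S : C -> Prop) (X Y : C) (f : hom X Y) :
  serre S -> mono f -> S Y -> S X.
Proof. by move=> [_ Sses] /mono_ses [Q [p /Sses ->]] []. Qed.

Variable S : C -> Prop.
Hypothesis serS : serre S.
Let FS := fullsub S.

Lemma fullsub_kernelE (X Y N : FS) (f : hom X Y) (i : hom N X) :
  is_kernel f i <-> @is_kernel K C (sval X) (sval Y) f (sval N) i.
Proof.
split=> [[fi0 ker] | [fi0 ker]]; last by split=> // W g; apply: ker.
pose fC : @hom K C (sval X) (sval Y) := f.
pose iC : @hom K C (sval N) (sval X) := i.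
have [N0 [j kfj]] := ab_kernel abC fC.
have SN0 := serre_sub serS (kernel_mono kfj) (svalP X).
have [u [iu _]] := ker (exist _ N0 SN0) j (proj1 kfj).
have [v jv] := kernel_lift (g := iC) kfj fi0.
pose uC : @hom K C N0 (sval N) := u.
have {}iu : iC \oc uC = j by exact: iu.
have uv : uC \oc v = idm (sval N).
  have [w [_ wU]] := ker N i fi0.
  have wid : w = idm (sval N) by apply/wU/(cmpm1 iC).
  have wuv : w = uC \oc v.
    by apply: wU; change (iC \oc (uC \oc v) = iC); rewrite cmpA iu jv.
  by rewrite -wuv wid.
have vu : v \oc uC = idm N0.
  by apply: (kernel_mono kfj); rewrite cmpA jv cmpm1.
by apply: kernel_iso kfj _ jv; exists uC.
Qed.

End SerreFull.

Section SerreFullAbelian.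
Variables (K : fieldType) (C : lincat K).
Hypothesis abC : abelian C.
Variable S : C -> Prop.
Hypothesis serS : serre S.
Let FS := fullsub S.

Lemma fullsub_cokernelE (X Y Q : FS) (f : hom X Y) (p : hom Y Q) :
  is_cokernel f p <-> @is_cokernel K C (sval X) (sval Y) f (sval Q) p.
Proof.
exact: (@fullsub_kernelE K (opcat C) (abelian_op abC) S (serre_op serS)).
Qed.

Lemma fullsub_sesE (X Y Z : FS) (i : hom X Y) (p : hom Y Z) :
  ses i p <-> @ses K C (sval X) (sval Y) (sval Z) i p.
Proof.
by rewrite /ses fullsub_cokernelE (fullsub_kernelE abC).
Qed.

Lemma fullsub_ker (X Y : FS) (f : hom X Y) :
  exists N (i : hom N X), is_kernel f i.
Proof.
have [N [i ki]] := @ab_kernel _ _ abC (sval X) (sval Y) f.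
have SN := serre_sub abC serS (kernel_mono ki) (svalP X).
by exists (exist _ N SN), i; apply/(fullsub_kernelE abC).
Qed.

Lemma fullsub_mono_kernel (X Y : FS) (f : hom X Y) :
  (exists Q (p : hom Y Q), is_cokernel f p) -> mono f ->
  exists Z (g : hom Y Z), is_kernel g f.
Proof.
move=> [Q [p cp]] Mf; have [N [i ki]] := fullsub_ker f.
have MfC : @mono K C (sval X) (sval Y) f.
  apply: mono_from0 => W g fg0.
  have [h <-] := kernel_lift (proj1 (fullsub_kernelE abC serS _ _) ki) fg0.
  have -> : i = 0 by apply: Mf; rewrite cmpm0; apply: (proj1 ki).
  by rewrite cmp0m.
have [Z [g kg]] := ab_mono abC MfC; exists Q, p.
apply/(fullsub_kernelE abC) => //; apply: kernel_of_cokernel kg _.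
exact/fullsub_cokernelE.
Qed.

End SerreFullAbelian.

Lemma fullsub_isom (K : fieldType) (C : lincat K) (S : C -> Prop)
    (X Y : fullsub S) (f : hom X Y) :
  @isom K C (sval X) (sval Y) f -> isom f.
Proof. by move=> [g gE]; exists g. Qed.

Lemma fullsub_abelian (K : fieldType) (C : lincat K) (S : C -> Prop) :
  abelian C -> serre S -> abelian (fullsub S).
Proof.
move=> abC serS; have abO := abelian_op abC; have serO := serre_op serS.
have cok (X Y : fullsub S) (f : hom X Y) :
    exists Q (p : hom Y Q), is_cokernel f p.
  exact: (@fullsub_ker K (opcat C) abO S serO Y X f).
split=> //.
- by have [Z Z0] := ab_zero abC; exists (exist _ Z (proj1 serS Z Z0)).
- move=> X Y; have [Z bZ] := ab_biproduct abC (sval X) (sval Y).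
  have [i1 [i2 [p1 [p2 [p11 p22 p12 p21 E]]]]] := bZ.
  have s12 : ses i1 p2 by apply: ses_split p11 p22 p21 E.
  have SZ : S Z by apply/(proj2 serS _ _ _ _ _ s12); split; apply: svalP.
  by exists (exist _ Z SZ).
- by move=> X Y f; apply: fullsub_ker.
- by move=> X Y f Mf; apply: (fullsub_mono_kernel abC).
move=> X Y f Ef.
exact: (@fullsub_mono_kernel K (opcat C) abO S serO Y X f
          (@fullsub_ker K C abC S serS X Y f) Ef).
Qed.

(** Image factorization. The induced map [m] is a monomorphism because an
    epimorphism out of the coimage that [m] factors through has, after
    composition with [e], the same kernel as [e]. *)
Lemma abelian_factor (K : fieldType) (C : lincat K) (X Y : C) (f : hom X Y) :
  abelian C -> exists N I Q (k : hom N X) (e : hom X I) (m : hom I Y)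
    (c : hom Y Q), [/\ ses k e, ses m c & m \oc e = f].
Proof.
move=> abC; have [N [k kf]] := ab_kernel abC f.
have [I [e ce]] := ab_cokernel abC k.
have [m [mE _]] := proj2 ce _ f (proj1 kf).
have [Q [c cm]] := ab_cokernel abC m.
have ske : ses k e by split=> //; apply: kernel_of_cokernel kf ce.
have Ee : epi e := @kernel_mono K (opcat C) _ _ _ _ _ ce.
have Mm : mono m.
  apply: mono_from0 => W w mw0.
  have [R [q cq]] := ab_cokernel abC w.
  have Eq : epi q := @kernel_mono K (opcat C) _ _ _ _ _ cq.
  have [m' [m'q _]] := proj2 cq _ m mw0.
  have [H [h ch]] := ab_epi abC (epi_comp Eq Ee).
  have fh0 : f \oc h = 0.
    by rewrite -mE -m'q -!cmpA [q \oc (e \oc h)]cmpA (proj1 ch) cmpm0.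
  have [h' h'E] := kernel_lift kf fh0.
  have eh0 : e \oc h = 0 by rewrite -h'E cmpA (proj1 ce) cmp0m.
  have [s [sE _]] := proj2 ch _ e eh0.
  have sq : s \oc q = idm I by apply: Ee; rewrite -cmpA sE cmp1m.
  by rewrite -[w]cmp1m -sq -cmpA (proj1 cq) cmpm0.
have [Z [g kg]] := ab_mono abC Mm.
exists N, I, Q, k, e, m, c; split=> //; split=> //.
exact: kernel_of_cokernel kg cm.
Qed.

(** ** Serre quotients with a fully faithful exact left adjoint *)

Section Functors.
Variables (K : fieldType) (C D : lincat K) (F : functor C D).

Lemma fmapD X Y (f g : @hom K C X Y) : fmap F (f + g) = fmap F f + fmap F g.
Proof. by have := fmap_lin F 1 f g; rewrite !scale1r. Qed.

Lemma fmap0 X Y : fmap F (0 : @hom K C X Y) = 0.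
Proof. by apply: (addrI (fmap F 0)); rewrite -fmapD !addr0. Qed.

Lemma fmap_isom X Y (f : @hom K C X Y) : isom f -> isom (fmap F f).
Proof.
by move=> [g [gf fg]]; exists (fmap F g); rewrite -!fmapM gf fg !fmap1.
Qed.

(** A linear functor preserves the equations of a splitting. *)
Lemma split_exact :
  (forall X Y Z (i : @hom K C X Y) (p : hom Y Z), ses i p ->
     exists s, p \oc s = idm Z) -> exact F.
Proof.
move=> spl X Y Z i p ip; have [s ps] := spl _ _ _ _ _ ip.
have [r [ri pi0 E]] := split_ses ip ps.
by apply: (@ses_split _ _ _ _ _ _ _ (fmap F r) (fmap F s));
  rewrite -!fmapM ?ri ?ps ?pi0 ?fmap1 ?fmap0 // -fmapD E fmap1.
Qed.

End Functors.

(** In the factorization of [f] through its image both factors become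
    invertible: the kernel of the first and the cokernel of the second are
    killed. *)
Lemma exact_isom (K : fieldType) (C D : lincat K) (F : functor C D) X Y
    (f : hom X Y) : abelian C -> exact F ->
  (forall N (k : hom N X), is_kernel f k -> is_zero (F N)) ->
  (forall Q (c : hom Y Q), is_cokernel f c -> is_zero (F Q)) ->
  isom (fmap F f).
Proof.
move=> abC exF kerf cokf.
have [N [I [Q [k [e [m [c [ske smc mE]]]]]]]] := abelian_factor f abC.
have [kek cke] := ske; have [kmc cmc] := smc.
have Ee : epi e := @kernel_mono K (opcat C) _ _ _ _ _ cke.
have kfk : is_kernel f k.
  apply: is_kernel_mono (kernel_mono kek) _ _ => [|W g].
    by rewrite -mE -cmpA (proj1 kek) cmpm0.
  rewrite -mE -cmpA -(cmpm0 _ m) => /(kernel_mono kmc).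
  exact: kernel_lift.
have cfc : is_cokernel f c.
  split=> [|W g]; first by rewrite -mE cmpA (proj1 cmc) cmp0m.
  by rewrite -mE cmpA -(cmp0m _ e) => /Ee; apply: (proj2 cmc).
rewrite -mE fmapM; apply: isom_comp.
  exact: ses_zero_r (exF _ _ _ _ _ smc) (cokf _ _ cfc).
exact: ses_zero_l (exF _ _ _ _ _ ske) (kerf _ _ kfk).
Qed.

Section SerreQuotient.
Variables (K : fieldType) (C D : lincat K).
Variables (pi : functor C D) (Del : functor D C).
Hypotheses (abC : abelian C) (abD : abelian D).
Hypotheses (exPi : exact pi) (exDel : exact Del).
Variable eta : forall X : D, hom X (pi (Del X)).
Hypothesis etaN : forall X Y (f : @hom K D X Y),
  eta Y \oc f = fmap pi (fmap Del f) \oc eta X.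
Hypothesis etaU : forall (X : D) (Y : C) (f : hom X (pi Y)),
  exists! g : hom (Del X) Y, fmap pi g \oc eta X = f.
Hypothesis etaI : forall X, isom (eta X).
Variable S : C -> Prop.
Hypothesis SE : forall X, S X <-> is_zero (pi X).

Let counit_ex M : {e : hom (Del (pi M)) M | fmap pi e \oc eta (pi M) = idm (pi M)}.
Proof. by apply: cid; have [g [gE _]] := etaU (idm (pi M)); exists g. Qed.
Let eps M := sval (counit_ex M).
Let epsE M : fmap pi (eps M) \oc eta (pi M) = idm (pi M).
Proof. exact: svalP (counit_ex M). Qed.

Let epsN M N (f : @hom K C M N) :
  f \oc eps M = eps N \oc fmap Del (fmap pi f).
Proof.
have [g [_ gU]] := etaU (fmap pi f).
rewrite -(gU (f \oc eps M)); last by rewrite fmapM -cmpA epsE cmpm1.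
by apply: gU; rewrite fmapM -cmpA -etaN cmpA epsE cmp1m.
Qed.

Let piEpsI M : isom (fmap pi (eps M)).
Proof.
have [g [gE Eg]] := etaI (pi M).
have <- : g = fmap pi (eps M).
  by rewrite -[RHS]cmpm1 -Eg cmpA epsE cmp1m.
by exists (eta (pi M)).
Qed.

(** If an exact functor [F] kills [S] then it inverts the counit
    [Del (pi M) -> M], whose kernel and cokernel lie in [S]; hence [F] is
    isomorphic to [F Del pi]. Since the unit is invertible, every object of [D]
    is in the image of [pi] up to isomorphism, so transformations between
    functors on [D] are determined by their values on this image. *)
Lemma adjoint_serre_quotient : serre_quotient S pi.
Proof.
have kerS X Y (f : @hom K C X Y) : isom (fmap pi f) ->
    (forall N (k : hom N X), is_kernel f k -> S N) /\
    (forall Q (c : hom Y Q), is_cokernel f c -> S Q).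
  move=> If; split=> [N k kk | Q c kc]; apply/SE.
    have := kernel_mono kk => /(mono_ses abC) [Q [p skp]].
    have [+ _] := exPi skp; move=> kpk; have Mk := kernel_mono kpk.
    apply: (Mk); apply: (isom_mono If).
    by rewrite cmpm1 cmpm0 cmpm0 -fmapM (proj1 kk) fmap0.
  have Ec : epi c := @kernel_mono K (opcat C) _ _ _ _ _ kc.
  have [N [k /ses_op skc]] := @mono_ses K (opcat C) (abelian_op abC) _ _ c Ec.
  have [_ kpc] := exPi skc.
  have Epc : epi (fmap pi c) := @kernel_mono K (opcat D) _ _ _ _ _ kpc.
  apply: (Epc); apply: (isom_epi If).
  by rewrite cmp1m !cmp0m -fmapM (proj1 kc) fmap0.
split=> //.
- by move=> X /SE.
- move=> E F abE exF F0; exists (fcomp F Del); split.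
    by move=> X Y Z i p /exDel /exF.
  exists (fun M => fmap F (eps M)); split=> [M N f | M] /=.
    by rewrite -!fmapM -epsN.
  have [kS cS] := kerS _ _ _ (piEpsI M).
  by apply: exact_isom => // [N k /kS|Q c /cS]; apply: F0.
move=> E G G' abE exG exG' a aN.
have inv (X : D) : {g | g \oc fmap G' (eta X) = idm (G' X) /\
                        fmap G' (eta X) \oc g = idm _}.
  exact/cid/fmap_isom/etaI.
(* The only possible value at [Y]: [a (Del Y)] transported along [eta Y]. *)
pose b Y := sval (inv Y) \oc a (Del Y) \oc fmap G (eta Y).
have bE Y : fmap G' (eta Y) \oc b Y = a (Del Y) \oc fmap G (eta Y).
  by rewrite /b !cmpA (proj2 (svalP (inv Y))) cmp1m.
have G'M Y : mono (fmap G' (eta Y)) by apply/isom_mono/fmap_isom/etaI.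
exists b; split=> [X Y f | X | b' b'N b'E Y].
- apply: G'M; rewrite cmpA bE -cmpA -fmapM etaN fmapM cmpA.
  have /= -> := aN _ _ (fmap Del f).
  by rewrite -cmpA -bE !cmpA -!fmapM etaN.
- apply: G'M; rewrite bE.
  have aX := aN _ _ (eps X); rewrite /= in aX.
  apply: (isom_mono (fmap_isom G' (piEpsI X))).
  rewrite !cmpA -aX -cmpA -fmapM epsE fmap1 cmpm1.
  by rewrite -fmapM epsE fmap1 cmp1m.
apply: G'M; rewrite bE -b'E.
by have := b'N _ _ (eta Y); rewrite /= => <-.
Qed.

End SerreQuotient.

(** * Homogeneous components *)

Section Components.
Variables (M : zmodType) (V : int -> M -> Prop).

(** The family [c] of the homogeneous components of [x]. The finite set of
    indices is kept separate from [c], so that it can be enlarged at will. *)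
Definition component_family (x : M) (c : int -> M) :=
  (forall i, V i (c i)) /\
  exists s, [/\ uniq s, forall i, i \notin s -> c i = 0 & x = \sum_(i <- s) c i].

Lemma sum_finsupp (s s' : seq int) (c : int -> M) : uniq s -> uniq s' ->
  (forall i, i \notin s -> c i = 0) -> {subset s <= s'} ->
  \sum_(i <- s') c i = \sum_(i <- s) c i.
Proof.
move=> us us' c0 ss'; rewrite (bigID (mem s)) /= [X in _ + X]big1 ?addr0.
  rewrite -big_filter; apply: perm_big; apply: uniq_perm => // [|i].
    exact: filter_uniq.
  by rewrite mem_filter andb_idr //; apply: ss'.
by move=> i /c0.
Qed.

Hypothesis V0 : forall i, V i 0.
Hypothesis VB : forall i x y, V i x -> V i y -> V i (x - y).

Lemma component_familyB x y c d : component_family x c ->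
  component_family y d -> component_family (x - y) (fun i => c i - d i).
Proof.
move=> [Vc [s [us c0 ->]]] [Vd [t [ut d0 ->]]]; split=> [i|]; first exact: VB.
exists (undup (s ++ t)); split; first exact: undup_uniq.
  by move=> i; rewrite mem_undup mem_cat negb_or => /andP[/c0-> /d0->]; rewrite subr0.
rewrite sumrB; congr (_ - _); apply/esym/sum_finsupp => //;
  by rewrite ?undup_uniq // => i it; rewrite mem_undup mem_cat it ?orbT.
Qed.

Hypothesis dV : direct_sum V.

Lemma component_family_uniq x c d : component_family x c ->
  component_family x d -> c =1 d.
Proof.
move=> xc /(component_familyB xc); rewrite subrr => -[Vcd [s [us cd0 E]]] i.
apply/eqP; rewrite -subr_eq0; apply/eqP.
have [is_|/cd0 //] := boolP (i \in s).
exact: (proj2 dV s (fun i => c i - d i)) is_.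
Qed.

Lemma component_family_ex x : exists c, component_family x c.
Proof.
have [[s [f [_ Vf ->]]] _] := (proj1 dV x, tt).
have VN i y : V i y -> V i (- y) by rewrite -sub0r; apply: VB.
have VM i y n : V i y -> V i (y *+ n).
  move=> Vy; elim: n => [//|n IH].
  by rewrite mulrS -[y *+ n]opprK; apply/VB/VN.
exists (fun i => f i *+ count_mem i s); split=> [i|]; first exact: VM.
exists (undup s); split; first exact: undup_uniq.
  by move=> i; rewrite mem_undup => /count_memPn ->.
by rewrite -big_undup_iterop_count.
Qed.

Definition component (i : int) (x : M) : M := projT1 (cid (component_family_ex x)) i.

Lemma componentP x : component_family x (component^~ x).
Proof. by rewrite /component; case: (cid _). Qed.

Lemma component_deg i x : V i (component i x).
Proof. exact: (proj1 (componentP x)). Qed.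

Lemma component_uniq x c i : component_family x c -> component i x = c i.
Proof. by move=> xc; apply: (component_family_uniq (componentP x) xc). Qed.

Lemma component_homog i x : V i x -> forall j, component j x = if j == i then x else 0.
Proof.
move=> Vx j; apply: (@component_uniq _ (fun j => if j == i then x else 0)).
split=> [k|]; first by case: eqP => [->|].
exists [:: i]; split=> // [k|]; first by rewrite inE; case: eqP.
by rewrite big_seq1 eqxx.
Qed.

Lemma componentB i : {morph component i : x y / x - y}.
Proof.
move=> x y; apply: (component_uniq _ (component_familyB (componentP x) (componentP y))).
Qed.

Lemma component_sum x :
  exists s, [/\ uniq s, forall i, i \notin s -> component i x = 0
    & x = \sum_(i <- s) component i x].
Proof. exact: (proj2 (componentP x)). Qed.

End Components.

(** Gradings are constructed below from their projections [c]: applying [c j]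
    to a relation between homogeneous elements isolates the term of degree
    [j]. *)
Lemma direct_sum_components (M : zmodType) (V : int -> M -> Prop)
    (c : int -> {additive M -> M}) :
  (forall i x, V i (c i x)) ->
  (forall x, exists s, x = \sum_(i <- s) c i x) ->
  (forall i x, V i x -> forall j, c j x = if j == i then x else 0) ->
  direct_sum V.
Proof.
move=> Vc sumc cV; split=> [x | s f us Vf f0 i is_].
  by have [s xE] := sumc x; exists s, (c^~ x); split=> //; apply/allP.
have /(congr1 (c i)) := f0; rewrite raddf0 raddf_sum (bigD1_seq i) //= big1.
  by rewrite addr0 (cV _ _ (Vf i)) eqxx.
by move=> j ji; rewrite (cV _ _ (Vf j)) eq_sym (negPf ji).
Qed.

Section PropSpace.
Variables (K : fieldType) (V : vectType K) (P : V -> Prop).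

Definition subspace_pred :=
  P 0 /\ forall (k : K) x y, P x -> P y -> P (k *: x + y).

Lemma vspace_of_ex : subspace_pred -> exists U : {vspace V}, forall x, x \in U <-> P x.
Proof.
move=> [P0 PL].
(* A subspace of maximal dimension inside [P] is all of [P]. *)
pose Q n := `[< exists2 U : {vspace V}, (forall x, x \in U -> P x) & \dim U = n >].
have Q0 : exists n, Q n.
  exists 0%N; apply/asboolP; exists 0%VS; last exact: dimv0.
  by move=> x; rewrite memv0 => /eqP ->.
have Qb n : Q n -> (n <= \dim {:V})%N.
  by move=> /asboolP[U _ <-]; apply/dimvS/subvf.
case: (ex_maxnP Q0 Qb) => n /asboolP[U UP dU] nmax.
exists U => x; split=> [/UP //|Px]; apply: contraT => xU.
have /nmax : Q (\dim (<[x]> + U)%VS).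
  apply/asboolP; exists (<[x]> + U)%VS => // y.
  by move=> /memv_addP[_ /vlineP[k ->] [u uU ->]]; apply: PL => //; apply: UP.
rewrite leqNgt -dU => /negP[].
have sU : (U <= <[x]> + U)%VS by exact: addvSr.
rewrite (ltn_leqif (dimv_leqif_sup sU)).
by apply: contra xU; apply: subv_trans; apply: addvSl.
Qed.

(** Submodules and homogeneous parts are described by predicates, but compared
    through their dimensions; this is the passage from the former to the
    latter. The value 0 off the subspace predicates only makes it total. *)
Definition vspace_of : {vspace V} :=
  if pselect subspace_pred is left h then projT1 (cid (vspace_of_ex h)) else 0%VS.

Lemma vspace_ofP : subspace_pred -> forall x, x \in vspace_of <-> P x.
Proof. by rewrite /vspace_of; case: pselect => // h _; case: (cid _). Qed.

End PropSpace.

Section Generators.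
Variables (B : nzRingType) (N : lmodType B).

Lemma gfg_ord n (e : 'I_n -> N) :
  (forall x, exists c : 'I_n -> B, x = \sum_i c i *: e i) ->
  exists s : seq N, forall x, exists c : N -> B, x = \sum_(g <- s) c g *: g.
Proof.
move=> gen; exists (undup [seq e i | i : 'I_n]) => x.
have [c ->] := gen x; exists (fun g => \sum_(i | e i == g) c i).
under [RHS]eq_bigr do rewrite scaler_suml.
rewrite (exchange_big_dep xpredT) //=; apply: eq_bigr => i _.
rewrite -big_filter (@perm_big _ _ _ _ _ [:: e i]) ?big_seq1 //=.
apply: uniq_perm; rewrite ?filter_uniq ?undup_uniq // => g.
rewrite mem_filter mem_undup inE eq_sym; case: eqP => //= ->.
by rewrite map_f // mem_enum.
Qed.

End Generators.

Import VectorInternalTheory.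

(** The coordinates are those of a complement of the kernel of the map that the
    generators define. *)
Lemma finite_span_axiom (K : fieldType) (V : lmodType K) n (e : 'I_n -> V) :
  (forall x, exists c : 'I_n -> K, x = \sum_i c i *: e i) ->
  exists d (f : V -> 'rV[K]_d), linear f /\ bijective f.
Proof.
move=> gen; pose phi (v : 'rV[K]_n) := \sum_i v 0 i *: e i.
have phiL : linear phi.
  move=> k u v; rewrite /phi scaler_sumr -big_split; apply: eq_bigr => i _ /=.
  by rewrite !mxE scalerDl scalerA.
have phi0 : phi 0 = 0.
  by rewrite /phi big1 // => i _; rewrite mxE scale0r.
have phiB u v : phi (u - v) = phi u - phi v.
  by have := phiL (-1) v u; rewrite !scaleN1r !(addrC (- _)).
have kerP : subspace_pred (fun v => phi v = 0).
  by split=> // k u v u0 v0; rewrite phiL u0 v0 scaler0 addr0.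
pose U := vspace_of (fun v => phi v = 0); have UP := vspace_ofP kerP.
have exw x : {w : subvs_of U^C | phi (vsval w) = x}.
  apply: cid; have [c ->] := gen x; pose v := \row_i c i.
  exists (vsproj _ (v - projv U v)); rewrite vsprojK ?memv_projC // phiB.
  have /UP -> := memv_proj U v; rewrite subr0.
  by apply: eq_bigr => i _; rewrite mxE.
pose g x := sval (exw x); have gE x : phi (vsval (g x)) = x := svalP (exw x).
have inj : injective (fun w : subvs_of U^C => phi (vsval w)).
  move=> w w' ww'; apply/subvs_inj/eqP; rewrite -subr_eq0 -memv0.
  rewrite -(capv_compl U) memv_cap; apply/andP; split.
    by apply/UP; rewrite phiB ww' subrr.
  by rewrite rpredB ?subvsP.
have gK w : g (phi (vsval w)) = w by apply: inj; rewrite gE.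
exists _, (fun x => v2r (g x)); split.
  move=> k x y; rewrite -linearP; congr v2r; apply: inj.
  by rewrite gE linearP /= phiL !gE.
exists (fun r => phi (vsval (r2v r))) => [x|r]; first by rewrite v2rK gE.
by rewrite gK r2vK.
Qed.

(** * Graded modules *)

Section GradedModules.
Variables (K : fieldType) (A : falgType K) (Ac : int -> {vspace A}).
Implicit Types M N P : gmod Ac.

Lemma gdegB M i (x y : M) : gdeg i x -> gdeg i y -> gdeg i (x - y).
Proof. by move=> xi /gdegN; apply: gdegD. Qed.

Definition gc M i : M -> M :=
  component (@gdeg0 _ _ _ M) (@gdegB M) (@gdeg_direct _ _ _ M) i.

Lemma gc_is_additive M i : {morph @gc M i : x y / x - y}.
Proof. exact: componentB. Qed.

HB.instance Definition _ M i :=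
  GRing.isZmodMorphism.Build M M (@gc M i) (@gc_is_additive M i).

Lemma gc_deg M i (x : M) : gdeg i (gc i x).
Proof. exact: component_deg. Qed.

Lemma gc_homog M i (x : M) : gdeg i x -> forall j, gc j x = if j == i then x else 0.
Proof. exact: component_homog. Qed.

Lemma gc_id M i (x : M) : gdeg i x -> gc i x = x.
Proof. by move=> /gc_homog ->; rewrite eqxx. Qed.

Lemma gc_sum M (x : M) : exists s, [/\ uniq s,
  forall i, i \notin s -> gc i x = 0 & x = \sum_(i <- s) gc i x].
Proof. exact: component_sum. Qed.

Lemma gc_eq0 M (x : M) : (forall i, gc i x = 0) -> x = 0.
Proof. by move=> x0; have [s [_ _ ->]] := gc_sum x; apply: big1. Qed.

Lemma gc_gc M i j (x : M) : gc j (gc i x) = if j == i then gc i x else 0.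
Proof. exact/gc_homog/gc_deg. Qed.

Lemma gdegE M i (x : M) : gdeg i x <-> gc i x = x.
Proof. by split=> [/gc_id //|<-]; apply: gc_deg. Qed.

Lemma gdeg_uniq M i j (x : M) : gdeg i x -> gdeg j x -> i != j -> x = 0.
Proof. by move=> /gc_homog xi /gc_id <- ij; rewrite xi eq_sym (negPf ij). Qed.

Lemma gdeg_sum M i I (r : seq I) (P : pred I) (F : I -> M) :
  (forall j, P j -> gdeg i (F j)) -> gdeg i (\sum_(j <- r | P j) F j).
Proof. by move=> FP; elim/big_rec: _ => [|j x /FP]; [apply: gdeg0 | apply: gdegD]. Qed.

(** [M] as a vector space over [K]. The scalar action of [gcar M] is that of
    [A], so the action of [K] needs another name for the same carrier. *)
Definition kcar M : Type := gcar M.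
HB.instance Definition _ M := GRing.Zmodule.copy (kcar M) (gcar M).

Definition kscale M (k : K) (x : kcar M) : kcar M := k%:A *: (x : gcar M).
Fact kscaleA M a b (x : kcar M) : kscale a (kscale b x) = kscale (a * b) x.
Proof. by rewrite /kscale scalerA -scalerAl mul1r scalerA. Qed.
Fact kscale1 M : left_id 1 (@kscale M).
Proof. by move=> x; rewrite /kscale !scale1r. Qed.
Fact kscaleDr M : right_distributive (@kscale M) +%R.
Proof. by move=> k x y; rewrite /kscale scalerDr. Qed.
Fact kscaleDl M x : {morph (@kscale M)^~ x : a b / a + b}.
Proof. by move=> a b; rewrite /kscale !scalerDl. Qed.
HB.instance Definition _ M := GRing.Zmodule_isLmodule.Build K (kcar M)
  (@kscaleA M) (@kscale1 M) (@kscaleDr M) (@kscaleDl M).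

Lemma kscaleE M (k : K) (x : kcar M) : k *: x = (k%:A : A) *: (x : gcar M).
Proof. by []. Qed.

Lemma scalerAk M (k : K) a (x : M) : (k *: a) *: x = k%:A *: (a *: x).
Proof. by rewrite scalerA -scalerAl mul1r. Qed.

Lemma scalerCk M (k : K) a (x : M) : a *: (k%:A *: x) = k%:A *: (a *: x).
Proof. by rewrite !scalerA -scalerAl -scalerAr mul1r mulr1. Qed.

Lemma kcar_span M : exists n (e : 'I_n -> kcar M),
  forall x, exists c : 'I_n -> K, x = \sum_i c i *: e i.
Proof.
have [s gen] := gfg M; pose b := vbasis {:A}.
pose J := ('I_(size s) * 'I_(\dim {:A}))%type.
pose e (ij : J) : kcar M := b`_ij.2 *: (s`_ij.1 : M).
exists #|{: J}|, (fun k => e (enum_val k)) => x; have [c ->] := gen x.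
pose d (ij : J) : K := coord b ij.2 (c s`_ij.1).
exists (fun k => d (enum_val k)).
rewrite [RHS](reindex _ (onW_bij _ (@enum_rank_bij J))) /=.
under [RHS]eq_bigr do rewrite enum_rankK.
rewrite (big_nth 0) big_mkord -(pair_bigA _ (fun i j => d (i, j) *: e (i, j))) /=.
apply: eq_bigr => i _; rewrite {1}(coord_vbasis (memvf (c _))) scaler_suml.
by apply: eq_bigr => j _; rewrite kscaleE /= scalerAk.
Qed.

Fact kcar_axiom M : {d : nat & Vector.axiom d (kcar M)}.
Proof.
have [n /cid[e gen]] := cid (kcar_span M).
have [d /cid[f [fL fB]]] := cid (finite_span_axiom gen).
by exists d, f.
Qed.
HB.instance Definition _ M :=
  Lmodule_hasFinDim.Build K (kcar M) (projT2 (kcar_axiom M)).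

Definition gdim M := \dim {:kcar M}.
End GradedModules.

(** ** Modules from actions *)

Section ActionModule.
Variables (B : nzRingType) (W : zmodType) (act : B -> W -> W).

Record is_action : Prop := IsAction {
  act_comp : forall a b w, act a (act b w) = act (a * b) w;
  act_one : left_id 1 act;
  actDr : right_distributive act +%R;
  actDl : forall w, {morph act^~ w : a b / a + b} }.

Definition action_car of is_action : Type := W.
Variable h : is_action.
HB.instance Definition _ := GRing.Zmodule.copy (action_car h) W.
HB.instance Definition _ := GRing.Zmodule_isLmodule.Build B (action_car h)
  (act_comp h) (act_one h) (actDr h) (actDl h).
End ActionModule.

Section Constructions.
Variables (K : fieldType) (A : falgType K) (Ac : int -> {vspace A}).
Hypothesis gA : graded_algebra Ac.
Implicit Types M N P : gmod Ac.

Let AcB i (a b : A) : a \in Ac i -> b \in Ac i -> a - b \in Ac i.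
Proof. exact: rpredB. Qed.
Let Ac0 i : (0 : A) \in Ac i. Proof. exact: rpred0. Qed.
Let dA : direct_sum (fun i a => a \in Ac i). Proof. by case: gA. Qed.

Lemma Ac1 : 1 \in Ac 0. Proof. by case: gA. Qed.
Lemma AcM i j (a b : A) : a \in Ac i -> b \in Ac j -> a * b \in Ac (i + j).
Proof. by case: gA => _ _ /(_ i j)/subvP AM ai bj; apply/AM/memv_mul. Qed.

Definition ac i : A -> A := component (M := A) Ac0 AcB dA i.

Lemma ac_is_additive i : {morph ac i : x y / x - y}.
Proof. exact: componentB. Qed.
HB.instance Definition _ i := GRing.isZmodMorphism.Build A A (ac i) (@ac_is_additive i).

Lemma ac_deg i a : ac i a \in Ac i.
Proof. exact: (component_deg (M := A) Ac0 AcB dA). Qed.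
Lemma ac_homog i a : a \in Ac i -> forall j, ac j a = if j == i then a else 0.
Proof. exact: (component_homog (M := A) Ac0 AcB dA). Qed.
Lemma ac_sum a : exists s, [/\ uniq s, forall i, i \notin s -> ac i a = 0
  & a = \sum_(i <- s) ac i a].
Proof. exact: (component_sum (M := A) Ac0 AcB dA). Qed.

Lemma homog_ind (P : A -> Prop) : P 0 -> (forall a b, P a -> P b -> P (a + b)) ->
  (forall i a, a \in Ac i -> P a) -> forall a, P a.
Proof.
move=> P0 PD Ph a; have [s [_ _ ->]] := ac_sum a.
by elim/big_rec: _ => // i x _; apply/PD/Ph/ac_deg.
Qed.

Lemma gc_scale M i k a (x : M) : a \in Ac i -> gc k (a *: x) = a *: gc (k - i) x.
Proof.
move=> ai; have [s [us s0 xE]] := gc_sum x.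
rewrite {1}xE scaler_sumr raddf_sum /=.
under eq_bigr => i' _ do rewrite (gc_homog (gdegZ ai (gc_deg i' x))).
have [ks|ks] := boolP (k - i \in s).
  rewrite (bigD1_seq _ ks us) /= [i + _]addrC subrK eqxx big1 ?addr0 // => j jk.
  by rewrite ifN // addrC -subr_eq eq_sym.
rewrite s0 // scaler0 big1_seq // => j /andP[_ js].
by rewrite ifN // addrC -subr_eq; apply: contraNneq ks => ->.
Qed.

Lemma gc_scale_sum M k a (x : M) : exists s,
  gc k (a *: x) = \sum_(i <- s) ac i a *: gc (k - i) x.
Proof.
have [s [_ _ aE]] := ac_sum a; exists s.
rewrite {1}aE scaler_suml raddf_sum /=; apply: eq_bigr => i _.
exact/gc_scale/ac_deg.
Qed.

Lemma gc_k M i (k : K) (x : M) : gc i (k%:A *: x) = k%:A *: gc i x.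
Proof. by rewrite (@gc_scale _ 0) ?subr0 // memvZ // Ac1. Qed.

Lemma ac_k i (k : K) a : ac i (k *: a) = k *: ac i a.
Proof.
apply: (@component_uniq A _ Ac0 AcB dA _ (fun j => k *: ac j a)).
have [s [us s0 aE]] := ac_sum a; split=> [j|]; first exact/memvZ/ac_deg.
by exists s; split=> // [j js|]; rewrite ?s0 ?scaler0 // {1}aE scaler_sumr.
Qed.

(** ** Morphisms *)

Lemma gmor_additive M N (f : gmor M N) : {morph f : x y / x - y}.
Proof. by move=> x y; have := glin f (-1) y x; rewrite !scaleN1r !(addrC (- _)). Qed.

HB.instance Definition _ M N (f : gmor M N) :=
  GRing.isZmodMorphism.Build M N f (@gmor_additive M N f).

Lemma gmorE M N (f : gmor M N) a (x : M) : f (a *: x) = a *: f x.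
Proof. by have := glin f a x 0; rewrite raddf0 !addr0. Qed.

Lemma gmor_gc M N (f : gmor M N) i (x : M) : f (gc i x) = gc i (f x).
Proof.
have [s [us s0 xE]] := gc_sum x; rewrite {2}xE !raddf_sum /=.
under eq_bigr => j _ do rewrite (gc_homog (gmor_deg f (gc_deg j x))).
have [is_|is_] := boolP (i \in s).
  rewrite (bigD1_seq _ is_ us) /= eqxx big1 ?addr0 // => j ji.
  by rewrite ifN // eq_sym.
rewrite s0 // raddf0 big1_seq // => j /andP[_ js].
by rewrite ifN //; apply: contraNneq is_ => ->.
Qed.

Definition klin M N (f : gmor M N) : kcar M -> kcar N := f.
Fact klin_linear M N (f : gmor M N) : linear (klin f).
Proof. by move=> k x y; rewrite /klin glin. Qed.
HB.instance Definition _ M N (f : gmor M N) :=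
  GRing.isLinear.Build K (kcar M) (kcar N) _ (klin f) (klin_linear f).

Definition glfun M N (f : gmor M N) : 'Hom(kcar M, kcar N) := linfun (klin f).
Lemma glfunE M N (f : gmor M N) x : glfun f x = f x.
Proof. by rewrite lfunE. Qed.

Definition surj (X Y : Type) (f : X -> Y) := forall y, exists x, f x = y.

Lemma limg_surj M N (f : gmor M N) : surj f -> limg (glfun f) = fullv.
Proof.
move=> Sf; apply/eqP; rewrite eqEsubv subvf /=; apply/subvP => y _.
by have [x <-] := Sf y; rewrite -glfunE memv_img ?memvf.
Qed.

Lemma surj_inj M N (f : gmor M N) : surj f -> (gdim M <= gdim N)%N -> injective f.
Proof.
move=> Sf dMN; have := limg_ker_dim (glfun f) fullv; rewrite capfv limg_surj //.
rewrite -/(gdim N) -/(gdim M) => dE.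
have /eqP : \dim (lker (glfun f)) = 0%N.
  by apply/eqP; rewrite -leqn0 -(leq_add2r (gdim N)) dE add0n.
by rewrite dimv_eq0 => /lker0P If x y; rewrite -2!glfunE => /If.
Qed.

Lemma inj_surj M N (f : gmor M N) : injective f -> (gdim N <= gdim M)%N -> surj f.
Proof.
move=> If dNM y.
have /eqP ker0 : lker (glfun f) == 0%VS.
  by apply/lker0P => x x'; rewrite !glfunE => /If.
have := limg_ker_dim (glfun f) fullv; rewrite ker0 capv0 dimv0 add0n => dE.
have : (y : kcar N) \in limg (glfun f).
  have /eqP-> : limg (glfun f) == fullv by rewrite eqEdim subvf /= dE.
  exact: memvf.
by case/memv_imgP=> x _ ->; exists x; rewrite glfunE.
Qed.

Lemma gdim_ses M N P (i : gmor M N) (p : gmor N P) : injective i -> surj p ->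
  (forall y, p y = 0 <-> exists x, i x = y) -> gdim N = (gdim M + gdim P)%N.
Proof.
move=> Ii Sp ex; rewrite /gdim -(limg_ker_dim (glfun p)) capfv limg_surj //.
congr (_ + _)%N; rewrite -(@limg_dim_eq _ _ _ (glfun i)).
  congr (\dim _); apply/vspaceP => y; rewrite memv_ker glfunE.
  apply/eqP/memv_imgP => [/ex[x <-]|[x _ ->]]; last by apply/ex; exists x; rewrite glfunE.
  by exists x; rewrite ?memvf ?glfunE.
apply/eqP; rewrite -subv0; apply/subvP => x; rewrite memv_cap memv_ker memv0.
by rewrite glfunE -(raddf0 i) => /andP[_ /eqP/Ii ->].
Qed.

Lemma inj_gdeg M N (f : gmor M N) i x : injective f -> gdeg i (f x) -> gdeg i x.
Proof. by move=> If /gdegE; rewrite -gmor_gc => /If/gdegE. Qed.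

Lemma inj0 M N (f : gmor M N) : (forall x, f x = 0 -> x = 0) -> injective f.
Proof.
move=> f0 x y fxy; apply/eqP; rewrite -subr_eq0; apply/eqP/f0.
by rewrite raddfB /= fxy subrr.
Qed.

Lemma gmor_lift M N W (i : gmor N M) (g : gmor W M) : injective i ->
  (forall w, exists n, i n = g w) -> exists h : gmor W N, forall w, i (h w) = g w.
Proof.
move=> Ii /choice[h hE].
have hL : linear h by move=> a x y; apply: Ii; rewrite glin !hE glin.
have hd k x : gdeg k x -> gdeg k (h x).
  by move=> xk; apply: inj_gdeg Ii _; rewrite hE; apply: gmor_deg.
by exists (GMor hL hd).
Qed.

Lemma gmor_desc M Q W (p : gmor M Q) (g : gmor M W) : surj p ->
  (forall x, p x = 0 -> g x = 0) -> exists h : gmor Q W, forall x, h (p x) = g x.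
Proof.
move=> Sp pg; have [s sE] := choice Sp.
have gE x y : p x = p y -> g x = g y.
  move=> pxy; apply/eqP; rewrite -subr_eq0 -raddfB; apply/eqP/pg.
  by rewrite raddfB /= pxy subrr.
have hL : linear (g \o s).
  by move=> a x y; rewrite /= -glin; apply: gE; rewrite glin !sE.
have hd k y : gdeg k y -> gdeg k ((g \o s) y).
  move=> yk; rewrite /= -(gE (gc k (s y))); first exact/gmor_deg/gc_deg.
  by rewrite gmor_gc sE gc_id.
by exists (GMor hL hd) => x /=; apply: gE; rewrite sE.
Qed.

(** ** Submodules and quotients *)

Record gsubmod M (S : M -> Prop) : Prop := GSubmod {
  gs0 : S 0;
  gsP : forall a x y, S x -> S y -> S (a *: x + y);
  gs_gc : forall i x, S x -> S (gc i x) }.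

Lemma gsD M (S : M -> Prop) x y : gsubmod S -> S x -> S y -> S (x + y).
Proof. by move=> sS Sx Sy; rewrite -[x]scale1r; apply: gsP. Qed.
Lemma gsZ M (S : M -> Prop) a x : gsubmod S -> S x -> S (a *: x).
Proof. by move=> sS Sx; rewrite -[_ *: x]addr0; apply: gsP => //; apply: gs0. Qed.
Lemma gs_sum M (S : M -> Prop) I (r : seq I) (P : pred I) (F : I -> M) :
  gsubmod S -> (forall i, P i -> S (F i)) -> S (\sum_(i <- r | P i) F i).
Proof. by move=> sS SF; elim/big_rec: _ => [|i x /SF]; [apply: gs0 | apply: gsD]. Qed.

Definition gspace M (S : M -> Prop) : {vspace kcar M} :=
  @vspace_of K (kcar M) S.
Lemma gspaceP M (S : M -> Prop) : gsubmod S -> forall x : kcar M, x \in gspace S <-> S x.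
Proof.
move=> sS; apply: (@vspace_ofP K (kcar M) S); split=> [|k x y]; first exact: gs0.
by rewrite kscaleE; apply: gsP.
Qed.

Lemma vect_gfg (W : vectType K) (N : lmodType A) (f : W -> N) :
  surj f -> (forall k (x y : W), f (k *: x + y) = k%:A *: f x + f y) ->
  exists s : seq N, forall x, exists c : N -> A, x = \sum_(g <- s) c g *: g.
Proof.
move=> Sf fL; pose b := vbasis {:W}.
have fB x y : f (x - y) = f x - f y.
  by have := fL (-1) y x; rewrite !scaleN1r !(addrC (- _)).
have f0 : f 0 = 0 by rewrite -(subrr 0) fB subrr.
have fD x y : f (x + y) = f x + f y by rewrite -[x]scale1r fL !scale1r.
have fZ k x : f (k *: x) = k%:A *: f x by rewrite -[_ *: x]addr0 fL f0 addr0.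
apply: (@gfg_ord _ _ _ (fun i : 'I_(\dim {:W}) => f b`_i)) => y.
have [x <-] := Sf y; exists (fun i => (coord b i x)%:A).
rewrite {1}(coord_vbasis (memvf x)) (big_morph f fD f0).
by apply: eq_bigr => i _; rewrite fZ.
Qed.

Section Sub.
Variables (M : gmod Ac) (S : M -> Prop).
Hypothesis sS : gsubmod S.
Let W := subvs_of (gspace S).
Let inc (w : W) : M := vsval w.
Let WS (w : W) : S (inc w). Proof. exact/(gspaceP sS)/subvsP. Qed.
Let pr (x : M) : W := vsproj (gspace S) (x : kcar M).
Let prK x : S x -> inc (pr x) = x.
Proof. by move=> /(gspaceP sS) xS; rewrite /inc vsprojK. Qed.
Let incI : injective inc. Proof. exact: subvs_inj. Qed.
Let act (a : A) (w : W) : W := pr (a *: inc w).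
Let incA a w : inc (act a w) = a *: inc w.
Proof. exact: prK (gsZ _ sS (WS w)). Qed.
Let incD w w' : inc (w + w') = inc w + inc w'. Proof. by []. Qed.
Fact sub_action : is_action act.
Proof.
split=> [a b w|w|a w w'|w a b]; apply: incI.
- by rewrite !incA scalerA.
- by rewrite incA scale1r.
- by rewrite incD !incA incD scalerDr.
by rewrite incD !incA scalerDl.
Qed.
Let N : lmodType A := action_car sub_action.
Let inc' : N -> M := inc.
Let deg i (x : N) := gdeg i (inc' x).
Let incL a (x y : N) : inc' (a *: x + y) = a *: inc' x + inc' y.
Proof. by rewrite [LHS]incD incA. Qed.
Let inc0 : inc' 0 = 0. Proof. by []. Qed.
Let incB : {morph inc' : x y / x - y}.
Proof. by move=> x y; have := incL (-1) y x; rewrite !scaleN1r !(addrC (- _)). Qed.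
Let comp i (x : N) : N := pr (gc i (inc x)).
Let compE i x : inc (comp i x) = gc i (inc x). Proof. exact: prK (gs_gc sS _ (WS x)). Qed.
Let comp_add i : {morph comp i : x y / x - y}.
Proof.
move=> x y; apply: incI; rewrite compE.
have -> : inc (x - y) = inc x - inc y := incB x y.
have -> : inc (comp i x - comp i y) = inc (comp i x) - inc (comp i y) := incB _ _.
by rewrite !compE raddfB.
Qed.
HB.instance Definition _ i := GRing.isZmodMorphism.Build N N (comp i) (@comp_add i).

Definition sub_gmod : gmod Ac.
Proof.
refine (@GMod K A Ac N deg _ _ _ _ _).
- by move=> i; rewrite /deg inc0; apply: gdeg0.
- by move=> i k x y; rewrite /deg incL; apply: gdegP.
- apply: (@direct_sum_components _ _ (fun i => comp i : {additive N -> N})).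
  + by move=> i x; rewrite /deg [inc' _]compE; apply: gc_deg.
  + move=> x; have [s [_ _ xE]] := gc_sum (inc x); exists s.
    apply: incI; rewrite xE.
    have incsum : {morph inc' : x y / x + y} by [].
    rewrite [RHS](big_morph inc' incsum inc0); apply: eq_bigr => i _.
    by rewrite -compE.
  + move=> i x xi j; apply: incI; rewrite compE (gc_homog xi).
    by case: eqP.
- by move=> i j a x ai xj; rewrite /deg [inc' _]incA; apply: gdegZ.
apply: (@vect_gfg W N id) => [w|k x y]; first by exists w.
apply: incI; rewrite [RHS]incL.
by rewrite /inc linearP.
Defined.

Definition sub_inc : gmor sub_gmod M.
Proof. by exists inc' => [a x y|i x]; [apply: incL | rewrite /gdeg]. Defined.

Lemma sub_inc_inj : injective sub_inc.
Proof. exact: incI. Qed.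

Lemma sub_incP y : S y <-> exists x, sub_inc x = y.
Proof. by split=> [Sy|[x <-]]; [exists (pr y); apply: prK | apply: WS]. Qed.
End Sub.

(** The quotient by [S] is realized on a vector space complement of [S], where
    [A] acts by acting in [M] and projecting back. *)
Section Quotient.
Variables (M : gmod Ac) (S : M -> Prop).
Hypothesis sS : gsubmod S.
Let U := gspace S.
Let W := subvs_of U^C.
Let prc := (\1 - projv U)%VF.
Let prcE x : prc x = x - projv U x.
Proof. by rewrite add_lfunE opp_lfunE id_lfunE. Qed.
Let pr (x : M) : W := vsproj (U^C) (prc (x : kcar M)).
Let lift (w : W) : M := vsval w.
Let liftpr x : lift (pr x) = x - projv U (x : kcar M).
Proof. by rewrite /lift vsprojK prcE ?memv_projC. Qed.
Let prK w : pr (lift w) = w.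
Proof.
apply: subvs_inj; rewrite [LHS]liftpr.
suff -> : projv U (vsval w) = 0 by rewrite subr0.
by apply/eqP; rewrite -memv_ker lker_proj subvsP.
Qed.
Let prB : {morph pr : x y / x - y}.
Proof. by move=> x y; rewrite /pr -linearB -[in RHS]linearB. Qed.
HB.instance Definition _ := GRing.isZmodMorphism.Build M W pr prB.
Let prS x : pr x = 0 <-> S x.
Proof.
have E : S x <-> projv U (x : kcar M) = x.
  split=> [/(gspaceP sS)/projv_id //|<-]; exact/(gspaceP sS)/memv_proj.
rewrite E; split=> [pr0|xE]; last by rewrite /pr prcE xE subrr linear0.
by apply/eqP; rewrite eq_sym -subr_eq0 -liftpr pr0.
Qed.
Let pr_eq x y : S (x - y) -> pr x = pr y.
Proof. by move/prS; rewrite raddfB => /eqP; rewrite subr_eq0 => /eqP. Qed.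
Let Slift x : S (lift (pr x) - x).
Proof. by apply/prS; rewrite raddfB /= prK subrr. Qed.
Let act (a : A) (w : W) : W := pr (a *: lift w).
Let actpr a x : act a (pr x) = pr (a *: x).
Proof. by apply: pr_eq; rewrite -scalerBr; apply: gsZ => //; apply: Slift. Qed.
Let prD : {morph pr : x y / x + y}. Proof. exact: raddfD. Qed.
Fact quot_action : is_action act.
Proof.
split=> [a b w|w|a w w'|w a b].
- by rewrite actpr scalerA.
- by rewrite /act scale1r prK.
- by rewrite -[w]prK -[w']prK -prD !actpr scalerDr prD.
by rewrite -prD /act scalerDl.
Qed.
Let N : lmodType A := action_car quot_action.
Let pr' : M -> N := pr.
Let deg i (y : N) := exists2 x, gdeg i x & pr' x = y.
Let prL a x y : pr' (a *: x + y) = a *: pr' x + pr' y.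
Proof. by rewrite [LHS]prD -[pr (a *: x)]actpr. Qed.
Let comp i (y : N) : N := pr (gc i (lift y)).
Let comp_pr i x : comp i (pr x) = pr (gc i x).
Proof. by apply: pr_eq; rewrite -raddfB; apply: (gs_gc sS); apply: Slift. Qed.
Let comp_add i : {morph comp i : x y / x - y}.
Proof.
move=> x y; rewrite -[x]prK -[y]prK.
have -> : (pr (lift x) : N) - pr (lift y) = pr (lift x - lift y) by rewrite prB.
by rewrite !comp_pr raddfB [LHS]prB.
Qed.
HB.instance Definition _ i := GRing.isZmodMorphism.Build N N (comp i) (@comp_add i).

Definition quot_gmod : gmod Ac.
Proof.
refine (@GMod K A Ac N deg _ _ _ _ _).
- by move=> i; exists 0; [apply: gdeg0 | apply: (raddf0 pr)].
- move=> i k _ _ [x xi <-] [y yi <-]; exists (k%:A *: x + y); first exact: gdegP.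
  exact: prL.
- apply: (@direct_sum_components _ _ (fun i => comp i : {additive N -> N})).
  + by move=> i y; exists (gc i (lift y)); [apply: gc_deg | ].
  + move=> y; have [s [_ _ xE]] := gc_sum (lift y); exists s.
    by rewrite -{1}[y]prK xE [LHS](raddf_sum pr).
  + move=> i _ [x xi <-] j; rewrite [LHS]comp_pr (gc_homog xi).
    by case: eqP => // _; apply: (raddf0 pr).
- move=> i j a _ ai [x xj <-]; exists (a *: x); first exact: gdegZ.
  by apply: esym; apply: actpr.
apply: (@vect_gfg W N id) => [w|k x y]; first by exists w.
have -> : (k%:A : A) *: (x : N) = pr (k%:A *: lift x) by [].
by congr (_ + _); rewrite -{1}[x]prK /pr -!linearZ.
Defined.

Definition quot_pr : gmor M quot_gmod.
Proof. by exists pr' => [a x y|i x xi]; [apply: prL | exists x]. Defined.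

Lemma quot_pr_surj : surj quot_pr.
Proof. by move=> y; exists (lift y); apply: prK. Qed.

Lemma quot_prP x : quot_pr x = 0 <-> S x.
Proof. exact: prS. Qed.
End Quotient.

End Constructions.

(** ** Free modules and biproducts *)

Section FreeAndPair.
Variables (K : fieldType) (A : falgType K) (Ac : int -> {vspace A}).
Hypothesis gA : graded_algebra Ac.
Implicit Types M N P : gmod Ac.

(** The generators have the prescribed degrees [js], so the coefficients of a
    homogeneous element of degree [i] have degrees [i - js l]. *)
Section Free.
Variables (n : nat) (js : 'I_n -> int).
Let F : lmodType A := {ffun 'I_n -> A^o}.
Let deg i (f : F) := forall l, f l \in Ac (i - js l).
Let comp i (f : F) : F := [ffun l => ac gA (i - js l) (f l)].
Let comp_add i : {morph comp i : x y / x - y}.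
Proof. by move=> x y; apply/ffunP => l; rewrite !ffunE raddfB. Qed.
HB.instance Definition _ i := GRing.isZmodMorphism.Build F F (comp i) (@comp_add i).

Definition free_gmod : gmod Ac.
Proof.
refine (@GMod K A Ac F deg _ _ _ _ _).
- by move=> i l; rewrite ffunE mem0v.
- move=> i k x y xi yi l; rewrite !ffunE /= rpredD ?yi //.
  by rewrite /GRing.scale /= mulr_algl memvZ.
- apply: (@direct_sum_components _ _ (fun i => comp i : {additive F -> F})).
  + by move=> i f l; rewrite ffunE ac_deg.
  + move=> f; have /choice[s sE] := fun l => ac_sum gA (f l).
    exists (undup (flatten [seq [seq i + js l | i <- s l] | l : 'I_n])).
    apply/ffunP => l; rewrite sum_ffunE; have [us s0 {1}->] := sE l.
    under [RHS]eq_bigr do rewrite ffunE.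
    transitivity (\sum_(k <- [seq i + js l | i <- s l]) ac gA (k - js l) (f l)).
      by rewrite big_map; apply: eq_bigr => i _; rewrite addrK.
    apply/esym/sum_finsupp; rewrite ?undup_uniq //.
    * by rewrite map_inj_uniq // => i j /addIr.
    * move=> i /negP is_; apply: s0; apply/negP => h; apply: is_.
      by apply/mapP; exists (i - js l); rewrite ?subrK.
    * move=> i is_; rewrite mem_undup; apply/flattenP.
      exists [seq i + js l | i <- s l] => //.
      by apply/mapP; exists l; rewrite ?mem_enum.
  + move=> i f fi j; apply/ffunP => l; rewrite ffunE (ac_homog gA (fi l)).
    rewrite (inj_eq (addIr _)); by case: eqP => // _; rewrite ffunE.
- move=> i j a f ai fj l; rewrite ffunE -addrA; exact: AcM.
apply: (@vect_gfg K A {ffun 'I_n -> A} F id) => [w|k x y]; first by exists w.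
by apply/ffunP => l; rewrite !ffunE /GRing.scale /= mulr_algl.
Defined.

Lemma free_degP i (f : free_gmod) :
  gdeg i f <-> forall l, (f : F) l \in Ac (i - js l).
Proof. by []. Qed.

Definition free_gen (l : 'I_n) : free_gmod := [ffun l' => (l' == l)%:R] : F.

Lemma free_gen_deg l : gdeg (js l) (free_gen l).
Proof.
move=> l'; rewrite ffunE; have [->|_] := eqVneq; last by rewrite mem0v.
by rewrite subrr Ac1.
Qed.

Lemma free_expand (f : free_gmod) : f = \sum_l (f : F) l *: free_gen l.
Proof.
apply/ffunP => l; rewrite sum_ffunE (bigD1 l) //= big1 ?addr0 => [|l' l'l].
  by rewrite !ffunE eqxx [_ *: _]mulr1.
by rewrite !ffunE eq_sym (negPf l'l) [_ *: _]mulr0.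
Qed.

Lemma free_map M (m : 'I_n -> M) : (forall l, gdeg (js l) (m l)) ->
  exists g : gmor free_gmod M, forall l, g (free_gen l) = m l.
Proof.
move=> mdeg; pose g (f : free_gmod) := \sum_l (f : F) l *: m l.
have gL : linear g.
  move=> a x y; rewrite /g scaler_sumr -big_split; apply: eq_bigr => l _ /=.
  by rewrite !ffunE scalerDl scalerA.
have gD i x : gdeg i x -> gdeg i (g x).
  move=> xi; apply: gdeg_sum => l _; rewrite -(subrK (js l) i).
  exact: gdegZ.
exists (GMor gL gD) => l; rewrite /= /g (bigD1 l) //= big1 ?addr0 => [|l' l'l].
  by rewrite ffunE eqxx scale1r.
by rewrite ffunE (negPf l'l) scale0r.
Qed.

Lemma free_ext M (g h : gmor free_gmod M) :
  (forall l, g (free_gen l) = h (free_gen l)) -> g = h.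
Proof.
move=> gh; apply: gmor_ext => f; rewrite [f]free_expand !raddf_sum.
by apply: eq_bigr => l _; rewrite /= !gmorE gh.
Qed.
End Free.

Section Pair.
Variables M N : gmod Ac.
Let F : lmodType A := (gcar M * gcar N)%type.
Let deg i (f : F) := gdeg i f.1 /\ gdeg i f.2.
Let comp i (f : F) : F := (gc i f.1, gc i f.2).
Let comp_add i : {morph comp i : x y / x - y}.
Proof. by move=> x y; rewrite /comp !raddfB. Qed.
HB.instance Definition _ i := GRing.isZmodMorphism.Build F F (comp i) (@comp_add i).

Definition pair_gmod : gmod Ac.
Proof.
refine (@GMod K A Ac F deg _ _ _ _ _).
- by move=> i; split; apply: gdeg0.
- by move=> i k x y [? ?] [? ?]; split; apply: gdegP.
- apply: (@direct_sum_components _ _ (fun i => comp i : {additive F -> F})).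
  + by move=> i f; split; apply: gc_deg.
  + case=> x y; have [s [us s0 xE]] := gc_sum x; have [t [ut t0 yE]] := gc_sum y.
    exists (undup (s ++ t)).
    have sumE (r : seq int) (f : int -> F) : \sum_(i <- r) f i
        = (\sum_(i <- r) (f i).1, \sum_(i <- r) (f i).2).
      by elim/big_rec3: _ => // i a b c _ ->.
    rewrite sumE; congr (_, _) => /=.
      rewrite {1}xE; apply/esym/sum_finsupp; rewrite ?undup_uniq // => i.
      by rewrite mem_undup mem_cat => ->.
    rewrite {1}yE; apply/esym/sum_finsupp; rewrite ?undup_uniq // => i.
    by rewrite mem_undup mem_cat => ->; rewrite orbT.
  + move=> i [x y] [/= xi yi] j; rewrite /comp /= (gc_homog xi) (gc_homog yi).
    by case: eqP.
- by move=> i j a f ai [? ?]; split; apply: gdegZ.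
apply: (@vect_gfg K A (kcar M * kcar N)%type F id) => [w|k x y]; first by exists w.
by [].
Defined.

Definition pair_in1 : gmor M pair_gmod.
Proof.
exists (fun x => (x, 0)) => [a x y|i x xi]; last by split=> //; apply: gdeg0.
by congr (_, _) => /=; rewrite scaler0 addr0.
Defined.
Definition pair_in2 : gmor N pair_gmod.
Proof.
exists (fun x => (0, x)) => [a x y|i x xi]; last by split=> //; apply: gdeg0.
by congr (_, _) => /=; rewrite scaler0 addr0.
Defined.
Definition pair_pr1 : gmor pair_gmod M.
Proof. by exists (fun x : F => x.1) => [a x y|i x []]. Defined.
Definition pair_pr2 : gmor pair_gmod N.
Proof. by exists (fun x : F => x.2) => [a x y|i x []]. Defined.
End Pair.

(** * The category of graded modules *)

Notation GA := (gcat Ac).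

Lemma gcompE (M N P : GA) (g : hom N P) (f : hom M N) (x : M) :
  gfun (g \oc f) x = g (f x).
Proof. by []. Qed.

Lemma gsubmod_ker M N (f : gmor M N) : gsubmod (fun x => f x = 0).
Proof.
split=> [|a x y fx fy|i x fx]; first exact: raddf0.
  by rewrite glin fx fy scaler0 addr0.
by rewrite gmor_gc // fx raddf0.
Qed.

Lemma gsubmod_im M N (f : gmor M N) : gsubmod (fun y => exists x, f x = y).
Proof.
split=> [|a _ _ [x <-] [y <-]|i _ [x <-]]; first by exists 0; apply: raddf0.
  by exists (a *: x + y); rewrite glin.
by exists (gc i x); rewrite gmor_gc.
Qed.

Lemma gker_kernel (M N P : GA) (f : hom M N) (i : hom P M) :
  injective (gfun i) -> (forall y, f y = 0 <-> exists x, i x = y) -> is_kernel f i.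
Proof.
move=> Ii ex; split.
  by apply: gmor_ext => x; rewrite gcompE; apply/ex; exists x.
move=> W g /(congr1 (fun h : gmor W N => gfun h)) fg0.
have [|h hE] := @gmor_lift _ _ _ M P W i g Ii.
  by move=> w; apply/ex; exact: (congr1 (fun h => h w) fg0).
exists h; split; first exact/gmor_ext/hE.
move=> h' h'E; apply: gmor_ext => w; apply: Ii.
by rewrite hE -h'E.
Qed.

Lemma gcoker_cokernel (M N Q : GA) (f : hom M N) (p : hom N Q) :
  surj (gfun p) -> (forall y, p y = 0 <-> exists x, f x = y) -> is_cokernel f p.
Proof.
move=> Sp ex; split.
  by apply: gmor_ext => x; rewrite gcompE; apply/ex; exists x.
move=> W g /(congr1 (fun h : gmor M W => gfun h)) gf0.
have [|h hE] := @gmor_desc _ _ _ N Q W p g Sp.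
  by move=> y /ex[x <-]; exact: (congr1 (fun h => h x) gf0).
exists h; split; first exact/gmor_ext/hE.
move=> h' h'E; apply: gmor_ext => y; have [x <-] := Sp y.
by rewrite hE -h'E.
Qed.

Lemma gmonoP (M N : GA) (f : hom M N) : mono f <-> injective (gfun f).
Proof.
split=> [Mf|If W g h E]; last first.
  apply: gmor_ext => w; apply: If.
  by have := congr1 (fun h : gmor W N => h w) E.
apply: inj0 => // x fx.
have sK := gsubmod_ker f; pose i : @hom K GA (sub_gmod sK) M := sub_inc sK.
have i0 : i = 0.
  apply: Mf; apply: gmor_ext => w; rewrite gcompE [RHS](raddf0 f).
  by apply: (proj2 (sub_incP sK (i w))); exists w.
have [w <-] := proj1 (sub_incP sK x) fx.
exact: (congr1 (fun h : gmor _ M => h w) i0).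
Qed.

Lemma gepiP (M N : GA) (f : hom M N) : epi f <-> surj (gfun f).
Proof.
split=> [Ef y|Sf W g h E]; last first.
  apply: gmor_ext => y; have [x <-] := Sf y.
  by have := congr1 (fun h : gmor M W => h x) E.
have sI := gsubmod_im f.
pose p : @hom K GA N (quot_gmod sI) := quot_pr sI.
have p0 : p = 0.
  apply: Ef; apply: gmor_ext => w; rewrite gcompE.
  by apply/(quot_prP sI); exists w.
by apply/(quot_prP sI); exact: (congr1 (fun h : gmor N _ => h y) p0).
Qed.

Lemma is_zero_gmod (M : GA) : is_zero M <-> forall x : M, x = 0.
Proof.
split=> [M0 x|M0]; first exact: (congr1 (fun f : gmor M M => f x) M0).
by apply: gmor_ext => x; rewrite [LHS]M0 [RHS]M0.
Qed.

Lemma gisomP (M N : GA) (f : hom M N) :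
  injective (gfun f) -> surj (gfun f) -> isom f.
Proof.
move=> If Sf; have [|g gE] := @gmor_lift _ _ _ N M N f (gmor1 N) If.
  by move=> y; have [x xE] := Sf y; exists x.
exists g; split; apply: gmor_ext => x; last exact: gE.
by apply: If; rewrite gE.
Qed.

Lemma isom_bij (M N : GA) (f : hom M N) :
  isom f -> injective (gfun f) /\ surj (gfun f).
Proof. by move=> If; split; [apply/gmonoP/isom_mono | apply/gepiP/isom_epi]. Qed.

Lemma gses (M N P : GA) (i : hom M N) (p : hom N P) :
  injective (gfun i) -> surj (gfun p) ->
  (forall y, p y = 0 <-> exists x, i x = y) -> ses i p.
Proof. by move=> Ii Sp ex; split; [apply: gker_kernel | apply: gcoker_cokernel]. Qed.

Lemma gsesP (M N P : GA) (i : hom M N) (p : hom N P) : ses i p <->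
  [/\ injective (gfun i), surj (gfun p)
    & forall y, p y = 0 <-> exists x, i x = y].
Proof.
split=> [[kpi cip]|[? ? ?]]; last exact: gses.
split; first exact/gmonoP/kernel_mono/kpi.
  exact/gepiP/(@kernel_mono K (opcat GA) _ _ _ _ _ cip).
move=> y; split=> [py|[x <-]]; last first.
  exact: (congr1 (fun h : gmor M P => h x) (proj1 kpi)).
have sK := gsubmod_ker p; pose j : @hom K GA (sub_gmod sK) N := sub_inc sK.
have [|h hE] := kernel_lift (g := j) kpi.
  apply: gmor_ext => w; rewrite gcompE.
  by apply: (proj2 (sub_incP sK (j w))); exists w.
have [w <-] := proj1 (sub_incP sK y) py; exists (gfun h w).
exact: (congr1 (fun h : gmor _ N => h w) hE).
Qed.

Lemma sub_quot_ses (M : GA) (S : M -> Prop) (sS : gsubmod S) :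
  @ses K GA _ _ _ (sub_inc sS) (quot_pr sS).
Proof.
apply: gses; [exact: sub_inc_inj | exact: quot_pr_surj | move=> y].
by split=> [/(quot_prP sS)/(sub_incP sS) //|h]; apply/(quot_prP sS)/(sub_incP sS).
Qed.

Lemma gcat_abelian : abelian GA.
Proof.
split.
- exists (@free_gmod 0 (fun=> 0)); apply/is_zero_gmod => x.
  by rewrite [x]free_expand big_ord0.
- move=> M N; exists (pair_gmod M N), (pair_in1 M N), (pair_in2 M N),
    (pair_pr1 M N), (pair_pr2 M N).
  by split; apply: gmor_ext => //= -[x y]; congr (_, _); rewrite ?addr0 ?add0r.
- move=> M N f; have sK := gsubmod_ker f.
  exists (sub_gmod sK), (sub_inc sK).
  by apply: gker_kernel (sub_incP sK); apply: sub_inc_inj.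
- move=> M N f; have sI := gsubmod_im f.
  exists (quot_gmod sI), (quot_pr sI).
  by apply: gcoker_cokernel (quot_prP sI); apply: quot_pr_surj.
- move=> M N f /gmonoP If; have sI := gsubmod_im f.
  exists (quot_gmod sI), (quot_pr sI).
  exact: gker_kernel If (quot_prP sI).
move=> M N f /gepiP Sf; have sK := gsubmod_ker f.
exists (sub_gmod sK), (sub_inc sK).
exact: gcoker_cokernel Sf (sub_incP sK).
Qed.

End FreeAndPair.

Lemma projective_retract (K : fieldType) (C : lincat K) (F N : C)
    (i : hom N F) (r : hom F N) :
  r \oc i = idm N -> projective F -> projective N.
Proof.
move=> ri prF Y Z e f Ee; have [g gE] := prF Y Z e (f \oc r) Ee.
by exists (g \oc i); rewrite cmpA gE -cmpA ri cmpm1.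
Qed.

(** ** Finite length *)

Section FiniteLength.
Variables (K : fieldType) (A : falgType K) (Ac : int -> {vspace A}).
Hypothesis gA : graded_algebra Ac.
Notation GA := (gcat Ac).
Implicit Types M N P : GA.

Lemma gsubmod_preim (M N : gmod Ac) (f : gmor M N) (S : N -> Prop) :
  gsubmod S -> gsubmod (fun x => S (f x)).
Proof.
move=> sS; split=> [|a x y fx fy|i x fx].
- by rewrite raddf0; apply: gs0.
- by rewrite glin; apply: gsP.
by rewrite gmor_gc; apply: gs_gc.
Qed.

Lemma gsubmod_img (M N : gmod Ac) (f : gmor M N) (S : M -> Prop) :
  gsubmod S -> gsubmod (fun y => exists2 x, S x & f x = y).
Proof.
move=> sS; split=> [|a _ _ [x Sx <-] [y Sy <-]|i _ [x Sx <-]].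
- by exists 0; [apply: gs0 | apply: raddf0].
- by exists (a *: x + y); [apply: gsP | rewrite glin].
by exists (gc i x); [apply: gs_gc | rewrite gmor_gc].
Qed.

Lemma gspace_eq (M : gmod Ac) (S S' : M -> Prop) :
  gsubmod S -> gsubmod S' -> (forall x, S x -> S' x) ->
  (\dim (gspace S') <= \dim (gspace S))%N -> forall x, S' x -> S x.
Proof.
move=> sS sS' SS' dS x /(gspaceP sS') xS'; apply/(gspaceP sS).
have : (gspace S <= gspace S')%VS.
  by apply/subvP => y /(gspaceP sS) yS; apply/(gspaceP sS')/SS'.
by move=> sub; have /eqP -> : gspace S == gspace S' by rewrite eqEdim sub.
Qed.

Lemma gsimpleP M : simple M <-> (exists x : gcar M, x <> 0) /\
  forall S : gcar M -> Prop, gsubmod S -> (forall x, S x -> x = 0) \/ forall x, S x.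
Proof.
split=> [[M0 sM]|[[x0 x00] sM]]; split.
- apply: contrapT => M00; apply/M0/is_zero_gmod => x.
  by apply: contrapT => x0; apply: M00; exists x.
- move=> S sS; have [|N0|If] := sM (sub_gmod sS) (sub_inc sS).
  + exact/gmonoP/sub_inc_inj.
  + left=> x /(sub_incP sS)[w <-].
    by rewrite (proj1 (is_zero_gmod _) N0 w) raddf0.
  by right=> x; apply/(sub_incP sS); apply: (proj2 (isom_bij If)).
- by move/is_zero_gmod => /(_ x0).
move=> Y f /gmonoP If; have [f0|fs] := sM _ (gsubmod_im f).
  left; apply/is_zero_gmod => y; apply: If; rewrite raddf0.
  by apply: f0; exists y.
by right; apply: gisomP => // x; apply: fs.
Qed.

Lemma simple_surj M N (f : hom M N) : simple N -> f <> 0 -> surj (gfun f).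
Proof.
move=> /gsimpleP[_ sN] f0; have [fz|//] := sN _ (gsubmod_im f).
by case: f0; apply: gmor_ext => x; apply: fz; exists x.
Qed.

Lemma simple_inj M N (f : hom M N) : simple M -> f <> 0 -> injective (gfun f).
Proof.
move=> /gsimpleP[_ sM] f0; have [fz|fz] := sM _ (gsubmod_ker f).
  exact: inj0.
by case: f0; apply: gmor_ext.
Qed.

Lemma schur_isom M N (f : hom M N) : simple M -> simple N -> f <> 0 -> isom f.
Proof. by move=> sM sN f0; apply: gisomP; [apply: simple_inj|apply: simple_surj]. Qed.

Lemma maximal_gsubmod M : ~ is_zero M -> exists S : gcar M -> Prop,
  exists2 sS : gsubmod S, (exists x, ~ S x) & @simple K GA (quot_gmod sS).
Proof.
move=> M0.
pose Q n := `[< exists S : gcar M -> Prop,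
  [/\ gsubmod S, exists x, ~ S x & \dim (gspace S) = n] >].
have Q0 : exists n, Q n.
  exists (\dim (@gspace K A Ac M (fun x => x = 0))); apply/asboolP; exists (fun x => x = 0).
  split=> //; first by split=> [//|a x y -> ->|i x ->]; rewrite ?scaler0 ?addr0 ?raddf0.
  apply: contrapT => h; apply/M0/is_zero_gmod => x.
  by apply: contrapT => x0; apply: h; exists x.
have Qb n : Q n -> (n <= gdim M)%N by move=> /asboolP[S [_ _ <-]]; apply/dimvS/subvf.
case: (ex_maxnP Q0 Qb) => n /asboolP[S [sS [x0 Sx0] dS]] nmax.
exists S, sS; first by exists x0.
apply/gsimpleP; split; first by exists (quot_pr sS x0) => /quot_prP.
move=> S' sS'; have sP := gsubmod_preim (quot_pr sS) sS'.
have SP x : S x -> S' (quot_pr sS x) by move=> /(quot_prP sS) ->; apply: gs0.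
have [[y Sy]|all] := pselect (exists y, ~ S' (quot_pr sS y)); last first.
  right=> q; have [y <-] := @quot_pr_surj _ _ _ _ _ sS q.
  by apply: contrapT => ny; apply: all; exists y.
left=> q; have [z <-] := @quot_pr_surj _ _ _ _ _ sS q => Sz; apply/(quot_prP sS).
apply: (gspace_eq sS sP SP) Sz; rewrite dS; apply: nmax; apply/asboolP.
by exists (fun x => S' (quot_pr sS x)); split=> //; exists y.
Qed.

(** Split off a simple quotient; the kernel has smaller dimension. *)
Lemma gcat_finite_length : finite_length GA.
Proof.
move=> M; have [n] := ubnP (gdim M); elim: n M => // n IH M dM.
have [M0|M0] := pselect (is_zero M); first exact: filtered_zero.
have [S [sS [x0 Sx0] simQ]] := maximal_gsubmod M0.
apply: filtered_ext (sub_quot_ses sS) _ simQ; apply: IH.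
rewrite ltnS in dM; apply: leq_trans dM; rewrite ltnNge; apply/negP => dS.
apply: Sx0; apply/(sub_incP sS); apply: inj_surj dS x0.
exact: sub_inc_inj.
Qed.

Lemma simple_quotient_ex M : ~ is_zero M ->
  exists Q (p : hom M Q), simple Q /\ epi p.
Proof.
move=> /maximal_gsubmod[S [sS _ simQ]]; exists (quot_gmod sS), (quot_pr sS).
by split=> //; apply/gepiP/quot_pr_surj.
Qed.

(** Simple quotients occur among the factors of any composition series. *)
Lemma finite_simple_quotients M : exists n (e : 'I_n -> GA),
  forall Q (p : hom M Q), simple Q -> epi p -> exists j, isomorphic Q (e j).
Proof.
elim: (gcat_finite_length M) => {M} [M M0|X Y Z i p ip _ [n [e eP]] sZ].
  exists 0%N, (fun=> M) => Q p [Q0 _] Ep; case: Q0; apply: Ep.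
  by rewrite cmp1m cmp0m (zero_hom_from p).
exists n.+1, (fun j => oapp e Z (unlift ord0 j)) => Q q sQ Eq.
have [qi0|qi0] := pselect (q \oc i = 0); last first.
  have [|j jE] := eP Q (q \oc i) sQ; first exact/gepiP/simple_surj.
  by exists (lift ord0 j); rewrite liftK.
have [h [hE _]] := proj2 (proj2 ip) Q q qi0; exists ord0; rewrite unlift_none /=.
apply: isomorphic_sym; exists h; apply: schur_isom => // h0.
have q0 : q = 0 by rewrite -hE h0 cmp0m.
by case: sQ => + _; apply; apply: Eq; rewrite cmp1m cmp0m.
Qed.

(** ** Projectives *)

Lemma free_projective n (js : 'I_n -> int) : @projective K GA (free_gmod gA js).
Proof.
move=> Y Z e f /gepiP Se.
have /choice[m mE] l : exists y : gcar Y, gdeg (js l) y /\ e y = f (free_gen gA js l).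
  have [y yE] := Se (f (free_gen gA js l)); exists (gc (js l) y).
  split; first exact: gc_deg.
  by rewrite gmor_gc yE gc_id //; apply/gmor_deg/free_gen_deg.
have [g gE] := free_map gA (fun l => proj1 (mE l)).
exists g; apply: (@free_ext _ _ _ gA) => l.
by rewrite gcompE gE; apply: (proj2 (mE l)).
Qed.

Lemma free_cover (M : gmod Ac) : exists n (js : 'I_n -> int)
  (g : gmor (free_gmod gA js) M), surj g.
Proof.
have [s gen] := gfg M.
have /choice[t tE] := @gc_sum _ _ _ M.
pose L := flatten [seq [seq (j, gc j x) | j <- t x] | x <- s].
have Ldeg (l : 'I_(size L)) : gdeg (nth (0, 0) L l).1 (nth (0, 0) L l).2.
  have /flattenP[_ /mapP[x _ ->] /mapP[j _ ->]] : nth (0, 0) L l \in L by apply: mem_nth.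
  exact: gc_deg.
have [g gE] := free_map gA Ldeg.
exists (size L), (fun l => (nth (0, 0) L l).1), g => x.
pose I y := exists x, g x = y; have sI : gsubmod I := gsubmod_im g.
rewrite -/(I x); have [c ->] := gen x.
rewrite big_seq; refine (gs_sum _ sI _) => y ys; apply: gsZ => //.
have [_ _ ->] := tE y; rewrite big_seq; refine (gs_sum _ sI _) => j jt.
have jL : (j, gc j y) \in L.
  by apply/flattenP; exists [seq (j, gc j y) | j <- t y]; apply/mapP; [exists y | exists j].
have lt : (index (j, gc j y) L < size L)%N by rewrite index_mem.
exists (free_gen gA (fun l => (nth (0, 0) L l).1) (Ordinal lt)).
by rewrite gE /= nth_index.
Qed.

Lemma gcat_enough_projectives : enough_projectives GA.
Proof.
move=> M; have [n [js [g Sg]]] := free_cover M.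
by exists (free_gmod gA js), g; split; [apply: free_projective | apply/gepiP].
Qed.

(** A submodule [N] of a projective [F] that is minimal among those mapping
    onto [L] is a retract of [F]: lift [F -> L] to [h : F -> N]; by minimality
    [h] maps [N] onto itself. *)
Lemma projective_cover_ex (F L : GA) (p : hom F L) : projective F -> epi p ->
  exists N (i : hom N F) (r : hom F N),
    r \oc i = idm N /\ projective_cover N L.
Proof.
move=> prF /gepiP Sp.
pose onto (S : gcar F -> Prop) := gsubmod S /\ forall y, exists2 x, S x & p x = y.
pose Q n := `[< exists2 S : gcar F -> Prop, onto S & \dim (gspace S) = n >].
have Q0 : exists n, Q n.
  exists (\dim (@gspace K A Ac F (fun=> True))); apply/asboolP; exists (fun=> True) => //.
  by split=> // y; have [x xE] := Sp y; exists x.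
case: (ex_minnP Q0) => n /asboolP[S [sS Sonto] dS] nmin.
have minS S' : onto S' -> (forall x, S' x -> S x) -> forall x, S x -> S' x.
  move=> [sS' S'o] S'S; apply: gspace_eq => //; rewrite dS; apply: nmin.
  by apply/asboolP; exists S'.
pose N : GA := sub_gmod sS; pose i : hom N F := sub_inc sS.
have iS x : S (gfun i x) by apply/(sub_incP sS); exists x.
have iI : injective (gfun i) by apply: sub_inc_inj.
pose q := p \oc i.
have Eq : epi q.
  apply/gepiP => y; have [x /(sub_incP sS)[w wE] <-] := Sonto y.
  by exists w; rewrite gcompE -[RHS](congr1 (gfun p) wE).
have im_onto Y (g : hom Y N) : epi (q \oc g) -> surj (gfun g).
  move=> /gepiP Sqg w.
  have [||x xE] := minS (fun y => exists x, gfun (i \oc g) x = y) _ _ (gfun i w) (iS w).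
  - by split=> [|y]; [apply: gsubmod_im | have [x <-] := Sqg y; exists (i (g x)) => //; exists x].
  - by move=> _ [x <-]; apply: iS.
  by exists x; apply: iI.
have [h hE] := prF _ _ q p Eq.
have qhi : q \oc (h \oc i) = q by rewrite cmpA hE.
have Shi : surj (gfun (h \oc i)) by apply: im_onto; rewrite qhi.
have [e [eh _]] : isom (h \oc i) by apply: gisomP => //; apply: surj_inj.
have ri : (e \oc h) \oc i = idm N by rewrite -cmpA.
exists N, i, (e \oc h); split=> //; split; first exact: projective_retract ri prF.
by exists q; split=> // Y g /im_onto/gepiP.
Qed.

End FiniteLength.

(** * Dimension counts over the negative part *)

(** Summing the first family of inequalities telescopes [D]; if the resulting
    bound is attained, each of the summed inequalities is an equality. In the
    application [D i] is the dimension of the submodule generated in degrees at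
    least [i], and [m i], [c i], [j i] are the dimensions of the part of degree
    [i] and of two nested subspaces of it. *)
Lemma telescope_count (n a : nat) (D c m j : nat -> nat) :
  (forall i, i < n -> D i <= D i.+1 + a * (m i - c i))%N ->
  (forall i, i < n -> j i <= c i)%N -> (forall i, i < n -> c i <= m i)%N ->
  D n = 0%N ->
  (D 0 + a * \sum_(i < n) j i <= a * \sum_(i < n) m i)%N /\
  ((0 < a)%N -> (D 0 + a * \sum_(i < n) j i)%N = (a * \sum_(i < n) m i)%N ->
   forall i, (i < n)%N -> D i = (D i.+1 + a * (m i - c i))%N /\ c i = j i).
Proof.
move=> hD hj hc Dn; have [n0|n_gt0] := posnP n.
  by rewrite n0 in Dn *; rewrite !big_ord0 Dn; split.
have tel : (\sum_(i < n) D i = D 0 + \sum_(i < n) D i.+1)%N.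
  rewrite -(prednK n_gt0) big_ord_recl [in RHS]big_ord_recr /=.
  by rewrite (prednK n_gt0) Dn addn0.
pose E i := (D i.+1 + a * (m i - j i))%N.
have DE (i : 'I_n) : true -> (D i <= E i ?= iff (D i == E i))%N.
  move=> _; split=> //; rewrite /E; apply: leq_trans (hD i (ltn_ord i)) _.
  by rewrite leq_add2l leq_mul2l leq_sub2l ?orbT ?hj.
have sumE : (\sum_(i < n) E i + a * \sum_(i < n) j i
             = \sum_(i < n) D i.+1 + a * \sum_(i < n) m i)%N.
  rewrite !big_distrr /= -!big_split /=; apply: eq_bigr => i _.
  have := hj i (ltn_ord i); have := hc i (ltn_ord i); rewrite /E => ? ?.
  by rewrite -addnA -mulnDr subnK //; lia.
have [sle seq] := leqif_sum DE.
rewrite /= in sle seq.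
move: (\sum_(i < n) E i)%N (\sum_(i < n) D i)%N (\sum_(i < n) D i.+1)%N
  => SE SD SD1 in sumE sle seq tel *.
move: (\sum_(i < n) m i)%N (\sum_(i < n) j i)%N => Sm Sj in sumE *.
split; first by lia.
move=> a0 eq i iln.
have eqs : SD = SE by lia.
move: seq; rewrite eqs eqxx => /esym/forallP/(_ (Ordinal iln))/eqP /= DEi.
have := hD i iln; have := hj i iln; have := hc i iln.
move: DEi; rewrite /E => -> h1 h2; rewrite leq_add2l leq_pmul2l // => h3.
have cj : c i = j i by lia.
by rewrite cj.
Qed.

Section SpaceAction.
Variables (K : fieldType) (A : falgType K) (Ac : int -> {vspace A}).
Hypothesis gA : graded_algebra Ac.
Implicit Types M N : gmod Ac.

Lemma prodv_ind (U V : {vspace A}) (P : A -> Prop) : subspace_pred P ->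
  (forall u v, u \in U -> v \in V -> P (u * v)) ->
  forall x, x \in (U * V)%VS -> P x.
Proof.
move=> sP PUV x; have /subvP sub : (U * V <= vspace_of P)%VS.
  by apply/prodvP => u v uU vV; apply/(vspace_ofP sP)/PUV.
by move=> /sub/(vspace_ofP sP).
Qed.

Definition actv M (U : {vspace A}) (V : {vspace kcar M}) : {vspace kcar M} :=
  <<[seq (u *: (v : gcar M) : kcar M) | u <- vbasis U, v <- vbasis V]>>%VS.

Lemma dim_actv M (U : {vspace A}) (V : {vspace kcar M}) : (\dim (actv U V) <= \dim U * \dim V)%N.
Proof. by apply: leq_trans (dim_span _) _; rewrite size_allpairs !size_tuple. Qed.

Lemma actv_ind M (U : {vspace A}) (V : {vspace kcar M}) (P : kcar M -> Prop) : subspace_pred P ->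
  (forall (u : A) (v : kcar M), u \in U -> v \in V -> P (u *: (v : M))) ->
  forall x, x \in actv U V -> P x.
Proof.
move=> sP PUV x; have /subvP sub : (actv U V <= vspace_of P)%VS.
  apply/span_subvP => y /allpairsP[[u v] [/= uU vV ->]].
  by apply/(vspace_ofP sP)/PUV; apply: vbasis_mem.
by move=> /sub/(vspace_ofP sP).
Qed.

Lemma memv_act M (U : {vspace A}) (V : {vspace kcar M}) (u : A) (v : kcar M) :
  u \in U -> v \in V -> (u *: (v : M) : kcar M) \in actv U V.
Proof.
move=> uU vV; rewrite (coord_vbasis uU) scaler_suml; apply: memv_suml => i _.
rewrite scalerAk -kscaleE memvZ // (coord_vbasis vV) scaler_sumr.
apply: memv_suml => j _; rewrite kscaleE scalerCk -kscaleE memvZ //.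
by apply/memv_span/allpairsP; exists ((vbasis U)`_i, (vbasis V)`_j); split=> //; apply: mem_nth; rewrite size_tuple.
Qed.

Lemma actv_stable M (V : {vspace kcar M}) a (x : kcar M) :
  x \in actv fullv V -> (a *: (x : M) : kcar M) \in actv fullv V.
Proof.
apply: (@actv_ind M _ _ (fun y => (a *: (y : M) : kcar M) \in actv fullv V)).
  split=> [|k y z yV zV]; first by rewrite scaler0 mem0v.
  by rewrite kscaleE scalerDr scalerCk -kscaleE memvD ?memvZ.
by move=> u v _ vV; rewrite scalerA memv_act ?memvf.
Qed.

Definition gpart M k : {vspace kcar M} := @vspace_of K (kcar M) (fun x => gdeg k (x : M)).
Lemma gpartP M k (x : kcar M) : x \in gpart M k <-> gdeg k (x : M).
Proof.
apply: (@vspace_ofP K (kcar M)); split; first exact: gdeg0.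
by move=> l y z; rewrite kscaleE; apply: gdegP.
Qed.

Definition gge M k : {vspace kcar M} :=
  @vspace_of K (kcar M) (fun x => forall i, i < k -> gc i (x : M) = 0).
Lemma ggeP M k (x : kcar M) : x \in gge M k <-> forall i, i < k -> gc i (x : M) = 0.
Proof.
apply: (@vspace_ofP K (kcar M)); split=> [i _|l y z y0 z0 i ik]; first exact: raddf0.
by rewrite kscaleE raddfD /= gc_k // y0 // z0 // scaler0 addr0.
Qed.

Lemma gge_deg M k i (x : M) : gdeg i x -> k <= i -> (x : kcar M) \in gge M k.
Proof.
move=> xi ki; apply/ggeP => j jk; rewrite (gc_homog xi) ifN //.
by apply: contraTneq jk => ->; rewrite -leNgt.
Qed.

(** The submodule generated by the components of degree at least [k]; for
    varying [k] these form the filtration of [M] whose subquotients will be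
    induced modules. *)
Definition gengen M k := actv fullv (gge M k).

Lemma gge_gengen M k (x : kcar M) : x \in gge M k -> x \in gengen M k.
Proof. by move=> xk; rewrite -[x](scale1r (x : M)); apply: memv_act; rewrite ?memvf. Qed.

Lemma finite_degrees M : exists s : seq int,
  forall i, i \notin s -> forall x : M, gdeg i x -> x = 0.
Proof.
pose b := vbasis {:kcar M}; have /choice[t tE] := @gc_sum _ _ _ M.
exists (flatten [seq t (b`_k) | k <- iota 0 (\dim {:kcar M})]) => i is_ x xi.
rewrite -(gc_id xi); have /= -> := coord_vbasis (memvf (x : kcar M)).
rewrite raddf_sum big1 // => k _; rewrite kscaleE /= gc_k //.
have [_ t0 _] := tE b`_k; rewrite t0 ?scaler0 //.
apply: contra is_ => it; apply/flattenP; exists (t b`_k) => //.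
by apply/mapP; exists (k : nat) => //; rewrite mem_iota add0n ltn_ord.
Qed.

Lemma degree_bound M (k : int) : exists n : nat, `|k| < n%:Z /\
  forall i, n%:Z <= `|i| -> forall x : M, gdeg i x -> x = 0.
Proof.
have [s sE] := finite_degrees M.
exists (\sum_(i <- k :: s) `|i|%N).+1.
have bnd i : i \in k :: s -> `|i| < (\sum_(i <- k :: s) `|i|%N).+1%:Z.
  by move=> iks; rewrite (big_rem i iks) /=; lia.
split=> [|i ni x]; first by apply: bnd; rewrite mem_head.
apply: sE; apply: contraTN ni => is_; rewrite -ltNge bnd // inE is_ orbT //.
Qed.

Lemma top_degree M (x0 : M) : x0 <> 0 -> exists xi,
  (exists2 x : M, gdeg xi x & x <> 0) /\
  forall i, xi < i -> forall x : M, gdeg i x -> x = 0.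
Proof.
move=> x00; have [n [_ nE]] := degree_bound M 0.
pose Q m := `[< exists2 x : M, gdeg (n%:Z - m%:Z) x & x <> 0 >].
have Q0 : exists m, Q m.
  apply: contrapT => h; apply: x00; apply: gc_eq0 => i.
  have [/nE ni|ni] := leP n%:Z `|i|; first exact/ni/gc_deg.
  apply: contrapT => xi; apply: h; exists `|n%:Z - i|%N; apply/asboolP.
  exists (gc i x0) => //; have -> : n%:Z - `|n%:Z - i|%N%:Z = i by lia.
  exact: gc_deg.
case: (ex_minnP Q0) => m /asboolP[x xd xn0] mmin.
exists (n%:Z - m%:Z); split; first by exists x.
move=> i im y yi; apply: contrapT => y0.
have [/nE/(_ y yi) //|ni] := leP n%:Z `|i|.
have /mmin : Q `|n%:Z - i|%N.
  by apply/asboolP; exists y => //; have -> : n%:Z - `|n%:Z - i|%N%:Z = i by lia.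
lia.
Qed.

(** A graded subspace is the direct sum of its homogeneous parts. *)
Lemma graded_dim M (U : {vspace kcar M}) (n : nat) :
  (forall i (x : kcar M), x \in U -> (gc i (x : M) : kcar M) \in U) ->
  (forall i, n%:Z <= `|i| -> forall x : M, gdeg i x -> x = 0) ->
  \dim U = (\sum_(i < n.*2) \dim (gpart M (i%:Z - n%:Z) :&: U))%N.
Proof.
move=> Ugr nE.
pose Us (i : 'I_n.*2) := (gpart M (i%:Z - n%:Z) :&: U)%VS.
have dxU : directv (\sum_i Us i).
  apply/directv_sum_independent => us usU us0 i _.
  have /(congr1 (gc (M := M) (i%:Z - n%:Z))) := us0.
  rewrite raddf0 raddf_sum (bigD1 i) //= big1 ?addr0 => [|j ji].
    by move/esym; rewrite gc_id //; apply/gpartP; have := usU i isT; rewrite memv_cap => /andP[].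
  have /gpartP/gc_homog -> : us j \in gpart M (j%:Z - n%:Z).
    by have := usU j isT; rewrite memv_cap => /andP[].
  rewrite ifN //; apply: contra ji => /eqP ij; apply/eqP/val_inj => /=; lia.
transitivity (\dim (\sum_i Us i)%VS); last exact: (directvP dxU).
congr (\dim _); apply/eqP; rewrite eqEsubv; apply/andP; split; last first.
  by apply/subv_sumP => i _; apply: capvSr.
apply/subvP => x xU; have [s [us s0 xE]] := gc_sum (x : M).
have -> : x = \sum_(i < n.*2) (gc (i%:Z - n%:Z) (x : M) : kcar M).
  rewrite {1}xE.
  transitivity (\sum_(k <- [seq i%:Z - n%:Z | i <- iota 0 n.*2]) gc k (x : M)); last first.
    rewrite big_map (_ : iota 0 n.*2 = index_iota 0 n.*2) ?big_mkord //.
    by rewrite /index_iota subn0.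
  apply/esym; transitivity (\sum_(k <- undup (s ++ [seq i%:Z - n%:Z | i <- iota 0 n.*2])) gc k (x : M)).
    apply/esym/sum_finsupp; rewrite ?undup_uniq // ?map_inj_uniq ?iota_uniq //.
    - by move=> i j; lia.
    - move=> i is_; apply: nE (gc_deg i _); rewrite leNgt; apply: contra is_ => ni.
      by apply/mapP; exists (absz (i + n%:Z)); rewrite ?mem_iota; lia.
    by move=> i is_; rewrite mem_undup mem_cat is_ orbT.
  by apply/sum_finsupp; rewrite ?undup_uniq // => i is_; rewrite mem_undup mem_cat is_.
apply: memv_sumr => i _; rewrite memv_cap; apply/andP; split; last exact: Ugr.
exact/gpartP/gc_deg.
Qed.

End SpaceAction.

(** ** The algebra *)

Section TriangularAlgebra.
Variables (K : fieldType) (A : falgType K) (Ac : int -> {vspace A}).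
Variables (Am T Ap : {aspace A}).
Hypothesis gA : graded_algebra Ac.
Hypothesis td : triangular_decomposition Ac Am T Ap.
Notation Bp := (Ap * T)%VS.
Notation ac := (ac gA).

Lemma graded_sub_ac (U : {aspace A}) i x :
  graded_subalgebra Ac U -> x \in U -> ac i x \in U.
Proof.
move=> [_ gU] /gU[s [f [_ fU ->]]]; rewrite raddf_sum; apply: memv_suml => j _.
have := fU j; rewrite memv_cap => /andP[fjU fj] /=.
by rewrite (ac_homog gA fj); case: eqP => // _; apply: mem0v.
Qed.

Lemma Ap_ac_neg x i : x \in Ap -> i < 0 -> ac i x = 0.
Proof.
move=> xA i0; apply/eqP; rewrite -memv0 -(td_Ap_ge0 td i0) memv_cap ac_deg.
by rewrite (graded_sub_ac _ (td_Ap td)).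
Qed.

Lemma Am_ac_pos x i : x \in Am -> 0 < i -> ac i x = 0.
Proof.
move=> xA i0; apply/eqP; rewrite -memv0 -(td_Am_le0 td i0) memv_cap ac_deg.
by rewrite (graded_sub_ac _ (td_Am td)).
Qed.

Lemma Ap_ac0 x : x \in Ap -> exists k, ac 0 x = k%:A.
Proof.
move=> xA; have : ac 0 x \in (Ap :&: Ac 0)%VS.
  by rewrite memv_cap ac_deg (graded_sub_ac _ (td_Ap td)).
by rewrite (td_Ap0 td) => /vlineP.
Qed.

Lemma Am_ac0 x : x \in Am -> exists k, ac 0 x = k%:A.
Proof.
move=> xA; have : ac 0 x \in (Am :&: Ac 0)%VS.
  by rewrite memv_cap ac_deg (graded_sub_ac _ (td_Am td)).
by rewrite (td_Am0 td) => /vlineP.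
Qed.

Lemma T1 : 1 \in T. Proof. by case: (td_T td). Qed.
Lemma Ap1 : 1 \in Ap. Proof. by case: (td_Ap td). Qed.
Lemma Am1 : 1 \in Am. Proof. by case: (td_Am td). Qed.
Lemma T_deg t : t \in T -> t \in Ac 0.
Proof. by move=> tT; exact: (subvP (td_T0 td)). Qed.

Lemma T_Bp t : t \in T -> t \in Bp.
Proof. by move=> tT; rewrite -[t]mul1r memv_mul ?Ap1. Qed.

Lemma ac_mulr a b i j : b \in Ac j -> ac i (a * b) = ac (i - j) a * b.
Proof.
move=> bj; elim/(homog_ind gA): a => [|a a' aE a'E|l a al].
- by rewrite mul0r !raddf0 mul0r.
- by rewrite mulrDl !raddfD /= aE a'E mulrDl.
rewrite (ac_homog gA (AcM gA al bj)) (ac_homog gA al) subr_eq.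
by case: eqP => //; rewrite mul0r.
Qed.

(** Inherited from [Ap], since [Ap] has only scalars in degree 0 and [T] lies in
    degree 0. *)
Lemma Bp_ac b i : b \in Bp ->
  [/\ ac i b \in Bp, i < 0 -> ac i b = 0 & i = 0 -> ac i b \in T].
Proof.
move: b; apply: prodv_ind.
  split; first by rewrite raddf0 !mem0v.
  move=> k x y [xB x0 xT] [yB y0 yT]; rewrite raddfD /= ac_k; split.
  - by rewrite memvD ?memvZ.
  - by move=> i0; rewrite x0 // y0 // scaler0 addr0.
  by move=> i0; rewrite memvD ?memvZ ?xT ?yT.
move=> y t yA tT; rewrite (ac_mulr y i (T_deg tT)) subr0; split.
- by rewrite memv_mul // (graded_sub_ac _ (td_Ap td)).
- by move=> i0; rewrite Ap_ac_neg // mul0r.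
move=> ->; have [k ->] := Ap_ac0 yA.
by rewrite -scalerAl mul1r memvZ.
Qed.

(** A linear map on [A] that vanishes on all products is 0, by the uniqueness in
    the universal property; apply this to a projection along the span of the
    products. *)
Lemma mult_span : (Am * Bp)%VS = fullv.
Proof.
rewrite (td_ApT td) prodvA; apply/eqP; rewrite eqEsubv subvf /=.
set U := (Am * T * Ap)%VS; apply/subvP => a _.
pose phi (_ : subvs_of Am) (_ : subvs_of T) (_ : subvs_of Ap) : A := 0.
have [|h [_ hU]] := @td_mult _ _ _ _ _ _ td A phi.
  by split=> * k u v; rewrite /phi scaler0 addr0.
pose f : 'End(A) := \1%VF - projv U.
have fE z : f z = z - projv U z by rewrite add_lfunE opp_lfunE id_lfunE.
have h0 := hU (0 : 'End(A)) (fun x t y => zero_lfunE _ _).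
have /(_ a) : f =1 h.
  apply: hU => x t y; rewrite [LHS]fE projv_id ?subrr //.
  by rewrite !memv_mul ?subvsP.
rewrite -h0 [RHS]zero_lfunE fE => /eqP; rewrite subr_eq0 => /eqP ->.
exact: memv_proj.
Qed.

(** By the universal property, the coordinates on the three factors define a
    linear map on [A]. It takes the products of basis elements to the standard
    basis of [W], so it is onto. *)
Lemma mult_dim : (\dim Am * \dim T * \dim Ap <= \dim {:A})%N.
Proof.
pose J := ('I_(\dim Am) * 'I_(\dim T) * 'I_(\dim Ap))%type.
pose W := {ffun J -> K^o}.
pose b1 := vbasis Am; pose b2 := vbasis T; pose b3 := vbasis Ap.
pose phi (x : subvs_of Am) (t : subvs_of T) (y : subvs_of Ap) : W :=
  [ffun j => coord b1 j.1.1 (vsval x) * coord b2 j.1.2 (vsval t) * coord b3 j.2 (vsval y)].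
have [|h [hE _]] := @td_mult _ _ _ _ _ _ td W phi.
  split=> * k u v; apply/ffunP => j; rewrite !ffunE !linearP /=.
  - by rewrite !mulrDl -!mulrA.
  - by rewrite mulrDr mulrDl mulrCA -!mulrA.
  by rewrite mulrDr mulrCA.
have surjh : limg (linfun h) = fullv.
  apply/eqP; rewrite eqEsubv subvf /=; apply/subvP => w _.
  have -> : w = \sum_j w j *: (linfun h (b1`_j.1.1 * b2`_j.1.2 * b3`_j.2)).
    apply/ffunP => j; rewrite sum_ffunE (bigD1 j) //= big1 ?addr0 => [|i ij].
      have := hE (vsproj Am b1`_j.1.1) (vsproj T b2`_j.1.2) (vsproj Ap b3`_j.2).
      rewrite !vsprojK ?vbasis_mem ?mem_nth ?size_tuple // lfunE => ->.
      by rewrite !ffunE !vsprojK ?vbasis_mem ?mem_nth ?size_tuple // !coord_free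
        ?(basis_free (vbasisP _)) // !eqxx !mulr1 [_ *: _]mulr1.
    have := hE (vsproj Am b1`_i.1.1) (vsproj T b2`_i.1.2) (vsproj Ap b3`_i.2).
    rewrite !vsprojK ?vbasis_mem ?mem_nth ?size_tuple // lfunE => ->.
    rewrite !ffunE !vsprojK ?vbasis_mem ?mem_nth ?size_tuple // !coord_free
      ?(basis_free (vbasisP _)) // -!natrM !mulnb.
    rewrite (_ : _ && _ = false) ?[_ *: _]mulr0 //; apply: contraNF ij.
    move=> /andP[/andP[/eqP e1 /eqP e2] /eqP e3]; apply/eqP.
    by move: i j e1 e2 e3 => [[i1 i2] i3] [[j1 j2] j3] /= -> -> ->.
  by apply: memv_suml => j _; apply/memvZ/memv_img/memvf.
have := limg_ker_dim (linfun h) fullv; rewrite surjh => <-.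
rewrite [\dim {:W}]dimvf /dim /= !card_prod !card_ord muln1.
exact: leq_addl.
Qed.

(** ** The dimension bound for a module *)

Definition negAm : {vspace A} :=
  vspace_of (fun x => x \in Am /\ forall i, 0 <= i -> ac i x = 0).

Lemma negAmP x : x \in negAm <-> x \in Am /\ forall i, 0 <= i -> ac i x = 0.
Proof.
apply: vspace_ofP; split=> [|k y z [yA y0] [zA z0]].
  by split=> [|i _]; [apply: mem0v | apply: raddf0].
split=> [|i i0]; first by rewrite memvD ?memvZ.
by rewrite raddfD /= ac_k y0 ?z0 // scaler0 addr0.
Qed.

Lemma Am_neg x : x \in Am -> exists k y, y \in negAm /\ x = k%:A + y.
Proof.
move=> xA; have [k kE] := Am_ac0 xA; exists k, (x - k%:A); split; last by rewrite addrC subrK.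
apply/negAmP; split=> [|i]; first by rewrite memvB ?memvZ ?Am1.
rewrite le_eqVlt raddfB /= ac_k (ac_homog gA (Ac1 gA)) => /orP[/eqP<-|i0].
  by rewrite eqxx kE subrr.
by rewrite Am_ac_pos // gt_eqF // scaler0 subrr.
Qed.

Lemma negAm_ac x i : x \in negAm -> ac i x \in negAm.
Proof.
move=> /negAmP[xA x0]; apply/negAmP; split=> [|j j0].
  by rewrite (graded_sub_ac _ (td_Am td)).
rewrite (ac_homog gA (ac_deg gA i x)); case: eqP => // ji.
by rewrite x0 // -ji.
Qed.

Section Count.
Variable M : gmod Ac.
Notation gpart := (gpart M).
Notation gge := (gge M).
Notation D := (gengen M).
Definition rad_part : {vspace kcar M} := actv negAm fullv.

Lemma Bp_gge b k (x : kcar M) : b \in Bp -> x \in gge k ->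
  (b *: (x : M) : kcar M) \in gge k.
Proof.
move=> bB /(ggeP gA) x0; apply/(ggeP gA) => i ik.
have [s ->] := gc_scale_sum gA i b (x : M); apply: big1 => j _.
have [_ b0 _] := Bp_ac j bB.
have [j0|j0] := ltP j 0; first by rewrite b0 // scale0r.
by rewrite x0 ?scaler0 //; lia.
Qed.

Lemma gge_split k (x : kcar M) : x \in gge k ->
  gc k (x : M) - (x : M) \in gge (k + 1).
Proof.
move=> /(ggeP gA) x0; apply/(ggeP gA) => i ik; rewrite raddfB /= gc_gc.
by case: eqP => [->|ik']; rewrite ?subrr // x0 ?subrr //; lia.
Qed.

(** [A = Am Bp], and [Bp] does not lower degrees: so modulo what higher degrees
    generate, the submodule generated in degrees at least [k] is [Am] times the
    new part of degree [k]. *)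
Lemma gengen_dim_step (k : int) :
  (\dim (D k) <= \dim (D (k + 1)%R) +
     \dim Am * (\dim (gpart k) - \dim (gpart k :&: D (k + 1)%R)))%N.
Proof.
set V := (gpart k :\: D (k + 1)%R)%VS.
have <- : \dim V = (\dim (gpart k) - \dim (gpart k :&: D (k + 1)%R))%N.
  by rewrite -(dimv_cap_compl (gpart k) (D (k + 1)%R)) addKn.
apply: leq_trans (leq_trans (dimvS _) (dimv_add_leqif (D (k + 1)%R) (actv Am V)).1) _; last first.
  by rewrite leq_add2l dim_actv.
have DS a (x : kcar M) : x \in D (k + 1)%R -> (a *: (x : M) : kcar M) \in (D (k + 1)%R + actv Am V)%VS.
  by move=> xD; apply: (subvP (addvSl _ _)); apply: actv_stable.
have partV x (y : kcar M) : x \in Am -> y \in gge k ->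
    (x *: (y : M) : kcar M) \in (D (k + 1)%R + actv Am V)%VS.
  move=> xA yk; have -> : (y : M) = gc k (y : M) - (gc k (y : M) - y) by rewrite opprB addrC subrK.
  rewrite scalerBr memvB //; last exact/DS/gge_gengen/gge_split.
  have : (gc k (y : M) : kcar M) \in (V + gpart k :&: D (k + 1)%R)%VS.
    by rewrite addv_diff_cap; apply/gpartP/gc_deg.
  case/memv_addP=> u uV [v]; rewrite memv_cap => /andP[_ vD] ->.
  rewrite scalerDr; apply: memvD; last exact: DS.
  by apply: (subvP (addvSr _ _)); apply: memv_act.
apply/subvP; apply: actv_ind => [|a y _ yk].
  by split=> [|l u v uU vU]; rewrite ?mem0v // memvD ?memvZ.
have : a \in (Am * Bp)%VS by rewrite mult_span memvf.
move: a; apply: prodv_ind => [|x b xA bB].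
  split=> [|l u v uU vU]; first by rewrite scale0r mem0v.
  by rewrite scalerDl scalerAk -kscaleE memvD ?memvZ.
by rewrite -scalerA; apply: partV => //; apply: Bp_gge.
Qed.

Lemma rad_gc k (x : kcar M) : x \in rad_part ->
  (gc k (x : M) : kcar M) \in rad_part /\ (gc k (x : M) : kcar M) \in D (k + 1)%R.
Proof.
move: x; apply: actv_ind => [|a x aN _].
  split=> [|l u v [uU uD] [vU vD]]; first by rewrite raddf0 !mem0v.
  by rewrite kscaleE raddfD /= gc_k // -kscaleE !memvD ?memvZ.
have [s ->] := gc_scale_sum gA k a (x : M).
split; apply: memv_suml => i _.
  by rewrite memv_act ?memvf ?negAm_ac.
have [i0|i0] := leP 0 i.
  by have /negAmP[_ ->] := aN; rewrite ?scale0r ?mem0v.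
apply: memv_act; rewrite ?memvf //; apply: (gge_deg gA) (gc_deg _ _) _; lia.
Qed.

Lemma rad_sub k : (gpart k :&: rad_part <= gpart k :&: D (k + 1)%R)%VS.
Proof.
apply/subvP => x; rewrite !memv_cap => /andP[xk xr]; rewrite xk /=.
by have [_] := rad_gc k xr; rewrite gc_id //; apply/gpartP.
Qed.

(** Adding up [gengen_dim_step] over all degrees bounds the dimension of [M] by
    [\dim Am] times that of [M / negAm M]: generators of [M] over [Am] may be
    chosen outside [negAm M]. When the bound is attained, so is each of the
    inequalities added up. *)
Lemma rad_dim_bound (k : int) :
  (gdim M + \dim Am * \dim rad_part <= \dim Am * gdim M)%N /\
  ((gdim M + \dim Am * \dim rad_part)%N = (\dim Am * gdim M)%N ->
   \dim (D k) = (\dim (D (k + 1)%R) +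
     \dim Am * (\dim (gpart k) - \dim (gpart k :&: D (k + 1)%R)))%N /\
   (gpart k :&: D (k + 1)%R <= rad_part)%VS).
Proof.
have [n [kn nE]] := degree_bound gA M k.
(* [M] vanishes outside the degrees [-n, ..., n - 1], which are renumbered from
   0. *)
pose deg (i : nat) : int := i%:Z - n%:Z.
have degS i : deg i.+1 = deg i + 1 by rewrite /deg; lia.
pose d i := \dim (D (deg i)); pose m i := \dim (gpart (deg i)).
pose c i := \dim (gpart (deg i) :&: D (deg i + 1)).
pose j i := \dim (gpart (deg i) :&: rad_part).
have [||||le eq] := @telescope_count n.*2 (\dim Am) d c m j.
- by move=> i _; rewrite /d degS; apply: gengen_dim_step.
- by move=> i _; apply/dimvS/rad_sub.
- by move=> i _; apply/dimvS/capvSl.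
- apply/eqP; rewrite dimv_eq0 -subv0; apply/subvP; apply: actv_ind => [|a x _].
    by split=> [|l u v uU vU]; rewrite ?mem0v // memvD ?memvZ.
  move=> /(ggeP gA) x0; rewrite memv0; apply/eqP.
  suff -> : (x : M) = 0 by rewrite scaler0.
  apply: gc_eq0 => i; have [/nE ni|ni] := leP n%:Z `|i|; first exact/ni/gc_deg.
  by apply: x0; rewrite /deg; lia.
have d0 : d 0%N = gdim M.
  congr (\dim _); apply/eqP; rewrite eqEsubv subvf /=; apply/subvP => x _.
  apply/gge_gengen/(ggeP gA) => i i0; apply: nE (gc_deg _ _).
  by move: i0; rewrite /deg; lia.
have mE : (\sum_(i < n.*2) m i)%N = gdim M.
  rewrite /gdim (graded_dim _ nE); last by move=> i x _; apply: memvf.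
  by apply: eq_bigr => i _; rewrite capvf.
have jE : (\sum_(i < n.*2) j i)%N = \dim rad_part.
  by rewrite (graded_dim _ nE) // => i x /(rad_gc i)[].
rewrite d0 mE jE in le eq; split=> // {}/eq eq.
have Am0 : (0 < \dim Am)%N by apply: adim_gt0.
have [|dk ck] := eq Am0 (absz (k + n%:Z)); first by lia.
have kE : deg (absz (k + n%:Z)) = k by rewrite /deg; lia.
split; first by move: dk; rewrite /d /m /c degS kE.
apply: (subv_trans _ (capvSr (gpart k) _)); rewrite -kE.
by rewrite -(dimv_leqif_sup (rad_sub _)).2; apply/eqP/esym; exact: ck.
Qed.
End Count.

(** The case of equality in [rad_dim_bound]. It says that [M] is free over [Am]:
    its dimension is [\dim Am] times that of [M / negAm M]. *)
Definition balanced_dim (M : gmod Ac) : Prop :=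
  (gdim M + \dim Am * \dim (rad_part M))%N = (\dim Am * gdim M)%N.

(** [F] is the direct sum of [N] and the kernel of [r]. The two sides of the
    bound are additive and each summand satisfies it, so equality for [F] forces
    equality for [N]. *)
Lemma balanced_retract (N F : gcat Ac) (i : hom N F) (r : hom F N) :
  r \oc i = idm N -> balanced_dim F -> balanced_dim N.
Proof.
move=> ri; rewrite /balanced_dim => bF.
have riE x : gfun r (gfun i x) = x := congr1 (fun h : gmor N N => h x) ri.
have sK := gsubmod_ker r; pose N' := sub_gmod sK; pose i' : gmor N' F := sub_inc sK.
have Ii' : injective i' := @sub_inc_inj _ _ _ _ _ sK.
have dF : gdim F = (gdim N' + gdim N)%N.
  apply: (@gdim_ses _ _ _ N' F N i' r) => // [y|y]; first by exists (gfun i y).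
  exact: sub_incP.
have [leN _] := rad_dim_bound N 0; have [leN' _] := rad_dim_bound N' 0.
have radF : (\dim (rad_part F) <= \dim (rad_part N) + \dim (rad_part N'))%N.
  have sub : (rad_part F <= glfun i @: rad_part N + glfun i' @: rad_part N')%VS.
    apply/subvP; apply: actv_ind => [|a x aN _].
      by split=> [|l u v uU vU]; rewrite ?mem0v // memvD ?memvZ.
    have [w wE] : exists w, i' w = (x : F) - gfun i (gfun r x).
      by apply/(sub_incP sK); rewrite raddfB /= riE subrr.
    have -> : (x : F) = gfun i (gfun r x) + i' w by rewrite wE addrC subrK.
    rewrite scalerDr -gmorE -[a *: i' w]gmorE; apply: memv_add.
      by rewrite -(glfunE (M := N)); apply/memv_img/memv_act; rewrite ?memvf.
    by rewrite -glfunE; apply/memv_img/memv_act; rewrite ?memvf.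
  apply: leq_trans (dimvS sub) (leq_trans (dimv_add_leqif _ _).1 _).
  have dimg (V W : vectType K) (f : 'Hom(V, W)) U : (\dim (f @: U) <= \dim U)%N.
    by rewrite -(limg_ker_dim f U) leq_addl.
  by apply: leq_add; apply: dimg.
rewrite dF in bF; nia.
Qed.

Section FreeRankOne.
Variable xi : int.
Let F : gmod Ac := free_gmod gA (fun _ : 'I_1 => xi).
Let e : F := free_gen gA _ ord0.

Let orbit : A -> kcar F := fun a => a *: e.
Let orbit_lin : linear orbit.
Proof. by move=> k a b; rewrite /orbit scalerDl scalerAk. Qed.
HB.instance Definition _ := GRing.isLinear.Build K A (kcar F) _ orbit orbit_lin.

Lemma free_orbit_inj a : a *: e = 0 -> a = 0.
Proof.
move=> /(congr1 (fun f : {ffun 'I_1 -> A^o} => f ord0)).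
by rewrite /e /free_gen !ffunE eqxx [_ *: _]mulr1.
Qed.

Lemma free_orbit_surj (x : F) : exists a, x = a *: e.
Proof. by eexists; rewrite [LHS]free_expand big_ord1. Qed.

Lemma free1_dim : gdim F = \dim {:A}.
Proof.
have := limg_ker_dim (linfun orbit) fullv.
have -> : lker (linfun orbit) = 0%VS.
  apply/eqP; rewrite -subv0; apply/subvP => a.
  by rewrite memv_ker lfunE memv0 => /eqP/free_orbit_inj/eqP.
rewrite capv0 dimv0 add0n => <-; congr (\dim _); apply/eqP.
rewrite eq_sym eqEsubv subvf /=; apply/subvP => x _.
have [a ->] := free_orbit_surj x.
by rewrite -[a *: e](lfunE orbit) memv_img ?memvf.
Qed.

(** [A = negAm A + Bp], so [A / negAm A] has at most the dimension of [Bp]; but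
    [\dim Am * \dim Bp] is at most the dimension of [A]. Together with
    [rad_dim_bound] this makes all the inequalities equalities. *)
Lemma free1_balanced : balanced_dim F /\
  (rad_part F :&: actv Bp <[e : kcar F]> = 0)%VS.
Proof.
have [le _] := rad_dim_bound F 0; rewrite /balanced_dim.
have full : (rad_part F + actv Bp <[e : kcar F]> = fullv)%VS.
  apply/eqP; rewrite eqEsubv subvf /=; apply/subvP => x _.
  have [a ->] := free_orbit_surj x.
  have : a \in (Am * Bp)%VS by rewrite mult_span memvf.
  move: a; apply: prodv_ind => [|y b /Am_neg[k [z [zN ->]]] bB].
    split=> [|k a b aU bU]; first by rewrite scale0r mem0v.
    by rewrite scalerDl scalerAk -kscaleE memvD ?memvZ.
  rewrite mulrDl scalerDl addrC; apply: memv_add.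
    by rewrite -scalerA memv_act ?memvf.
  by rewrite -scalerAl mul1r memv_act ?memvZ ?memv_line.
have d1 := dim_actv Bp <[e : kcar F]>; have d2 := dimv_sum_cap (rad_part F) (actv Bp <[e : kcar F]>).
have d3 : (\dim <[e : kcar F]> <= 1)%N by rewrite dim_vline leq_b1.
have d4 := dim_prodv Ap T; have d5 := mult_dim.
rewrite full -/(gdim F) in d2; rewrite -free1_dim in d5.
have Am0 : (0 < \dim Am)%N by apply: adim_gt0.
have d6 : (\dim (actv Bp <[e : kcar F]>) <= \dim Bp)%N.
  by apply: leq_trans d1 _; rewrite -[X in (_ <= X)%N]muln1 leq_mul2l d3 orbT.
have d7 : (\dim Am * \dim Bp <= gdim F)%N.
  by apply: leq_trans d5; rewrite -mulnA leq_mul2l [(\dim T * _)%N]mulnC d4 orbT.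
have d8 : (\dim Am * gdim F <= \dim Am * \dim (rad_part F) + \dim Am * \dim Bp)%N.
  by rewrite -mulnDr leq_mul2l; apply/orP; right; lia.
split; first by lia.
apply/eqP; rewrite -dimv_eq0.
have : (\dim Am * (\dim (rad_part F) + \dim Bp) <= \dim Am * gdim F)%N by rewrite mulnDr; lia.
rewrite leq_pmul2l //; lia.
Qed.
End FreeRankOne.

Definition posA : {vspace A} := vspace_of (fun a => forall i, i <= 0 -> ac i a = 0).
Lemma posAP a : a \in posA <-> forall i, i <= 0 -> ac i a = 0.
Proof.
apply: vspace_ofP; split=> [i _|k x y x0 y0 i i0]; first exact: raddf0.
by rewrite raddfD /= ac_k x0 // y0 // scaler0 addr0.
Qed.

(** The elements of degree 0 of the left ideal [A posA] lie in [negAm A], by the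
    case of equality in [rad_dim_bound] for [A] itself, and [negAm A] meets [Bp]
    trivially. *)
Lemma T_posA_trivial t : t \in T -> t \in (fullv * posA)%VS -> t = 0.
Proof.
move=> tT tI; pose F : gmod Ac := free_gmod gA (fun _ : 'I_1 => 0).
pose e : F := free_gen gA _ ord0.
have e0 : gdeg 0 e := free_gen_deg gA _ ord0.
have [bF cap0] := free1_balanced 0; have [_ /(_ bF)[_ sub]] := rad_dim_bound F 0.
apply: (@free_orbit_inj 0); rewrite -/e.
suff : (t *: e : kcar F) \in (rad_part F :&: actv Bp <[e : kcar F]>)%VS.
  by rewrite [(_ :&: _)%VS]cap0 memv0 => /eqP.
rewrite memv_cap; apply/andP; split; last by rewrite memv_act ?T_Bp ?memv_line.
apply: (subvP sub); rewrite memv_cap; apply/andP; split.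
  by apply/gpartP; rewrite -[0]addr0; apply: gdegZ => //; apply: T_deg.
move: t tI {tT}; apply: prodv_ind => [|a b _ /posAP b0].
  split=> [|k a b aU bU]; first by rewrite scale0r mem0v.
  by rewrite scalerDl scalerAk -kscaleE memvD ?memvZ.
rewrite -scalerA; apply: memv_act; rewrite ?memvf //; apply/(ggeP gA) => i i0.
have [s ->] := gc_scale_sum gA i b e; apply: big1 => j _.
rewrite (gc_homog e0); case: eqP => [ij|_]; last by rewrite scaler0.
by rewrite b0 ?scale0r //; lia.
Qed.

End TriangularAlgebra.

Lemma free_gc (K : fieldType) (A : falgType K) (Ac : int -> {vspace A})
    (gA : graded_algebra Ac) n (js : 'I_n -> int) k (f : free_gmod gA js) l :
  (gc k f : {ffun 'I_n -> A^o}) l = ac gA (k - js l) ((f : {ffun 'I_n -> A^o}) l).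
Proof.
have [s [us s0 fE]] := gc_sum f; rewrite [in RHS]fE sum_ffunE raddf_sum /=.
have hom j : ac gA (k - js l) ((gc j f : {ffun 'I_n -> A^o}) l) =
    if k == j then (gc j f : {ffun 'I_n -> A^o}) l else 0.
  have /free_degP/(_ l)/(ac_homog gA) -> := gc_deg j f.
  by rewrite (inj_eq (addIr _)).
under eq_bigr do rewrite hom.
have [ks|ks] := boolP (k \in s).
  rewrite (bigD1_seq _ ks us) /= eqxx big1 ?addr0 // => j jk.
  by rewrite ifN // eq_sym.
rewrite s0 // ffunE big1_seq // => j /andP[_ js'].
by rewrite ifN //; apply: contraNneq ks => ->.
Qed.

(** * Induction from the positive part *)

Section Induction.
Variables (K : fieldType) (A : falgType K) (Ac : int -> {vspace A}).
Variables (Am T Ap : {aspace A}).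
Hypothesis gA : graded_algebra Ac.
Hypothesis td : triangular_decomposition Ac Am T Ap.
Notation Bp := (Ap * T)%VS.
Notation ac := (ac gA).
Notation Bc := (sub_grading Ac T).
Notation GT := (gcat Bc).

Lemma vsval1 : vsval (1 : subvs_of T) = 1.
Proof. by apply/eqP; rewrite [vsval 1]/(algid T) algid_eq1 (T1 td). Qed.

Lemma vsval0 : vsval (0 : subvs_of T) = 0. Proof. by []. Qed.

Lemma vsval_k (k : K) : vsval (k%:A : subvs_of T) = k%:A.
Proof. by rewrite linearZ; congr (_ *: _); apply: vsval1. Qed.

Lemma T_graded : graded_algebra Bc.
Proof.
have deg0 (t : subvs_of T) : t \in Bc 0.
  by rewrite -memv_preim lfunE; apply: (T_deg td (subvsP t)).
have degN (t : subvs_of T) i : t \in Bc i -> i != 0 -> t = 0.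
  rewrite -memv_preim lfunE /= => ti i0; apply: subvs_inj.
  have := ac_homog gA (T_deg td (subvsP t)) i; rewrite (negPf i0).
  by rewrite (ac_homog gA ti) eqxx.
split; first 1 last.
- exact: deg0.
- move=> i j; apply/prodvP => u v ui vj.
  have [->|i0] := eqVneq i 0; last by rewrite (degN _ _ ui) // mul0r mem0v.
  have [->|j0] := eqVneq j 0; last by rewrite (degN _ _ vj) // mulr0 mem0v.
  by rewrite addr0.
split=> [t|s f us fd f0 i is_].
  exists [:: 0], (fun i => if i == 0 then t else 0); split=> // [i|].
    by case: eqP => [->|_]; rewrite ?deg0 ?mem0v.
  by rewrite big_seq1 eqxx.
have [i0|i0] := eqVneq i 0; last exact: degN (fd i) i0.
have := f0; rewrite (bigD1_seq i) //= big1 ?addr0 // => j ji.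
by apply: degN (fd j) _; rewrite -i0.
Qed.

Lemma Bp_to_T_self (t : subvs_of T) : Bp_to_T Ac Ap (vsval t) t.
Proof.
split; first exact/(T_Bp td)/subvsP.
by exists [::], (fun=> 0); split=> // [i|]; rewrite ?mem0v // big_nil subrr.
Qed.

Lemma Bp_to_T_pos b j : b \in Bp -> b \in Ac j -> 0 < j ->
  Bp_to_T Ac Ap b (0 : subvs_of T).
Proof.
move=> bB bj j0; split=> //.
exists [:: j], (fun i => if i == j then b else 0); split=> [|i|].
- by rewrite /= j0.
- by case: eqP => [->|_]; rewrite ?mem0v // memv_cap bB.
by rewrite big_seq1 eqxx; apply: subr0.
Qed.

Lemma Bp_to_T_ex b : b \in Bp -> exists t : subvs_of T, Bp_to_T Ac Ap b t.
Proof.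
move=> bB; have [_ _ /(_ erefl) b0T] := Bp_ac gA td 0 bB.
exists (vsproj T (ac 0 b)); split=> //; rewrite vsprojK //.
have [s [us s0 bE]] := ac_sum gA b.
exists (filter (fun i => 0 < i) s), (ac^~ b); split=> [|i|].
- exact: filter_all.
- by rewrite memv_cap ac_deg; case: (Bp_ac gA td i bB) => ->.
apply: (canLR (addrK _)); rewrite big_filter {1}bE (bigID (fun i : int => 0 < i)) /=.
congr (_ + _).
have [s_0|s_0] := boolP (0 \in s); last first.
  rewrite s0 // big1_seq // => i /andP[i0 is_]; case: (Bp_ac gA td i bB) => _ -> //.
  by rewrite lt_neqAle leNgt i0 andbT; apply: contraNneq s_0 => <-.
rewrite big_mkcond (bigD1_seq _ s_0 us) /= ?ltxx big1 ?addr0 // => i i00.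
case: ifP => // i0; case: (Bp_ac gA td i bB) => _ -> //.
by rewrite lt_neqAle i00 leNgt.
Qed.

(** ** The projection of [A] onto [T] *)

Notation posI := (fullv * posA gA)%VS.

Lemma posA_deg j a : a \in Ac j -> 0 < j -> a \in posA gA.
Proof.
move=> aj j0; apply/posAP => i i0; rewrite (ac_homog gA aj) ifN //.
by apply: contraTneq j0 => <-; rewrite -leNgt.
Qed.

(** In degree 0, a product of [negAm] and [Bp] involves only components of
    positive degree of the second factor. *)
Lemma theta_ex a : exists t : subvs_of T, ac 0 a - vsval t \in posI.
Proof.
have : a \in (Am * Bp)%VS by rewrite (mult_span td) memvf.
move: a; apply: prodv_ind => [|x b /(Am_neg gA td)[k [z [zN ->]]] bB].
  split=> [|k a b [t tE] [u uE]]; first by exists 0; rewrite raddf0 vsval0 subr0 mem0v.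
  exists (k *: t + u); rewrite raddfD /= ac_k.
  by rewrite opprD addrACA -scalerBr memvD ?memvZ.
have [_ _ /(_ erefl) b0T] := Bp_ac gA td 0 bB.
exists (k *: vsproj T (ac 0 b)).
have -> : vsval (k *: vsproj T (ac 0 b)) = k *: ac 0 b by rewrite linearZ /= vsprojK.
rewrite mulrDl -scalerAl mul1r raddfD /= ac_k addrAC subrr add0r.
have [s [us s0 ->]] := ac_sum gA b.
rewrite mulr_sumr raddf_sum; apply: memv_suml => i _ /=.
rewrite (ac_mulr _ _ _ (ac_deg gA i b)) sub0r.
have [i0|i0] := leP i 0.
  by have /negAmP[_ ->] := zN; rewrite ?mul0r ?mem0v // oppr_ge0.
by rewrite memv_mul ?memvf // (posA_deg (ac_deg gA i b)).
Qed.

(** The projection of [A] onto [T] along the components of nonzero degree and the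
    left ideal generated by [posA]. Because of [theta_mul], [theta a *: x] is a
    balanced function of [a] and [x] for every [T]-module. *)
Definition theta a : subvs_of T := projT1 (cid (theta_ex a)).
Lemma thetaP a : ac 0 a - vsval (theta a) \in posI.
Proof. by rewrite /theta; case: cid. Qed.

Lemma theta_uniq a (t : subvs_of T) : ac 0 a - vsval t \in posI -> theta a = t.
Proof.
move=> at_; apply/eqP; rewrite -subr_eq0; apply/eqP/subvs_inj.
apply: (T_posA_trivial (gA := gA) td); first exact: subvsP.
have -> : vsval (theta a - t) = (ac 0 a - vsval t) - (ac 0 a - vsval (theta a)).
  by rewrite linearB opprB [RHS]addrC addrA subrK.
by apply: memvB => //; apply: thetaP.
Qed.

Lemma thetaD a b : theta (a + b) = theta a + theta b.
Proof.
apply: theta_uniq; rewrite raddfD /= opprD addrACA.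
by apply: memvD; apply: thetaP.
Qed.

Lemma theta1 : theta 1 = 1.
Proof.
by apply: theta_uniq; rewrite (ac_homog gA (Ac1 gA)) eqxx vsval1 subrr mem0v.
Qed.

Lemma theta_mul a b t : Bp_to_T Ac Ap b t -> theta (a * b) = theta a * t.
Proof.
move=> [bB [s [f [s0 fB /eqP]]]]; rewrite subr_eq => /eqP ->.
apply: theta_uniq; rewrite mulrDr raddfD /= (ac_mulr _ _ _ (T_deg td (subvsP t))) subr0.
rewrite -addrA -mulrBl.
apply: memvD.
  rewrite mulr_sumr raddf_sum big_seq; apply: memv_suml => i /(allP s0) i0 /=.
  have := fB i; rewrite memv_cap => /andP[_ fi].
  by rewrite (ac_mulr _ _ _ fi) memv_mul ?memvf // (posA_deg fi).
move: (ac 0 a - _) (thetaP a); apply: prodv_ind => [|c p _ /posAP p0].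
  split=> [|k x y xI yI]; first by rewrite mul0r mem0v.
  by rewrite mulrDl -scalerAl memvD ?memvZ.
rewrite -mulrA memv_mul ?memvf //; apply/posAP => i i0.
by rewrite (ac_mulr _ _ _ (T_deg td (subvsP t))) subr0 p0 // mul0r.
Qed.

(** ** The induced module *)

Section Module.
Variables (xi : int) (X : GT).
Hypothesis pureX : forall x : gcar X, gdeg xi x.
Let n := \dim {:kcar X}.
Let e (i : 'I_n) : gcar X := (vbasis {:kcar X})`_i.
Let c (i : 'I_n) (x : gcar X) : K := coord (vbasis {:kcar X}) i (x : kcar X).
Let F : gmod Ac := free_gmod gA (fun _ : 'I_n => xi).
Let FF : Type := {ffun 'I_n -> A^o}.
Let phi0 (a : A) (x : gcar X) : F := [ffun i => c i x *: a] : {ffun 'I_n -> A^o}.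

Lemma balanced_scale (W : zmodType) (psi : A -> gcar X -> W) k a x :
  balanced Ap psi -> psi (k *: a) x = psi a ((k%:A : subvs_of T) *: x).
Proof.
move=> [_ _ bal]; rewrite -(bal _ (vsval (k%:A : subvs_of T))); last exact: Bp_to_T_self.
by rewrite vsval_k -scalerAr mulr1.
Qed.

Lemma balanced_additive (W : zmodType) (psi : A -> gcar X -> W) : balanced Ap psi ->
  [/\ forall x, psi 0 x = 0, forall a, psi a 0 = 0,
      forall a b x, psi (a - b) x = psi a x - psi b x
    & forall a x y, psi a (x - y) = psi a x - psi a y].
Proof.
move=> [Dl Dr _].
have z1 x : psi 0 x = 0 by apply: (addrI (psi 0 x)); rewrite -Dl !addr0.
have z2 a : psi a 0 = 0 by apply: (addrI (psi a 0)); rewrite -Dr !addr0.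
split=> // [a b x|a x y]; apply: (canRL (addrK _)).
  by rewrite -Dl subrK.
by rewrite -Dr subrK.
Qed.

Lemma balanced_phi0 (W : zmodType) (psi : A -> gcar X -> W) a x :
  balanced Ap psi -> \sum_i psi ((phi0 a x : FF) i) (e i) = psi a x.
Proof.
move=> bal; have [z1 z2 _ _] := balanced_additive bal; have [_ Dr _] := bal.
have /= xE := coord_vbasis (memvf (x : kcar X)).
rewrite {2}xE (big_morph (psi a) (Dr a) (z2 a)); apply: eq_bigr => i _.
by rewrite ffunE balanced_scale.
Qed.

(** [A (x)_{Bp} X] is the free module on a basis of [X] modulo the elements
    that every balanced map kills. With the relations described from above in
    this way, balanced maps factor through the quotient by definition; what has
    to be proved is that these elements form a graded submodule. *)
Definition ind_rel (f : F) : Prop :=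
  forall (W : zmodType) (psi : A -> gcar X -> W), balanced Ap psi ->
    \sum_i psi ((f : FF) i) (e i) = 0.

Lemma ind_relP : gsubmod ind_rel.
Proof.
split=> [W psi bal|a f g fR gR W psi bal|k f fR W psi bal].
- have [z1 _ _ _] := balanced_additive bal.
  by apply: big1 => i _; rewrite ffunE.
- have [Dl Dr B] := bal.
  have bal' : balanced Ap (fun b x => psi (a * b) x).
    split=> [b b' x|b x x'|b b' t x bt]; first by rewrite mulrDr Dl.
      by rewrite Dr.
    by rewrite mulrA (B _ _ _ _ bt).
  have := congr2 +%R (fR _ _ bal') (gR _ _ bal); rewrite addr0 -big_split /=.
  by apply: etrans; apply: eq_bigr => i _; rewrite !ffunE Dl.
have [Dl Dr B] := bal.
have [z1 z2 Bl _] := balanced_additive bal.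
have bal' : balanced Ap (fun b x => psi (ac (k - xi) b) x).
  split=> [b b' x|b x x'|b b' t x [bB [s [f' [s0 fB /eqP]]]]].
  - by rewrite raddfD Dl.
  - by rewrite Dr.
  rewrite subr_eq => /eqP ->; rewrite mulrDr raddfD Dl /=.
  rewrite (ac_mulr _ _ _ (T_deg td (subvsP t))) subr0 (B _ _ _ _ (Bp_to_T_self t)).
  rewrite mulr_sumr raddf_sum (big_morph (psi^~ x) (fun a b => Dl a b x) (z1 x)).
  rewrite big1_seq ?add0r // => i /andP[_ /(allP s0) i0].
  have := fB i; rewrite memv_cap => /andP[fiB fi] /=.
  by rewrite (ac_mulr _ _ _ fi) (B _ _ _ _ (Bp_to_T_pos fiB fi i0)) scale0r z2.
apply: etrans (fR _ _ bal'); apply: eq_bigr => i _.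
by rewrite [(gc k f : FF) i]free_gc.
Qed.

Definition ind : gmod Ac := quot_gmod ind_relP.
Let pr : gmor F ind := quot_pr ind_relP.
Definition ind_tensor (a : A) (x : gcar X) : ind := pr (phi0 a x).

Lemma ind_tensor_eq0 a x : ind_tensor a x = 0 <->
  forall (W : zmodType) (psi : A -> gcar X -> W), balanced Ap psi -> psi a x = 0.
Proof.
rewrite /ind_tensor; split=> [/quot_prP R0 W psi bal|R0].
  by rewrite -(balanced_phi0 a x bal); apply: R0.
by apply/quot_prP => W psi bal; rewrite balanced_phi0 //; apply: R0.
Qed.

Lemma ind_tensorZ a b x : ind_tensor (a * b) x = a *: ind_tensor b x.
Proof.
rewrite /ind_tensor -gmorE; congr (gfun pr _); apply/ffunP => i.
by rewrite !ffunE scalerAr.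
Qed.

Lemma ind_tensorE a x : ind_tensor a x = a *: ind_tensor 1 x.
Proof. by rewrite -ind_tensorZ mulr1. Qed.

Lemma ind_balanced : balanced Ap ind_tensor.
Proof.
split=> [a a' x|a x x'|a b t x bt].
- rewrite /ind_tensor -raddfD; congr (gfun pr _); apply/ffunP => i.
  by rewrite !ffunE scalerDr.
- rewrite /ind_tensor -raddfD; congr (gfun pr _); apply/ffunP => i.
  rewrite !ffunE.
  have -> : c i (x + x') = c i x + c i x' by apply: (linearD (coord (vbasis {:kcar X}) i)).
  exact: (scalerDl a (c i x) (c i x')).
apply/eqP; rewrite -subr_eq0 /ind_tensor -raddfB; apply/eqP.
apply/quot_prP => W psi bal; have [_ _ Bl _] := balanced_additive bal.
have [_ _ B] := bal.
have E : psi (a * b) x - psi a (t *: x) = 0 by rewrite (B _ _ _ _ bt) subrr.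
rewrite -[RHS]E -(balanced_phi0 _ _ bal) -(balanced_phi0 a _ bal) -sumrB.
by apply: eq_bigr => i _; rewrite !ffunE Bl.
Qed.

Lemma ind_deg i j a x : a \in Ac i -> gdeg j x -> gdeg (i + j) (ind_tensor a x).
Proof.
move=> ai xj; have [x0|x0] := eqVneq x 0.
  rewrite x0; case: (balanced_additive ind_balanced) => _ -> _ _; exact: gdeg0.
have -> : j = xi.
  by apply/eqP; apply: contraNT x0 => ji; apply/eqP; apply: gdeg_uniq xj (pureX x) ji.
apply: gmor_deg; apply/free_degP => l; rewrite ffunE addrK; exact: memvZ.
Qed.

Lemma ind_span (y : ind) : exists a : 'I_n -> A, y = \sum_i a i *: ind_tensor 1 (e i).
Proof.
have [f <-] := quot_pr_surj y; exists (fun i => (f : FF) i).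
rewrite {1}(free_expand f) raddf_sum; apply: eq_bigr => i _.
apply: etrans (gmorE pr _ _) _.
congr (_ *: gfun pr _); apply/ffunP => j; rewrite !ffunE.
have -> : c j (e i) = (i == j)%:R.
  exact: (coord_free i j (basis_free (vbasisP {:kcar X}))).
by rewrite eq_sym; case: eqP => _; [exact: (esym (scale1r (1 : A))) | exact: (esym (scale0r (1 : A)))].
Qed.

Lemma ind_ext (M : zmodType) (h h' : {additive gcar ind -> M}) :
  (forall a x, h (ind_tensor a x) = h' (ind_tensor a x)) -> h =1 h'.
Proof.
move=> hh y; have [a ->] := ind_span y; rewrite !raddf_sum.
by apply: eq_bigr => i _; rewrite -ind_tensorE.
Qed.

Lemma ind_is_induced : is_induced Ap X ind.
Proof.
exists ind_tensor; split.
- exact: ind_balanced.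
- move=> W psi bal; have [z1 _ Bl _] := balanced_additive bal.
  pose g (f : gcar F) := \sum_i psi ((f : FF) i) (e i).
  have gB : {morph g : f f' / f - f'}.
    by move=> f f'; rewrite /g -sumrB; apply: eq_bigr => i _; rewrite !ffunE Bl.
  have /choice[s sE] := @quot_pr_surj _ _ _ _ _ ind_relP.
  have gE f f' : pr f = pr f' -> g f = g f'.
    move=> ff'; apply/eqP; rewrite -subr_eq0 -gB; apply/eqP.
    have /quot_prP/(_ W psi bal) // : pr (f - f') = 0 by rewrite gmor_additive ff' subrr.
  have hB : {morph (fun y => g (s y)) : y y' / y - y'}.
    by move=> y y'; rewrite -gB; apply: gE; rewrite gmor_additive /pr !sE.
  pose h : {additive gcar ind -> W} := HB.pack (fun y => g (s y))
    (GRing.isZmodMorphism.Build _ _ (fun y => g (s y)) hB).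
  have hE a x : h (ind_tensor a x) = psi a x.
    by rewrite -(balanced_phi0 a x bal); apply: gE; rewrite sE.
  exists h; split=> // h' h'E; apply: ind_ext => a x.
  by rewrite h'E hE.
- exact: ind_tensorZ.
exact: ind_deg.
Qed.

Lemma ind_tensorT (t : subvs_of T) x :
  vsval t *: ind_tensor 1 x = ind_tensor 1 (t *: x).
Proof.
case: ind_balanced => _ _ bal; rewrite -ind_tensorE -(bal _ _ _ _ (Bp_to_T_self t)).
by rewrite mul1r.
Qed.

Lemma ind_tensorD x y : ind_tensor 1 (x + y) = ind_tensor 1 x + ind_tensor 1 y.
Proof. by case: ind_balanced. Qed.

(** The balanced map [theta a *: x] takes the value [x] at [a = 1]. *)
Lemma ind_inj x : ind_tensor 1 x = 0 -> x = 0.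
Proof.
move=> /ind_tensor_eq0/(_ X (fun a x => theta a *: x)) x0.
rewrite -[x]scale1r -theta1; apply: x0.
split=> [a a' y|a y y'|a b t y bt]; first by rewrite thetaD scalerDl.
  by rewrite scalerDr.
by rewrite (theta_mul _ bt) scalerA.
Qed.

Lemma ind_lift (M : gmod Ac) (u : gcar X -> M) : {morph u : x y / x + y} ->
  (forall (t : subvs_of T) x, u (t *: x) = vsval t *: u x) ->
  (forall x, gdeg xi (u x)) ->
  (forall b j x, b \in Bp -> b \in Ac j -> 0 < j -> b *: u x = 0) ->
  exists h : gmor ind M, forall a x, h (ind_tensor a x) = a *: u x.
Proof.
move=> uD uT ud u0.
have bal : balanced Ap (fun a x => a *: u x).
  split=> [a a' y|a y y'|a b t y [bB [s [f [s0 fB /eqP]]]]].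
  - by rewrite scalerDl.
  - by rewrite uD scalerDr.
  rewrite subr_eq => /eqP ->; rewrite uT mulrDr scalerDl scalerA mulr_sumr scaler_suml.
  rewrite big1_seq ?add0r // => i /andP[_ /(allP s0) i0].
  have := fB i; rewrite memv_cap => /andP[fiB fi].
  by rewrite -scalerA (u0 _ _ _ fiB fi i0) scaler0.
have [g gE] := free_map gA (m := fun i : 'I_n => u (e i)) (fun i => ud (e i)).
have gF (f : F) : g f = \sum_i (f : FF) i *: u (e i).
  rewrite {1}(free_expand f) raddf_sum; apply: eq_bigr => i _.
  by apply: etrans (gmorE g _ _) _; rewrite gE.
have [|h hE] := gmor_desc (p := pr) (g := g) (@quot_pr_surj _ _ _ _ _ ind_relP).
  by move=> f /quot_prP/(_ M _ bal); rewrite gF.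
by exists h => a x; rewrite hE gF (balanced_phi0 a x bal).
Qed.

(** [A = Am Bp], and [Bp] preserves the image of [X]. *)
Lemma ind_Am_span (P : ind -> Prop) : P 0 -> (forall y z, P y -> P z -> P (y + z)) ->
  (forall a x, a \in Am -> P (a *: ind_tensor 1 x)) -> forall y, P y.
Proof.
move=> P0 PD Pa y; have [a ->] := ind_span y.
elim/big_rec: _ => // i z _; apply: (PD); move: (e i) => x.
suff [s sE] : exists s : seq (A * gcar X), all (fun p => p.1 \in Am) s /\
    a i *: ind_tensor 1 x = \sum_(p <- s) p.1 *: ind_tensor 1 p.2.
  case: sE => /allP sA ->; rewrite big_seq; elim/big_rec: _ => // p w /sA pA.
  by apply: PD; apply: Pa.
have : a i \in (Am * Bp)%VS by rewrite (mult_span td) memvf.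
move: (a i); apply: prodv_ind => [|c0 b cA /Bp_to_T_ex[t bt]].
  split=> [|k u v [s [sA sE]] [s' [sA' sE']]].
    by exists [::]; rewrite scale0r big_nil.
  exists ([seq (k *: p.1, p.2) | p <- s] ++ s'); split.
    rewrite all_cat sA' andbT all_map; apply/allP => p /(allP sA) pA /=.
    exact: memvZ.
  rewrite scalerDl scalerAk sE sE' big_cat big_map scaler_sumr; congr (_ + _).
  by apply: eq_bigr => p _; apply: esym; apply: scalerAk.
exists [:: (c0, t *: x)]; rewrite /= cA big_seq1; split=> //=.
case: ind_balanced => _ _ bal.
by rewrite -ind_tensorE (bal _ _ _ _ bt) ind_tensorE.
Qed.

Lemma ind_gc k a x : a \in Am ->
  gc k (a *: ind_tensor 1 x) = ac (k - xi) a *: ind_tensor 1 x.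
Proof.
move=> aA; have [s [us s0 {1}->]] := ac_sum gA a.
have d1 : gdeg xi (ind_tensor 1 x).
  by rewrite -[xi]add0r; apply: ind_deg (Ac1 gA) (pureX x).
rewrite scaler_suml raddf_sum.
have hom i : gc k (ac i a *: ind_tensor 1 x) =
    if k - xi == i then ac i a *: ind_tensor 1 x else 0.
  by rewrite (gc_homog (gdegZ (ac_deg gA i a) d1)) subr_eq.
rewrite (eq_bigr _ (fun i _ => hom i)).
have [ks|ks] := boolP (k - xi \in s).
  rewrite (bigD1_seq _ ks us) /= eqxx big1 ?addr0 // => j jk.
  by rewrite ifN // eq_sym.
rewrite s0 // scale0r big1_seq // => j /andP[_ js].
by rewrite ifN //; apply: contraNneq ks => ->.
Qed.

Lemma ind_supp k (y : ind) : xi < k -> gdeg k y -> y = 0.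
Proof.
move=> xk /gc_id <-; move: y; apply: ind_Am_span => [|y z y0 z0|a x aA].
- exact: raddf0.
- by rewrite raddfD /= y0 z0 addr0.
by rewrite ind_gc // (Am_ac_pos gA td aA) ?scale0r // subr_gt0.
Qed.

Lemma ind_top (y : ind) : gdeg xi y -> exists x, y = ind_tensor 1 x.
Proof.
move=> /gc_id <-; move: y; apply: ind_Am_span => [|y z [x xE] [x' x'E]|a x aA].
- by exists 0; rewrite raddf0; case: (balanced_additive ind_balanced).
- by exists (x + x'); rewrite raddfD /= xE x'E ind_tensorD.
rewrite ind_gc // subrr; have [k ->] := Am_ac0 gA td aA.
by exists ((k%:A : subvs_of T) *: x); rewrite -ind_tensorT vsval_k.
Qed.

Lemma ind_dim : (gdim ind <= \dim Am * gdim X)%N.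
Proof.
pose j (x : kcar X) : kcar ind := ind_tensor 1 x.
have jL : linear j.
  move=> k x y; rewrite /j [LHS]ind_tensorD; congr (_ + _).
  by apply: esym; have := ind_tensorT k%:A x; rewrite vsval_k.
pose jl : {linear kcar X -> kcar ind} := HB.pack j (GRing.isLinear.Build _ _ _ _ j jL).
have full : (fullv <= actv Am (limg (linfun jl)))%VS.
  apply/subvP => y _; move: y; apply: ind_Am_span => [|y z yA zA|a x aA].
  - exact: mem0v.
  - exact: memvD.
  apply: memv_act => //; apply/memv_imgP; exists x; rewrite ?memvf //.
  by rewrite lfunE.
apply: leq_trans (dimvS full) (leq_trans (dim_actv _ _) _).
by rewrite leq_mul2l -[X in (_ <= X)%N](limg_ker_dim (linfun jl)) leq_addl orbT.
Qed.

End Module.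

(** The module [A (x)_{Bp} X] for [X] in degree [xi], with the properties from
    which everything else follows, independent of its construction. *)
Record induction (xi : int) (X : GT) := Induction {
  iob :> gmod Ac;
  ieta : gcar X -> iob;
  iob_is_induced : is_induced Ap X iob;
  ietaD : forall x y, ieta (x + y) = ieta x + ieta y;
  ietaT : forall (t : subvs_of T) x, ieta (t *: x) = vsval t *: ieta x;
  ieta_deg : forall x, gdeg xi (ieta x);
  ieta_inj : forall x, ieta x = 0 -> x = 0;
  ieta_span : forall S : iob -> Prop, gsubmod S -> (forall x, S (ieta x)) ->
    forall y, S y;
  ieta_lift : forall (M : gmod Ac) (u : gcar X -> M),
    {morph u : x y / x + y} ->
    (forall (t : subvs_of T) x, u (t *: x) = vsval t *: u x) ->
    (forall x, gdeg xi (u x)) ->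
    (forall b j x, b \in Bp -> b \in Ac j -> 0 < j -> b *: u x = 0) ->
    exists h : gmor iob M, forall x, h (ieta x) = u x;
  iob_supp : forall k (y : iob), xi < k -> gdeg k y -> y = 0;
  iob_top : forall y : iob, gdeg xi y -> exists x, y = ieta x;
  iob_dim : (gdim iob <= \dim Am * gdim X)%N }.

Lemma induction_ex xi (X : GT) : (forall x : gcar X, gdeg xi x) ->
  exists d : induction xi X, True.
Proof.
move=> pX; suff d : induction xi X by exists d.
apply: (@Induction xi X (ind xi X) (fun x => ind_tensor xi 1 x)).
- exact: ind_is_induced.
- exact: ind_tensorD.
- by move=> t x; apply: esym; apply: ind_tensorT.
- by move=> x; have := ind_deg pX (Ac1 gA) (pX x); rewrite add0r.
- exact: ind_inj.
- move=> S sS Sx y; have [a ->] := ind_span y.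
  by apply: (gs_sum _ sS) => i _; apply: gsZ.
- move=> M u uD uT ud u0; have [h hE] := ind_lift uD uT ud u0.
  by exists h => x; rewrite hE scale1r.
- exact: (ind_supp pX).
- exact: (ind_top pX).
exact: ind_dim.
Qed.

End Induction.

(** * The homogeneous part of a given degree *)

Section Restriction.
Variables (K : fieldType) (A : falgType K) (Ac : int -> {vspace A}).
Variables (Am T Ap : {aspace A}).
Hypothesis gA : graded_algebra Ac.
Hypothesis td : triangular_decomposition Ac Am T Ap.
Notation Bc := (sub_grading Ac T).
Notation GT := (gcat Bc).
Notation GA := (gcat Ac).

Definition pure (xi : int) (X : GT) := forall x : gcar X, gdeg xi x.

Section Part.
Variables (M : gmod Ac) (xi : int).
Let W := subvs_of (gpart M xi).
Let inc (w : W) : M := vsval w.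
Let incd (w : W) : gdeg xi (inc w). Proof. exact/gpartP/subvsP. Qed.
Let pr (x : M) : W := vsproj (gpart M xi) (x : kcar M).
Let prK x : gdeg xi x -> inc (pr x) = x.
Proof. by move=> /gpartP xS; rewrite /inc vsprojK. Qed.
Let incI : injective inc. Proof. exact: subvs_inj. Qed.
Let act (t : subvs_of T) (w : W) : W := pr (vsval t *: inc w).
Let incA t w : inc (act t w) = vsval t *: inc w.
Proof.
apply: prK; rewrite -[xi]add0r; apply: gdegZ (incd w).
exact: (T_deg td (subvsP t)).
Qed.
Let incD w w' : inc (w + w') = inc w + inc w'. Proof. by []. Qed.
Fact part_action : is_action act.
Proof.
split=> [a b w|w|a w w'|w a b]; apply: incI.
- by rewrite !incA scalerA.
- by rewrite incA (vsval1 td) scale1r.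
- by rewrite incD !incA incD scalerDr.
by rewrite incD !incA -scalerDl.
Qed.
Let N : lmodType (subvs_of T) := action_car part_action.
Let deg i (x : N) := i = xi \/ x = 0.
Let comp i (x : N) : N := if i == xi then x else 0.
Let comp_add i : {morph comp i : x y / x - y}.
Proof. by move=> x y; rewrite /comp; case: eqP; rewrite ?subr0. Qed.
HB.instance Definition _ i := GRing.isZmodMorphism.Build N N (comp i) (@comp_add i).

(** [T] has degree 0, so it acts on each homogeneous part. *)
Definition part_gmod : gmod Bc.
Proof.
refine (@GMod K _ Bc N deg _ _ _ _ _).
- by move=> i; right.
- move=> i k x y [->|->]; first by left.
  by case=> [->|->]; [left | right; rewrite scaler0 addr0].
- apply: (@direct_sum_components _ _ (fun i => comp i : {additive N -> N})).
  + by move=> i x; rewrite /deg /= /comp; case: eqP => [->|_]; [left|right].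
  + by move=> x; exists [:: xi]; rewrite big_seq1 /= /comp eqxx.
  + by move=> i x; rewrite /deg => -[->|->] j; rewrite /= /comp ?if_same.
- move=> i j t x ti [->|->]; last by right; rewrite scaler0.
  have [->|i0] := eqVneq i 0; first by left; rewrite add0r.
  right; suff -> : t = 0 by rewrite scale0r.
  move: ti; rewrite -memv_preim lfunE /= => ti; apply: subvs_inj.
  have := ac_homog gA (T_deg td (subvsP t)) i; rewrite (negPf i0).
  by rewrite (ac_homog gA ti) eqxx.
apply: (@vect_gfg K _ W N id) => [w|k x y]; first by exists w.
apply: incI; rewrite [RHS]incD [inc ((k%:A : subvs_of T) *: (x : N))]incA.
by rewrite (vsval_k td) /inc linearP.
Defined.

Definition part_inc : gcar part_gmod -> M := inc.
Lemma part_pure : pure xi part_gmod. Proof. by move=> x; left. Qed.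
Lemma part_inc_inj : injective part_inc. Proof. exact: incI. Qed.
Lemma part_incD : {morph part_inc : x y / x + y}. Proof. by []. Qed.
Lemma part_inc0 : part_inc 0 = 0. Proof. by []. Qed.
Lemma part_incT t x : part_inc (t *: x) = vsval t *: part_inc x.
Proof. exact: incA. Qed.
Lemma part_inc_deg x : gdeg xi (part_inc x). Proof. exact: incd. Qed.
Lemma part_incP y : gdeg xi y -> exists x, part_inc x = y.
Proof. by move=> yd; exists (pr y); apply: prK. Qed.
End Part.

Arguments part_gmod : simpl never.
Arguments part_inc : simpl never.

Lemma pure_deg X xi i (x : gcar X) : pure xi X -> gdeg i x -> i = xi \/ x = 0.
Proof.
move=> pX xd; have [->|ixi] := eqVneq i xi; first by left.
by right; apply: gdeg_uniq xd (pX x) ixi.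
Qed.

Lemma part_lift (X : GT) (M : gmod Ac) xi (u : gcar X -> M) : pure xi X ->
  {morph u : x y / x + y} ->
  (forall (t : subvs_of T) x, u (t *: x) = vsval t *: u x) -> (forall x, gdeg xi (u x)) ->
  exists g : gmor X (part_gmod M xi), forall x, part_inc (g x) = u x.
Proof.
move=> pX uD uT ud; have /choice[g gE] x := part_incP (ud x).
have gL : linear g.
  by move=> t x y; apply: part_inc_inj; rewrite part_incD part_incT !gE uD uT.
have gd i x : gdeg i x -> gdeg i (g x).
  move=> /(pure_deg pX)[->|->]; first exact: part_pure.
  suff -> : g 0 = 0 by apply: gdeg0.
  apply: part_inc_inj; rewrite gE part_inc0; apply: (addrI (u 0)).
  by rewrite -uD !addr0.
by exists (GMor gL gd).
Qed.

Lemma part_map_ex (M N : gmod Ac) xi (f : gmor M N) :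
  exists g : gmor (part_gmod M xi) (part_gmod N xi),
    forall x, part_inc (g x) = f (part_inc x).
Proof.
apply: (part_lift (u := fun x => f (part_inc x))) => [|x y|t x|x].
- exact: part_pure.
- by rewrite part_incD raddfD.
- by rewrite part_incT gmorE.
exact/gmor_deg/part_inc_deg.
Qed.

Definition part_map (M N : gmod Ac) xi (f : gmor M N) := sval (cid (part_map_ex xi f)).
Lemma part_mapE (M N : gmod Ac) xi (f : gmor M N) x :
  part_inc (part_map xi f x) = f (part_inc x).
Proof. by rewrite /part_map; case: cid. Qed.

Lemma gT : graded_algebra Bc. Proof. exact: T_graded gA td. Qed.

Lemma pure_serre xi : serre (pure xi).
Proof.
split=> [X /is_zero_gmod X0 x|X Y Z i p /gsesP[Ii Sp ex]].
  by rewrite (X0 x); apply: gdeg0.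
split=> [pY|[pX pZ] y].
  split=> [x|z]; first exact: inj_gdeg Ii (pY _).
  by have [y <-] := Sp z; apply: gmor_deg.
apply/gdegE; have [s [us s0 yE]] := gc_sum y; rewrite [RHS]yE.
have y0 k : k != xi -> gc k y = 0.
  move=> kxi; have [x xE] : exists x, gfun i x = gc k y.
    apply/ex; rewrite gmor_gc (gc_homog (pZ (p y))).
    by rewrite (negPf kxi).
  rewrite -[gc k y](gc_id (gc_deg k y)) -xE -gmor_gc (gc_homog (pX x)).
  by rewrite (negPf kxi) raddf0.
have [xs|xs] := boolP (xi \in s).
  by rewrite (bigD1_seq _ xs us) /= big1 ?addr0 // => k /y0.
by rewrite s0 // big1_seq // => k /andP[_ ks]; apply: y0; apply: contraNneq xs => <-.
Qed.

(** This category turns out to be the quotient of the modules supported in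
    degrees at most [xi] by those supported in smaller degrees. *)
Definition puremod xi : lincat K := fullsub (pure xi).

Lemma puremod_abelian xi : abelian (puremod xi).
Proof. exact: fullsub_abelian (gcat_abelian gT) (pure_serre xi). Qed.

Definition part_ob xi (M : gmod Ac) : puremod xi := exist _ (part_gmod M xi) (@part_pure M xi).

Definition part_functor (S : GA -> Prop) xi : functor (fullsub S) (puremod xi).
Proof.
exists (fun M : fullsub S => part_ob xi (sval M))
  (fun M N f => @part_map (sval M) (sval N) xi f).
- by move=> M; apply: gmor_ext => x; apply: part_inc_inj; rewrite part_mapE.
- move=> M N P g f; apply: gmor_ext => x; apply: part_inc_inj.
  by rewrite part_mapE [in RHS]part_mapE part_mapE.
move=> M N k f g; apply: gmor_ext => x; apply: part_inc_inj.
rewrite part_mapE /= part_incD part_incT !part_mapE; congr (_ + _).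
by congr (_ *: _); apply/esym/(vsval_k td).
Defined.

Lemma part_exact (M N P : GA) (i : hom M N) (p : hom N P) xi : ses i p ->
  @ses K GT _ _ _ (part_map xi (i : gmor M N)) (part_map xi (p : gmor N P)).
Proof.
move=> /gsesP[Ii Sp ex]; apply/gsesP; split.
- move=> x y /(congr1 (part_inc (xi := xi))).
  by rewrite !part_mapE => /Ii/part_inc_inj.
- move=> z; have [y yE] := Sp (part_inc z).
  have yd : gfun p (gc xi y) = part_inc z by rewrite gmor_gc yE gc_id //; apply: part_inc_deg.
  have [w wE] := part_incP (gc_deg xi y); exists w.
  by apply: part_inc_inj; rewrite part_mapE wE.
move=> y; split=> [/(congr1 (part_inc (xi := xi)))|[x <-]]; last first.
  apply: part_inc_inj; rewrite !part_mapE part_inc0; apply/ex.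
  by exists (part_inc x).
rewrite part_mapE part_inc0 => /ex[x xE].
have xd : gdeg xi x by apply: inj_gdeg Ii _; rewrite [gfun i x]xE; apply: part_inc_deg.
have [w wE] := part_incP xd; exists w; apply: part_inc_inj.
by rewrite part_mapE wE.
Qed.

(** ** Functoriality of induction and adjunction *)

Notation induction := (induction (Ac := Ac) Am Ap).

Definition Ind xi (X : puremod xi) : induction xi (sval X) :=
  projT1 (cid (induction_ex gA td (svalP X))).
Definition eta xi (X : puremod xi) : gcar (sval X) -> Ind X := @ieta _ _ _ _ _ _ _ _ (Ind X).

Lemma etaD xi (X : puremod xi) x y : eta (X := X) (x + y) = eta x + eta y.
Proof. exact: ietaD. Qed.
Lemma eta0 xi (X : puremod xi) : eta (X := X) 0 = 0.
Proof. by apply: (addrI (eta (X := X) 0)); rewrite -etaD !addr0. Qed.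
Lemma etaB xi (X : puremod xi) x y : eta (X := X) (x - y) = eta x - eta y.
Proof. by apply: (canRL (addrK _)); rewrite -etaD subrK. Qed.
Lemma eta_eq0 xi (X : puremod xi) x : eta (X := X) x = 0 -> x = 0.
Proof. exact: ieta_inj. Qed.
Lemma etaT xi (X : puremod xi) (t : subvs_of T) x :
  eta (X := X) (t *: x) = vsval t *: eta x.
Proof. exact: ietaT. Qed.
Lemma eta_top xi (X : puremod xi) (y : Ind X) :
  gdeg xi y -> exists x, y = eta (X := X) x.
Proof. exact: iob_top. Qed.

Definition supp_le xi (M : GA) := forall k (x : gcar M), xi < k -> gdeg k x -> x = 0.

Lemma eta_ext xi (X : puremod xi) (M : gmod Ac) (h h' : gmor (Ind X) M) :
  (forall x, h (eta x) = h' (eta x)) -> h = h'.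
Proof.
move=> hh; apply: gmor_ext; apply: ieta_span => // .
split=> [|a x y xE yE|i x xE]; first by rewrite !raddf0.
  by rewrite !glin xE yE.
by rewrite !gmor_gc xE.
Qed.

(** Elements of the top degree are killed by the positive part of [Bp]. *)
Lemma ind_adj xi (X : puremod xi) (M : GA) (g : gcar (sval X) -> gcar M) :
  supp_le xi M -> {morph g : x y / x + y} ->
  (forall (t : subvs_of T) x, g (t *: x) = vsval t *: g x) ->
  (forall x, gdeg xi (g x)) ->
  exists h : gmor (Ind X) M, forall x, h (eta x) = g x.
Proof.
move=> sM gD gT gd; apply: ieta_lift => // b j x _ bj j0.
by apply: (sM (j + xi)); [rewrite ltrDr | apply: gdegZ (gd x)].
Qed.

Lemma Ind_supp xi (X : puremod xi) : supp_le xi (Ind X : gmod Ac).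
Proof. by move=> k y; apply: iob_supp. Qed.

Lemma ind_map_ex xi (X Y : puremod xi) (f : gmor (sval X) (sval Y)) :
  exists h : gmor (Ind X) (Ind Y), forall x, h (eta x) = eta (f x).
Proof.
apply: (ind_adj (g := fun x => eta (f x))) => [|x y|t x|x].
- exact: Ind_supp.
- by rewrite raddfD etaD.
- by rewrite gmorE etaT.
exact: ieta_deg.
Qed.

Definition ind_map xi (X Y : puremod xi) (f : gmor (sval X) (sval Y)) :
  gmor (Ind X) (Ind Y) := sval (cid (ind_map_ex f)).
Lemma ind_mapE xi (X Y : puremod xi) (f : gmor (sval X) (sval Y)) x :
  ind_map f (eta x) = eta (f x).
Proof. by rewrite /ind_map; case: cid. Qed.

Section IndFunctor.
Variables (S : GA -> Prop) (xi : int).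
Hypothesis SE : forall M, S M <-> supp_le xi M.

Lemma ind_S (X : puremod xi) : S (Ind X : gmod Ac).
Proof. exact/SE/Ind_supp. Qed.

Definition ind_functor : functor (puremod xi) (fullsub S).
Proof.
exists (fun X => exist _ (Ind X : gmod Ac) (ind_S X)) (fun X Y f => @ind_map xi X Y f).
- by move=> X; apply: eta_ext => x; rewrite ind_mapE.
- by move=> X Y Z g f; apply: eta_ext => x; rewrite ind_mapE /= !ind_mapE.
move=> X Y k f g; apply: eta_ext => x; rewrite ind_mapE /= !ind_mapE.
by rewrite etaD etaT (vsval_k td).
Defined.

Let pi := part_functor S xi.

Lemma unit_ex (X : puremod xi) : exists h : gmor (sval X) (part_gmod (Ind X) xi),
  forall x, part_inc (h x) = eta x.
Proof.
apply: (part_lift (u := fun x => eta x)) => [|x y|t x|x].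
- exact: svalP X.
- exact: ietaD.
- exact: ietaT.
exact: ieta_deg.
Qed.

Definition adj_unit (X : puremod xi) : hom X (pi (ind_functor X)) := sval (cid (unit_ex X)).
Lemma adj_unitE X x : part_inc (gfun (adj_unit X) x) = eta x.
Proof. by rewrite /adj_unit; case: cid. Qed.

Lemma adj_unit_nat (X Y : puremod xi) (f : hom X Y) :
  adj_unit Y \oc f = fmap pi (fmap ind_functor f) \oc adj_unit X.
Proof.
apply: gmor_ext => x; apply: part_inc_inj; apply: etrans (adj_unitE _) _.
apply: esym; apply: etrans (part_mapE _ _) _.
by apply: etrans (congr1 (gfun (ind_map f)) (adj_unitE x)) _; apply: ind_mapE.
Qed.

Lemma adj_unit_univ (X : puremod xi) (M : fullsub S) (f : hom X (pi M)) :
  exists! g : hom (ind_functor X) M, fmap pi g \oc adj_unit X = f.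
Proof.
have [||||h hE] := @ind_adj xi X (sval M) (fun x => part_inc (gfun f x)).
- exact/SE/(svalP M).
- by move=> x y; rewrite raddfD part_incD.
- by move=> t x; rewrite gmorE part_incT.
- by move=> x; apply: part_inc_deg.
exists h; split=> [|h' h'E].
  apply: gmor_ext => x; apply: part_inc_inj; apply: etrans (part_mapE _ _) _.
  by apply: etrans (congr1 (gfun h) (adj_unitE x)) _; apply: hE.
apply: eta_ext => x; apply: etrans (hE x) _; rewrite -h'E.
apply: etrans (part_mapE _ _) _; exact: (congr1 (gfun h') (adj_unitE x)).
Qed.

(** [X] embeds in the induced module as its top degree. *)
Lemma adj_unit_isom X : isom (adj_unit X).
Proof.
apply: fullsub_isom; apply: gisomP.
- apply: inj0 => x /(congr1 (part_inc (xi := xi))).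
  by rewrite adj_unitE part_inc0; apply: ieta_inj.
move=> y; have [x xE] := iob_top (part_inc_deg y).
by exists x; apply: part_inc_inj; rewrite adj_unitE.
Qed.

End IndFunctor.
End Restriction.

(** * Complements over a semisimple algebra *)

Section Semisimple.
Variables (K : fieldType) (B : falgType K) (Bc : int -> {vspace B}).
Hypothesis ssB : semisimple_algebra B.
Variable X : gmod Bc.

Definition stable (U : {vspace kcar X}) :=
  forall b (x : kcar X), x \in U -> (b *: (x : X) : kcar X) \in U.

Let orb (x : X) : B -> kcar X := fun b => b *: x.
Let orb_lin x : linear (orb x).
Proof. by move=> k a b; rewrite /orb scalerDl scalerAk. Qed.
HB.instance Definition _ x := GRing.isLinear.Build K B (kcar X) _ (orb x) (orb_lin x).

(** A maximal stable subspace [C] meeting [U] trivially is a complement: for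
    [x] outside [U + C] some simple left ideal [S] has [S x] outside [U + C],
    hence [S x] meets [U + C] trivially and [C + S x] is larger. *)
Lemma stable_compl (U : {vspace kcar X}) : stable U ->
  exists C, [/\ stable C, (U :&: C = 0)%VS & (U + C = fullv)%VS].
Proof.
have [n [S [Smin Ssum _]]] := ssB; move=> sU.

pose Q m := `[< exists C : {vspace kcar X}, [/\ stable C, (U :&: C = 0)%VS & \dim C = m] >].
have Q0 : exists m, Q m.
  exists 0%N; apply/asboolP; exists 0%VS; split; rewrite ?capv0 ?dimv0 //.
  by move=> b x; rewrite !memv0 => /eqP ->; rewrite scaler0.
have Qb m : Q m -> (m <= \dim {:kcar X})%N.
  by move=> /asboolP[C [_ _ <-]]; apply/dimvS/subvf.
case: (ex_maxnP Q0 Qb) => m /asboolP[C [sC UC dC]] mmax.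
exists C; split=> //; apply/eqP; rewrite eqEsubv subvf /=.
apply: contraT => /subvPn[x _ xUC].
have sUC : stable (U + C)%VS.
  by move=> b y /memv_addP[u uU [v vC ->]]; rewrite scalerDr memv_add ?sU ?sC.
have [i [s sS sx]] : exists i, exists2 s, s \in S i & orb x s \notin (U + C)%VS.
  apply: contrapT => h; case/negP: xUC; rewrite -[x](scale1r (x : X)).
  have : 1 \in (\sum_i S i)%VS by rewrite Ssum memvf.
  case/memv_sumP=> s sS ->; rewrite scaler_suml; apply: memv_suml => i _.
  apply: contraT => sx; case: h; exists i; exists (s i) => //.
  exact: sS.
have [Sideal S0 Sm] := Smin i.
have capS b : b \in S i -> orb x b \in (U + C)%VS -> b = 0.
  pose V := (S i :&: (linfun (orb x) @^-1: (U + C)))%VS.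
  have Vid : left_ideal V.
    apply/prodvP => a c _; rewrite !memv_cap -!memv_preim !lfunE => /andP[cS cV].
    apply/andP; split; first by apply: (subvP Sideal); rewrite memv_mul ?memvf.
    by have := sUC a _ cV; rewrite /= /orb scalerA.
  move=> bS bV; have bV' : b \in V by rewrite memv_cap bS -memv_preim lfunE.
  have [V0|VS] := Sm V Vid (capvSl _ _).
    by move: bV'; rewrite V0 memv0 => /eqP.
  by case/negP: sx; move: sS; rewrite -VS memv_cap -memv_preim lfunE => /andP[].
pose C' := (C + linfun (orb x) @: S i)%VS.
have sC' : stable C'.
  move=> b y /memv_addP[u uC [v /memv_imgP[a aS ->] ->]].
  rewrite scalerDr memv_add ?sC // lfunE /= /orb scalerA.
  rewrite -[(b * a) *: x](lfunE (orb x)) memv_img //.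
  by apply: (subvP Sideal); rewrite memv_mul ?memvf.
have UC' : (U :&: C' = 0)%VS.
  apply/eqP; rewrite -subv0; apply/subvP => y; rewrite memv_cap => /andP[yU].
  case/memv_addP=> u uC [v /memv_imgP[a aS ->] yE].
  have a0 : a = 0.
    apply: capS => //; rewrite -[orb x a]lfunE.
    have -> : linfun (orb x) a = y - u by rewrite yE addrC addKr.
    by rewrite memvB //; [apply: (subvP (addvSl _ _)) | apply: (subvP (addvSr _ _))].
  by rewrite -UC memv_cap yU yE a0 linear0 addr0.
have /mmax : Q (\dim C') by apply/asboolP; exists C'.
rewrite leqNgt -dC => /negP[].
rewrite (ltn_leqif (dimv_leqif_sup (addvSl _ _))).
apply: contra sx => /subvP sub; apply: (subvP (addvSr U C)); apply: sub.
by apply: (subvP (addvSr _ _)); rewrite -[orb x s]lfunE memv_img.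
Qed.
End Semisimple.

Section Simples.
Variables (K : fieldType) (A : falgType K) (Ac : int -> {vspace A}).
Variables (Am T Ap : {aspace A}).
Hypothesis gA : graded_algebra Ac.
Hypothesis td : triangular_decomposition Ac Am T Ap.
Hypothesis ssT : semisimple_algebra (subvs_of T).
Notation Bc := (sub_grading Ac T).
Notation GT := (gcat Bc).
Notation GA := (gcat Ac).
Notation gT := (gT gA td).
Notation puremod := (puremod Ac T).
Notation Ind := (Ind gA td).
Notation eta := (eta gA td).

(** The inverse of [p] on a stable complement of its kernel is a section. *)
Lemma pure_surj_split xi (Y Z : puremod xi) (p : hom Y Z) :
  surj (gfun p) -> exists s, p \oc s = idm Z.
Proof.
move=> Sp; have sK := gsubmod_ker p.
pose U : {vspace kcar (sval Y)} := gspace (fun x => gfun p x = 0).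
have [C [sC UC UCf]] : exists C : {vspace kcar (sval Y)},
    [/\ stable C, (U :&: C = 0)%VS & (U + C = fullv)%VS].
  apply: stable_compl => // b x /(gspaceP sK) x0; apply/(gspaceP sK).
  by rewrite gmorE x0 scaler0.
have ex z : exists y : kcar (sval Y), y \in C /\ gfun p y = z.
  have [y <-] := Sp z; have : (y : kcar (sval Y)) \in fullv := memvf _.
  rewrite -UCf => /memv_addP[u /(gspaceP sK) u0 [v vC ->]].
  by exists v; rewrite raddfD /= u0 add0r.
have [s sE] := choice ex.
have uniqC (y y' : kcar (sval Y)) : y \in C -> y' \in C -> gfun p y = gfun p y' -> y = y'.
  move=> yC yC' yy; apply/eqP; rewrite -subr_eq0 -memv0 -UC memv_cap.
  apply/andP; split; last exact: memvB.
  by apply/(gspaceP sK); rewrite raddfB /= yy subrr.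
have sL : linear (s : gcar (sval Z) -> gcar (sval Y)).
  move=> t x y; apply: uniqC; first exact: (proj1 (sE _)).
    by apply: memvD (proj1 (sE y)); apply/sC/(proj1 (sE x)).
  by rewrite (proj2 (sE _)) glin !(proj2 (sE _)).
have sd i z : gdeg i z -> gdeg i ((s : gcar (sval Z) -> gcar (sval Y)) z).
  move=> /(pure_deg (svalP Z))[->|->]; first exact: (svalP Y).
  suff -> : s 0 = 0 by apply: gdeg0.
  by apply: uniqC; rewrite ?mem0v ?(proj2 (sE _)) ?raddf0 //; apply: (proj1 (sE _)).
by exists (GMor sL sd); apply: gmor_ext => z; apply: (proj2 (sE z)).
Qed.

Lemma puremod_epi_surj xi (Y Z : puremod xi) (p : hom Y Z) :
  epi p -> surj (gfun p).
Proof.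
move=> Ep; have abT := gcat_abelian gT; have sP := pure_serre Ac T xi.
have [W [g cg]] := ab_epi (puremod_abelian gA td xi) Ep.
have /(fullsub_cokernelE abT sP) cgC := cg.
by apply/gepiP; exact: (@kernel_mono K (opcat GT) _ _ _ _ _ cgC).
Qed.

Lemma puremod_projective xi (X : puremod xi) : projective X.
Proof.
move=> Y Z e f /puremod_epi_surj/pure_surj_split[s es].
by exists (s \oc f); rewrite cmpA es cmp1m.
Qed.

Lemma puremod_ses_split xi (X Y Z : puremod xi) (i : hom X Y) (p : hom Y Z) :
  ses i p -> exists s, p \oc s = idm Z.
Proof.
move=> [_ cip]; apply/pure_surj_split/puremod_epi_surj.
exact: (@kernel_mono K (opcat (puremod xi)) _ _ _ _ _ cip).
Qed.

(** ** Simple modules over [T] *)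

Lemma T_stable_gsubmod xi (X : GT) (P : gcar X -> Prop) : pure xi X -> P 0 ->
  (forall t x y, P x -> P y -> P (t *: x + y)) -> gsubmod P.
Proof.
move=> pX P0 PL; split=> // i x Px.
by rewrite (gc_homog (pX x)); case: eqP.
Qed.

Lemma simple_pure (X : GT) : simple X -> exists xi, pure xi X.
Proof.
move=> /gsimpleP[[x x0] sX].
have [i xi] : exists i, gc i x <> 0.
  apply: contrapT => h; apply: x0; apply: gc_eq0 => i.
  by apply: contrapT => hi; apply: h; exists i.
exists i; have [||//] := sX (fun y => gdeg i y); last by move/(_ _ (gc_deg i x)).
split=> [|t y z yi zi|j y yi]; first exact: gdeg0.
  have [ti _] : t \in Bc 0 /\ True.
    by split=> //; rewrite -memv_preim lfunE; apply: (T_deg td (subvsP t)).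
  by apply: gdegD => //; rewrite -[i]add0r; apply: gdegZ.
by rewrite (gc_homog yi); case: eqP => // _; apply: gdeg0.
Qed.

Lemma pure_iso xi (X Y : GT) : isomorphic X Y -> pure xi X -> pure xi Y.
Proof. exact: (serre_iso (gcat_abelian gT) (pure_serre Ac T xi)). Qed.

Notation irr := (Irr GT).
Notation irr_deg := (@irr_deg K _ Bc).

Definition rep (l : irr) : GT := sval (cid (svalP l)).
Lemma repP (l : irr) : simple (rep l) /\ sval l = isomorphic (rep l).
Proof. exact: (svalP (cid (svalP l))). Qed.
Lemma rep_simple l : simple (rep l). Proof. by case: (repP l). Qed.
Lemma rep_class l X : sval l X <-> isomorphic (rep l) X.
Proof. by case: (repP l) => _ ->. Qed.

Lemma irr_eq (l m : irr) : isomorphic (rep l) (rep m) -> l = m.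
Proof.
move=> /isomorphic_class; rewrite -(proj2 (repP l)) -(proj2 (repP m)).
case: l m => [c hc] [c' hc'] /= E; case: c' / E hc' => hc'.
by rewrite (Prop_irrelevance hc hc').
Qed.

Definition irr_of (X : GT) (sX : simple X) : irr :=
  exist _ (isomorphic X) (ex_intro _ X (conj sX erefl)).
Lemma rep_irr_of X (sX : simple X) : isomorphic (rep (irr_of sX)) X.
Proof. by apply/rep_class; apply: isomorphic_refl. Qed.

Lemma pure_irr_deg (l : irr) X : sval l X -> pure (irr_deg l) X.
Proof.
move=> /rep_class lX x.
have [xi pxi] := simple_pure (rep_simple l).
rewrite /irr_deg; case: xgetP => [j -> |/(_ xi)[]]; first by move=> jE; apply: jE; apply/rep_class.
by move=> Y /rep_class lY; apply: pure_iso lY pxi.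
Qed.

Lemma irr_deg_uniq (l : irr) X xi : sval l X -> pure xi X -> irr_deg l = xi.
Proof.
move=> lX pX; have pl := pure_irr_deg lX.
have /rep_class rX := lX.
have [x x0] : exists x : gcar X, x <> 0.
  apply: contrapT => h; have X0 : is_zero X.
    by apply/is_zero_gmod => x; apply: contrapT => x0; apply: h; exists x.
  by have [r0 _] := rep_simple l; apply: r0; apply: is_zero_iso X0; apply: isomorphic_sym.
by apply/eqP; apply: contrapT => /negP ne; apply: x0; apply: gdeg_uniq (pl x) (pX x) ne.
Qed.

Definition prep (l : irr) : puremod (irr_deg l) :=
  exist _ (rep l) (pure_irr_deg (proj2 (rep_class l _) (isomorphic_refl (rep l)))).

(** ** The head of an induced module *)

Section Head.
Variables (xi : int) (X : puremod xi).
Hypothesis sX : simple (sval X).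
Let V : gmod Ac := Ind X.

(** The largest submodule of [V] with no component in the top degree. *)
Definition ind_rad (y : V) := forall a, gc xi (a *: y) = 0.

Lemma ind_radP : gsubmod ind_rad.
Proof.
split=> [a|b x y x0 y0 a|i x x0 a]; first by rewrite scaler0 raddf0.
  by rewrite scalerDr scalerA raddfD /= x0 y0 addr0.
have [s ->] := gc_scale_sum gA xi a (gc i x); apply: big1 => j _.
rewrite gc_gc; case: eqP => [ij|_]; last by rewrite scaler0.
by rewrite -(x0 (ac gA j a)) (gc_scale _ _ (ac_deg gA j a)) ij.
Qed.

Definition Lmod : gmod Ac := quot_gmod ind_radP.
Definition Lpr : gmor V Lmod := quot_pr ind_radP.
Lemma Lpr_surj : surj Lpr. Proof. exact: quot_pr_surj. Qed.
Lemma Lpr0 y : Lpr y = 0 <-> ind_rad y. Proof. exact: quot_prP. Qed.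

(** A submodule not contained in [ind_rad] meets the top degree, where [X] is
    simple, and so contains the generators. *)
Lemma ind_rad_max (P : V -> Prop) : gsubmod P -> (exists2 y, P y & ~ ind_rad y) ->
  forall y, P y.
Proof.
move=> sP [y Py yr].
have [a ay] : exists a, gc xi (a *: y) <> 0.
  by apply: contrapT => h; apply: yr => a; apply: contrapT => ha; apply: h; exists a.
have [x xE] := iob_top (gc_deg xi (a *: y)).
have sPX : gsubmod (fun z : gcar (sval X) => P (eta z)).
  apply: (T_stable_gsubmod (svalP X)).
    by rewrite eta0; apply: gs0.
  by move=> t z w Pz Pw; rewrite etaD etaT; apply: gsP.
have [_ /(_ _ sPX)[P0|Pall]] := proj1 (gsimpleP (sval X)) sX.
  case: ay; rewrite xE.
  have x0 : x = 0 by apply: P0; rewrite /eta -xE; apply: gs_gc => //; apply: gsZ.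
  by rewrite x0; apply: eta0.
exact: (ieta_span sP Pall).
Qed.

Lemma eta_rad (x : gcar (sval X)) : ind_rad (eta x) -> x = 0.
Proof.
move=> /(_ 1); rewrite scale1r gc_id; last exact: ieta_deg.
exact: ieta_inj.
Qed.

Lemma simple_nonzero : exists x : gcar (sval X), x <> 0.
Proof. by case/gsimpleP: sX. Qed.

Lemma Lmod_simple : @simple K GA Lmod.
Proof.
have [x x0] := simple_nonzero.
apply/gsimpleP; split; first by exists (Lpr (eta x)) => /Lpr0/eta_rad.
move=> P sP; have [h|h] := pselect (exists2 y, P (Lpr y) & ~ ind_rad y).
  have all := ind_rad_max (gsubmod_preim Lpr sP) h.
  by right=> z; have [y <-] := Lpr_surj z; apply: all.
left=> z; have [y <-] := Lpr_surj z => Py; apply/Lpr0.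
by apply: contrapT => yr; apply: h; exists y.
Qed.

Lemma Lmod_top : exists2 y : gcar Lmod, gdeg xi y & y <> 0.
Proof.
have [x x0] := simple_nonzero; exists (Lpr (eta x)).
  exact: (gmor_deg Lpr (ieta_deg (Ind X) x)).
by move=> /Lpr0/eta_rad.
Qed.

(** The kernel is a proper submodule, so it lies in [ind_rad]. If [q] did not kill
    [ind_rad] it would map it onto [M], so that each generator of [V] would be
    congruent to an element of [ind_rad] modulo the kernel. *)
Lemma simple_quot_rad (M : GA) (q : gmor V M) : simple M -> (exists y, q y <> 0) ->
  forall y, q y = 0 <-> ind_rad y.
Proof.
move=> sM [z qz].
have kr y : q y = 0 -> ind_rad y.
  move=> qy; apply: contrapT => yr; apply: qz.
  by apply: (ind_rad_max (gsubmod_ker q)); exists y.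
move=> y; split=> [/kr //|yr].
have [_ /(_ _ (gsubmod_img q ind_radP))[r0|rall]] := proj1 (gsimpleP M) sM.
  by apply: r0; exists y.
have [x x0] := simple_nonzero; case: x0; apply: eta_rad.
have [r rr rE] := rall (q (eta x)).
have := kr (eta x - r); rewrite raddfB /= rE subrr => /(_ erefl) xr.
by rewrite -[eta x](subrK r); apply: gsD ind_radP xr rr.
Qed.

Lemma Lmod_iso (M : GA) (q : gmor V M) : simple M -> (exists y, q y <> 0) ->
  @isomorphic K GA Lmod M.
Proof.
move=> sM q0; have [|h hE] := gmor_desc (p := Lpr) (g := q) Lpr_surj.
  by move=> y /Lpr0/(simple_quot_rad sM q0).
exists h; apply: schur_isom => //; first exact: Lmod_simple.
case: q0 => y qy h0; apply: qy; rewrite -hE.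
exact: (congr1 (fun f : gmor Lmod M => f (Lpr y)) h0).
Qed.

Lemma Lmod_supp : supp_le xi (Lmod : GA).
Proof.
move=> k y xk /gc_id <-; have [z <-] := Lpr_surj y.
by rewrite -gmor_gc (Ind_supp xk (gc_deg k z)) raddf0.
Qed.

Lemma Lmod_head : @is_head K GA V Lmod.
Proof.
exists Lpr; split; first exact/gepiP/Lpr_surj.
move=> W f; split=> [pf S q sS|qf]; last exact: qf _ Lmod_simple.
have [q0|] := pselect (exists y, gfun q y <> 0); last first.
  move=> h; have -> : q = 0; last exact: cmp0m.
  by apply: gmor_ext => y; apply: contrapT => qy; apply: h; exists y.
apply: gmor_ext => w; apply/(simple_quot_rad sS q0)/Lpr0.
exact: (congr1 (fun g : gmor W Lmod => g w) pf).
Qed.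

Notation part := (part_gmod gA td).

(** [ind_rad] has no component in the top degree, which therefore survives in
    [Lmod]. *)
Lemma Lmod_part : exists u : gmor (sval X) (part Lmod xi),
  [/\ forall x, part_inc (u x) = Lpr (eta x), injective u & surj u].
Proof.
have [|x y|t x|x|u uE] := @part_lift _ _ _ _ _ _ gA td (sval X) Lmod xi (fun x => Lpr (eta x)).
- exact: svalP X.
- by rewrite etaD raddfD.
- by rewrite etaT gmorE.
- exact/gmor_deg/ieta_deg.
exists u; split=> //.
  by apply: inj0 => x /(congr1 (part_inc (xi := xi))); rewrite uE part_inc0 => /Lpr0/eta_rad.
move=> y; have [z zE] := Lpr_surj (part_inc y).
have [x xE] := iob_top (gc_deg xi z); exists x; apply: part_inc_inj.
by rewrite uE /eta -xE gmor_gc zE gc_id //; apply: part_inc_deg.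
Qed.

Lemma Lmod_part_iso : @isomorphic K GT (sval X) (part Lmod xi).
Proof. by have [u [_ uI uS]] := Lmod_part; exists u; apply: gisomP. Qed.

(** An endomorphism of [Lmod] is determined by its restriction to the top degree,
    an endomorphism of the [T]-module [X]; the latter is a scalar because [T] is
    split. *)
Lemma Lmod_end (f : @hom K GA Lmod Lmod) : exists k : K, f = k *: idm _.
Proof.
have [u [uE uI uS]] := Lmod_part.
have /choice[g gE] x : exists y, u y = part_map gA td xi f (u x) by exact: uS.
have gL : linear g.
  by move=> t x y; apply: uI; rewrite gE !glin !gE.
have smX : simple_module (gcar (sval X)).
  split=> [|P P0 PL].
    by have [x /eqP x0] := simple_nonzero; exists x.
  by case/gsimpleP: sX => _; apply; apply: (T_stable_gsubmod (svalP X)).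
pose gl : {linear gcar (sval X) -> gcar (sval X)} :=
  HB.pack g (GRing.isLinear.Build _ _ _ _ g gL).
have [k kE] := td_split td smX gl; exists k.
have E : gmor_comp f Lpr = gmor_comp (k *: gmor1 Lmod) Lpr.
  apply: eta_ext => x.
  change (gfun f (Lpr (eta x)) = (k%:A : A) *: Lpr (eta x)).
  by rewrite -uE -part_mapE -gE [g x]kE gmorE part_incT (vsval_k td).
apply: gmor_ext => y; have [z <-] := Lpr_surj y.
exact: (congr1 (fun h : gmor V Lmod => h z) E).
Qed.
End Head.
Arguments Lmod : simpl never.
Arguments Lpr : simpl never.

End Simples.

(** * Simple modules and the Serre subcategories *)

Lemma serre_gen_serre (K : fieldType) (C : lincat K) (G : C -> Prop) : serre (serre_gen G).
Proof.
split=> [X X0 S [S0 _] _|X Y Z i p ip]; first exact: S0.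
split=> [SY|[SX SZ] S sS GS].
  by split=> S sS GS; case: (proj1 (proj2 sS _ _ _ _ _ ip) (SY S sS GS)).
by apply/(proj2 sS _ _ _ _ _ ip); split; [apply: SX | apply: SZ].
Qed.

Section Classification.
Variables (K : fieldType) (A : falgType K) (Ac : int -> {vspace A}).
Variables (Am T Ap : {aspace A}).
Hypothesis gA : graded_algebra Ac.
Hypothesis td : triangular_decomposition Ac Am T Ap.
Hypothesis ssT : semisimple_algebra (subvs_of T).
Notation Bc := (sub_grading Ac T).
Notation GT := (gcat Bc).
Notation GA := (gcat Ac).
Notation gT := (gT gA td).
Notation Ind := (Ind gA td).
Notation eta := (eta gA td).
Notation part := (part_gmod gA td).
Notation irr := (Irr GT).
Notation irr_deg := (@irr_deg K _ Bc).

Definition Delta (l : irr) : GA := Ind (prep gA td l).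
Definition Lsimple (l : irr) : GA := Lmod gA td (prep gA td l).

Lemma prep_simple (l : irr) : simple (sval (prep gA td l)).
Proof. exact: rep_simple. Qed.

Lemma Lsimple_simple l : simple (Lsimple l).
Proof. exact/Lmod_simple/prep_simple. Qed.

(** The inclusion of a simple submodule of the top degree extends to the module
    induced from it, whose only simple quotient is its head. *)
Lemma simple_classify (M : GA) : simple M -> exists l,
  isomorphic (Lsimple l) M.
Proof.
move=> sM; have [[x0 x00] _] := proj1 (gsimpleP M) sM.
have [xi [[x xd xn0] top]] := top_degree gA x00.
have sM' : supp_le xi M by move=> k y xk yd; apply: top xk y yd.
have [w wE] := @part_incP _ _ _ _ _ _ gA td M xi x xd.
have P0 : ~ is_zero (part M xi : GT).
  by move/is_zero_gmod => /(_ w) w0; apply: xn0; rewrite -wE w0 part_inc0.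
have [Q [p [sQ Ep]]] := simple_quotient_ex P0.
have pQ : pure xi Q.
  by move=> z; have [y <-] := proj1 (gepiP p) Ep z; apply/gmor_deg/part_pure.
have [s ps] := @pure_surj_split _ _ _ _ ssT xi (part_ob gA td xi M) (exist _ Q pQ)
  p (proj1 (gepiP p) Ep).
pose l := irr_of sQ; have lQ : sval l Q by apply: isomorphic_refl.
have dl : irr_deg l = xi := irr_deg_uniq gA td lQ pQ.
have [f If] := rep_irr_of sQ; exists l.
pose g (z : gcar (rep l)) : gcar M := part_inc (gfun s (gfun f z)).
have gI z : g z = 0 -> z = 0.
  rewrite -(part_inc0 gA td M xi) => /part_inc_inj sf0.
  have [fI _] := isom_bij If; apply: fI; rewrite raddf0.
  have <- : gfun p (gfun s (gfun f z)) = gfun f z := congr1 (fun h : gmor Q Q => h (gfun f z)) ps.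
  by rewrite sf0 raddf0.
have [|y z|t z|z|h hE] := ind_adj gA td (X := prep gA td l) (M := M) (g := g).
- by rewrite dl.
- by rewrite /g !raddfD part_incD.
- by rewrite /g !gmorE part_incT.
- by rewrite dl; apply: part_inc_deg.
apply: (Lmod_iso (prep_simple l) (q := h)) => //.
have [z z0] := simple_nonzero (prep_simple l).
by exists (eta z); rewrite hE => /gI.
Qed.

Lemma Lsimple_top l : exists2 x : gcar (Lsimple l), gdeg (irr_deg l) x & x <> 0.
Proof. exact: (Lmod_top gA td (prep_simple l)). Qed.

Lemma Lsimple_supp l : supp_le (irr_deg l) (Lsimple l).
Proof. exact: (@Lmod_supp _ _ _ _ _ _ gA td _ (prep gA td l)). Qed.

Lemma Lsimple_deg_le l m : isomorphic (Lsimple l) (Lsimple m) -> (irr_deg l <= irr_deg m)%R.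
Proof.
move=> [f If]; have [fI _] := isom_bij If.
have [x xd x0] := Lsimple_top l; rewrite leNgt; apply/negP => ml; apply: x0.
by apply: fI; rewrite raddf0; apply: Lsimple_supp ml (gmor_deg _ xd).
Qed.

Lemma part_isomorphic xi (M N : GA) : isomorphic M N ->
  @isomorphic K GT (part M xi) (part N xi).
Proof.
move=> [f If]; have [fI fS] := isom_bij If.
exists (part_map gA td xi f); apply: gisomP.
  by move=> x y /(congr1 (part_inc (xi := _))); rewrite !part_mapE => /fI/part_inc_inj.
move=> y; have [x xE] := fS (part_inc y).
have xd : gdeg xi x by apply: inj_gdeg fI _; rewrite [gfun f x]xE; apply: part_inc_deg.
have [w wE] := part_incP gA td xd; exists w; apply: part_inc_inj.
by rewrite part_mapE wE.
Qed.

Lemma rep_part l : @isomorphic K GT (rep l) (part (Lsimple l) (irr_deg l)).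
Proof. exact: (Lmod_part_iso gA td (prep gA td l)). Qed.

(** [irr_deg l] is the top degree of [Lsimple l], and its part in this degree is
    the [T]-module [l]. *)
Lemma Lsimple_inj l m : isomorphic (Lsimple l) (Lsimple m) -> l = m.
Proof.
move=> lm; have dlm : irr_deg l = irr_deg m.
  by apply/eqP; rewrite eq_le (Lsimple_deg_le lm) (Lsimple_deg_le (isomorphic_sym lm)).
have rl := rep_part l; rewrite dlm in rl.
apply: irr_eq; apply: isomorphic_trans rl _.
apply: isomorphic_trans (part_isomorphic _ lm) _.
exact/isomorphic_sym/rep_part.
Qed.

Lemma simple_abs (M : GA) : simple M -> absolutely_simple M.
Proof.
move=> sM; split=> // f; have [l [u Iu]] := simple_classify sM.
have [v [vu uv]] := Iu.
have [k kE] : exists k : K, v \oc (f \oc u) = k *: idm (Lsimple l).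
  exact: (Lmod_end (prep_simple l)).
exists k; apply: (isom_epi Iu); apply: (isom_mono (ex_intro _ u (conj uv vu))).
by rewrite kE cmpZm cmp1m cmpmZ vu.
Qed.

(** ** The Serre subcategories *)

Section SerreGen.
Variable D : pred int.
Hypothesis Ddown : forall i j : int, i <= j -> D j -> D i.

Definition supp_in (M : GA) := forall k (x : gcar M), ~~ D k -> gdeg k x -> x = 0.

Lemma supp_in_serre : serre supp_in.
Proof.
split=> [X /is_zero_gmod X0 k x _ _|X Y Z i p /gsesP[Ii Sp ex]]; first exact: X0.
split=> [sY|[sX sZ] k y kD yk].
  split=> [k x kD xk|k z kD /gc_id <-].
    by apply: Ii; rewrite raddf0; apply: sY kD (gmor_deg _ xk).
  by have [y <-] := Sp z; rewrite -gmor_gc (sY _ _ kD (gc_deg k y)) raddf0.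
have /ex[x xE] : gfun p y = 0 by apply: sZ kD (gmor_deg _ yk).
rewrite -xE (sX k x) ?raddf0 //; apply: inj_gdeg Ii _.
by rewrite [gfun i x]xE.
Qed.

(** Consider a composition series of [M]: its factors inherit the support of [M],
    and [Lsimple l] is nonzero in degree [irr_deg l]. *)
Lemma serre_gen_supp (M : GA) :
  serre_gen (fun X => exists2 l, D (irr_deg l) & X = Lsimple l) M <-> supp_in M.
Proof.
split=> [GM|].
  apply: GM; first exact: supp_in_serre.
  move=> _ [l Dl ->] k x kD; apply: Lsimple_supp; rewrite ltNge.
  by apply: contra kD => kl; apply: Ddown kl Dl.
move=> sM S serS SL; elim: (gcat_finite_length M) sM => {M} [M M0 _|X Y Z i p ip _ IH sZ sY].
  exact: (proj1 serS).
have [sX' sZ'] := proj1 (proj2 supp_in_serre _ _ _ _ _ ip) sY.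
apply/(proj2 serS _ _ _ _ _ ip); split; first exact: IH.
have [l lZ] := simple_classify sZ; apply: (serre_iso (gcat_abelian gA) serS lZ).
apply: SL; exists l => //; apply: contraT => Dl.
have [x xd x0] := Lsimple_top l; have [f /isom_bij[fI _]] := lZ.
case: x0; apply: fI; rewrite raddf0; exact: sZ' Dl (gmor_deg _ xd).
Qed.
End SerreGen.

Lemma C_leE xi (M : GA) : C_le irr_deg Lsimple xi M <-> supp_le xi M.
Proof.
have := @serre_gen_supp (fun i => i <= xi) (fun i j => @le_trans _ _ j i xi) M.
rewrite /C_le => ->; split=> sM k x kxi; apply: sM; first by rewrite -ltNge.
by rewrite ltNge.
Qed.

Lemma C_ltE xi (M : GA) : supp_le xi M ->
  (C_lt irr_deg Lsimple xi M <-> forall x : gcar M, gdeg xi x -> x = 0).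
Proof.
have D i j : i <= j -> j < xi -> i < xi by apply: le_lt_trans.
move=> sM; rewrite /C_lt (serre_gen_supp D) /supp_in; split=> [M0 x|M0 k x kxi xk].
  by apply: M0; rewrite ltxx.
by move: kxi xk; rewrite -leNgt le_eqVlt => /orP[/eqP<- /M0|/sM] //; apply.
Qed.

(** A simple [T]-module of degree [xi] is a quotient of the free module on one
    generator of degree [xi], which has finitely many simple quotients. *)
Lemma irr_finite_fibres xi : finitely_many (fun l => irr_deg l = xi).
Proof.
pose F : GT := free_gmod gT (fun _ : 'I_1 => xi).
have [n [e eP]] := finite_simple_quotients F.
have [[l0 _]|none] := pselect (exists l, irr_deg l = xi); last first.
  exists 0%N, (fun j : 'I_0 => match j with Ordinal m lt => False_rect irr (Bool.diff_false_true lt) end).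
  by move=> l lxi; case: none; exists l.
pose ch (j : 'I_n) : irr := if pselect (exists l, isomorphic (rep l) (e j)) is left h
  then sval (cid h) else l0.
exists n, ch => l lxi.
have [x x0] := simple_nonzero (prep_simple l).
have xd : gdeg xi x by rewrite -lxi; apply: (svalP (prep gA td l)).
have [g gE] := free_map gT (js := fun _ : 'I_1 => xi) (m := fun _ => x) (fun _ => xd).
have [|j jE] := eP (rep l) g (rep_simple l).
  apply/gepiP; apply: simple_surj (rep_simple l) _ => g0.
  by apply: x0; rewrite -(gE ord0) g0.
exists j; apply: irr_eq; rewrite /ch; case: pselect => [h|[]]; last by exists l.
case: cid => m mE /=.
by apply: isomorphic_trans mE _; apply: isomorphic_sym.
Qed.

Lemma int_interval_finite (x y : int) : finitely_many (fun z : int => (x <= z <= y)%O).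
Proof.
exists (absz (y - x)).+1, (fun i : 'I_(absz (y - x)).+1 => x + i%:Z) => z /andP[xz zy].
have lt : (absz (z - x) < (absz (y - x)).+1)%N.
  by rewrite ltnS; lia.
by exists (Ordinal lt) => /=; lia.
Qed.

Lemma gcat_hw_setting : hw_setting irr_deg Lsimple.
Proof.
split.
- exact: gcat_abelian.
- exact: gcat_finite_length.
- exact: gcat_enough_projectives.
- exact: simple_abs.
- exact: Lsimple_simple.
- by move=> M /simple_classify[l lM]; exists l; apply: isomorphic_sym.
- exact: Lsimple_inj.
- exact: irr_finite_fibres.
exact: int_interval_finite.
Qed.

End Classification.

(** * Standard filtrations *)

(** The subobjects of [Z] in its filtration pull back to subobjects of [Y]
    containing [X], with the same subquotients. *)
Lemma filtered_cat (K : fieldType) (A : falgType K) (Ac : int -> {vspace A})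
    (P : gcat Ac -> Prop) (X Y Z : gcat Ac) (i : hom X Y) (p : hom Y Z) :
  ses i p -> filtered P X -> filtered P Z -> filtered P Y.
Proof.
move=> ip FX FZ; elim: FZ Y p i ip => {Z} [Z Z0|Z' Z Z'' j q jq _ IH PZ] Y p i ip.
  by apply: filtered_iso FX; exists i; apply: ses_zero_r ip Z0.
have /gsesP[Ij Sq exj] := jq; have /gsesP[Ii Sp exi] := ip.
have sK := gsubmod_ker (q \oc p); pose Y' : gcat Ac := sub_gmod sK.
pose k : gmor Y' Y := sub_inc sK.
have kI : injective k by apply: sub_inc_inj.
have kP y : gfun q (gfun p y) = 0 <-> exists x, k x = y by exact: (sub_incP sK y).
have [|p' p'E] := @gmor_lift _ _ _ Z Z' Y' j (gmor_comp p k) Ij.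
  by move=> w; apply/exj/kP; exists w.
have [|i' i'E] := @gmor_lift _ _ _ Y Y' X k i kI.
  move=> x; apply/kP; have -> : gfun p (gfun i x) = 0 by apply/exi; exists x.
  exact: raddf0.
apply: (@filtered_ext _ _ P Y' Y Z'' k (q \oc p)) => //.
  apply: gses => // z; have [w <-] := Sq z; have [y <-] := Sp w.
  by exists y.
apply: (IH Y' p' i'); apply: gses.
- by move=> x y xy; apply: Ii; rewrite -!i'E xy.
- move=> z; have [y yE] := Sp (gfun j z).
  have [x xE] : exists x, k x = y by apply/kP; rewrite yE; apply/exj; exists z.
  by exists x; apply: Ij; rewrite p'E -yE -xE.
move=> y; split=> [py|[x <-]].
  have : gfun p (k y) = 0 by have := p'E y; rewrite py raddf0.
  by move=> /exi[x xE]; exists x; apply: kI; rewrite i'E.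
apply: Ij; rewrite raddf0 p'E; apply: etrans (congr1 (gfun p) (i'E x)) _.
by apply/exi; exists x.
Qed.

Section Filtration.
Variables (K : fieldType) (A : falgType K) (Ac : int -> {vspace A}).
Variables (Am T Ap : {aspace A}).
Hypothesis gA : graded_algebra Ac.
Hypothesis td : triangular_decomposition Ac Am T Ap.
Hypothesis ssT : semisimple_algebra (subvs_of T).
Notation Bc := (sub_grading Ac T).
Notation GT := (gcat Bc).
Notation GA := (gcat Ac).
Notation gT := (gT gA td).
Notation puremod := (puremod Ac T).
Notation Ind := (Ind gA td).
Notation eta := (eta gA td).
Notation part := (part_gmod gA td).
Notation irr_deg := (@irr_deg K _ Bc).

Lemma gdim_part (M : gmod Ac) k : (gdim (part M k) <= \dim (gpart M k))%N.
Proof.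
pose j (x : kcar (part M k)) : kcar M := part_inc (x : gcar (part M k)).
have jL : linear j.
  move=> l x y; rewrite /j [LHS]part_incD; congr (_ + _).
  by rewrite kscaleE [LHS]part_incT (vsval_k td).
pose jl : {linear kcar (part M k) -> kcar M} := HB.pack j (GRing.isLinear.Build _ _ _ _ j jL).
have jI : lker (linfun jl) = 0%VS.
  apply/eqP/lker0P => x y; rewrite !lfunE; exact: part_inc_inj.
have := limg_ker_dim (linfun jl) fullv; rewrite jI capv0 dimv0 add0n => jE.
rewrite /gdim -jE; apply: dimvS; apply/subvP => y /memv_imgP[x _ ->].
by rewrite lfunE; apply/gpartP; apply: part_inc_deg.
Qed.

Section Layers.
Variable N : gmod Ac.
Hypothesis bN : balanced_dim Am gA N.

Definition layer k (x : N) : Prop := (x : kcar N) \in gengen N k.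

Lemma layerP k : gsubmod (layer k).
Proof.
split=> [|a x y xk yk|i x]; rewrite /layer; first exact: mem0v.
  by apply: memvD yk; apply: actv_stable.
move: x; apply: actv_ind => [|a x _ /(ggeP gA) x0].
  split=> [|l u v uU vU]; first by rewrite raddf0 mem0v.
  by rewrite kscaleE raddfD /= gc_k // -kscaleE memvD ?memvZ.
have [s ->] := gc_scale_sum gA i a (x : N); apply: memv_suml => j _.
apply: memv_act; rewrite ?memvf //; apply/(ggeP gA) => l lk.
by rewrite gc_gc; case: eqP => // ij; rewrite -ij x0.
Qed.

Lemma layer_deg k i (x : N) : k <= i -> gdeg i x -> layer k x.
Proof. by move=> ki xi; apply: gge_gengen; apply: (gge_deg gA xi ki). Qed.

Lemma layer_ind k (P : N -> Prop) : gsubmod P ->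
  (forall i (x : N), k <= i -> gdeg i x -> P x) -> forall x, layer k x -> P x.
Proof.
move=> sP Pd; apply: actv_ind => [|a x _ /(ggeP gA) x0].
  by split=> [|l u v Pu Pv]; [apply: gs0 | rewrite kscaleE; apply: gsP].
apply: gsZ => //; have [s [_ _ ->]] := gc_sum (x : N).
apply: (gs_sum _ sP) => i _; have [ki|ik] := leP k i; first exact: Pd ki (gc_deg i _).
by rewrite x0 //; apply: gs0.
Qed.

Lemma layerS k (x : N) : layer (k + 1) x -> layer k x.
Proof.
by apply: layer_ind (layerP k) _ x => i x ki; apply: layer_deg; lia.
Qed.

Variable k : int.
Let Q : gmod Ac := quot_gmod (layerP (k + 1)).
Let q : gmor N Q := quot_pr (layerP (k + 1)).
Let q_surj : surj q. Proof. exact: quot_pr_surj. Qed.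
Let q0 x : q x = 0 <-> layer (k + 1) x. Proof. exact: quot_prP. Qed.
Let Qsupp : supp_le k (Q : GA).
Proof.
move=> j y kj /gc_id <-; have [x <-] := q_surj y.
rewrite -gmor_gc; apply/q0/(layer_deg (i := j)); last exact: gc_deg.
by rewrite -ltzD1 ltrD2r.
Qed.
Let X : puremod k := part_ob gA td k Q.

(** [layer k / layer (k + 1)] is generated by its part [X] of degree [k], its top
    degree, so it is the image of [Ind X]. By the case of equality in [rad_dim_bound]
    its dimension is [\dim Am * \dim X], which bounds that of [Ind X]: there is
    no kernel. *)
Lemma layer_quotient : exists (Y : puremod k) (w : gmor (sub_gmod (layerP k)) (Ind Y)),
  surj w /\ forall x, w x = 0 <-> layer (k + 1) (sub_inc (layerP k) x).
Proof.
have [||||h hE] := ind_adj gA td (X := X) (M := Q) (g := fun x : part Q k => part_inc x).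
- exact: Qsupp.
- by move=> x y; rewrite part_incD.
- by move=> t x; rewrite part_incT.
- by move=> x; apply: part_inc_deg.
have him x : layer k x -> exists y, h y = q x.
  apply: (layer_ind (gsubmod_preim q (gsubmod_im h))) => i z ki zi.
  move: ki; rewrite le_eqVlt => /orP[/eqP ik|ki].
    rewrite -ik in zi; have [y yE] := part_incP gA td (gmor_deg q zi).
    by exists (eta (X := X) y); rewrite hE.
  exists 0; rewrite raddf0; apply/esym/q0/(layer_deg (i := i)) => //; lia.
have [_ /(_ bN)[dk _]] := rad_dim_bound gA td N k.
have kerq : lker (glfun q) = gengen N (k + 1).
  by apply/vspaceP => x; rewrite memv_ker glfunE; apply/eqP/idP => /q0.
have sub : (gengen N (k + 1)%R <= gengen N k)%VS by apply/subvP => x /layerS.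
have dimq := limg_ker_dim (glfun q) (gengen N k).
have dimp := limg_ker_dim (glfun q) (gpart N k).
rewrite kerq (capv_idPr sub) in dimq; rewrite kerq in dimp.
have imq : (glfun q @: gengen N k <= limg (glfun h))%VS.
  apply/subvP => y /memv_imgP[x xk ->]; rewrite glfunE.
  have [z <-] := him x xk; rewrite -(glfunE h); exact/memv_img/memvf.
have partq : (gpart Q k <= glfun q @: gpart N k)%VS.
  apply/subvP => y /gpartP yk; have [x xE] := q_surj y.
  apply/memv_imgP; exists (gc k x); first exact/gpartP/gc_deg.
  by rewrite glfunE gmor_gc xE gc_id.
have hI : injective h.
  have dh := limg_ker_dim (glfun h) fullv; rewrite capfv in dh.
  have d1 : (gdim (Ind X) <= \dim Am * gdim (part Q k))%N := iob_dim (Ind X).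
  have d2 := gdim_part Q k; have d3 := dimvS partq; have d4 := dimvS imq.
  have d5 : (\dim Am * gdim (part Q k) <= \dim Am * (\dim (gpart N k) - \dim (gpart N k :&: gengen N (k + 1)%R)))%N.
    apply: leq_mul => //; apply: leq_trans d2 (leq_trans d3 _).
    by rewrite -dimp addKn.
  have d6 : \dim (lker (glfun h)) = 0%N.
    have d7 : (gdim (Ind X) <= \dim (glfun q @: gengen N k))%N.
      apply: leq_trans d1 (leq_trans d5 _).
      by rewrite -(leq_add2l (\dim (gengen N (k + 1)%R))) dimq dk.
    apply/eqP; rewrite -leqn0 -(leq_add2r (\dim (limg (glfun h)))) dh add0n.
    exact: leq_trans d7 d4.
  have /eqP/lker0P hI : lker (glfun h) = 0%VS by apply/eqP; rewrite -dimv_eq0 d6.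
  by move=> x y xy; apply: hI; rewrite !glfunE.
have [|w wE] := @gmor_lift _ _ _ Q (Ind X) (sub_gmod (layerP k))
    h (gmor_comp q (sub_inc (layerP k))) hI.
  by move=> x; apply: (him (sub_inc (layerP k) x)); apply/(sub_incP (layerP k)); exists x.
exists X, w; split=> [y|x]; last first.
  split=> [w0|xk]; first by apply/q0; rewrite -[q _]wE w0 raddf0.
  by apply: hI; rewrite wE raddf0; apply/q0.
pose S y := exists2 x, layer k x & q x = h y.
have [x xk xE] : S y.
  move: y; apply: (@ieta_span _ _ _ _ _ _ _ _ (Ind X)).
    exact: (gsubmod_preim h (gsubmod_img q (layerP k))).
  move=> x; have [z zE] := q_surj (part_inc x).
  exists (gc k z); first exact: layer_deg (lexx k) (gc_deg k z).
  by rewrite gmor_gc zE [h _]hE gc_id //; apply: part_inc_deg.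
have [v vE] := proj1 (sub_incP (layerP k) x) xk.
by exists v; apply: hI; rewrite wE -xE -vE.
Qed.

End Layers.
Notation Lsimple := (Lsimple gA td).
Notation Delta := (Delta gA td).

Lemma supp_le_serre xi : serre (supp_le xi : GA -> Prop).
Proof.
have <- : C_le irr_deg Lsimple xi = supp_le xi.
  by apply/funext => M; apply/propext/C_leE.
exact: serre_gen_serre.
Qed.

Lemma Ind_iso xi xi' (X : puremod xi) (Y : puremod xi') : xi = xi' ->
  @isomorphic K GT (sval X) (sval Y) -> @isomorphic K GA (Ind X) (Ind Y).
Proof.
move=> e; case: xi' / e Y => Y [f [g [gf fg]]].
exists (ind_map gA td (f : gmor (sval X) (sval Y))), (ind_map gA td (g : gmor (sval Y) (sval X))).
split; apply: eta_ext => x; rewrite gcompE !ind_mapE.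
  exact: (congr1 (fun h : gmor _ _ => eta (h x)) gf).
exact: (congr1 (fun h : gmor _ _ => eta (h x)) fg).
Qed.

Lemma Ind_ses xi (X Y Z : puremod xi) (i : hom X Y) (p : hom Y Z) : ses i p ->
  @ses K GA _ _ _ (ind_map gA td (i : gmor _ _)) (ind_map gA td (p : gmor _ _)).
Proof.
pose F := ind_functor gA td (fun M => iff_refl (supp_le xi M)).
have exF : exact F by apply: split_exact; apply: (puremod_ses_split gA td ssT).
move=> /exF/(fullsub_sesE (gcat_abelian gA) (supp_le_serre xi)).
exact.
Qed.

(** Induction is exact, so a composition series of a [T]-module becomes a
    filtration of the induced module by standard modules. *)
Lemma Ind_filtered xi (X : puremod xi) :
  filtered (fun V : GA => exists2 m, irr_deg m = xi & isomorphic V (Delta m)) (Ind X).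
Proof.
case: X => X pX; elim: (gcat_finite_length X) pX => {X} [X X0|X Y Z i p ip _ IH sZ] pX.
  apply/filtered_zero/is_zero_gmod; apply: (@ieta_span _ _ _ _ _ _ _ _ (Ind (exist _ X pX))).
    by have := gsubmod_ker (gmor1 (Ind (exist _ X pX))).
  by move=> x; rewrite (proj1 (is_zero_gmod X) X0 x); apply: (eta0 gA td (exist _ X pX)).
have [pX' pZ] := proj1 (proj2 (pure_serre Ac T xi) _ _ _ _ _ ip) pX.
pose X1 : puremod xi := exist _ X pX'; pose Y1 : puremod xi := exist _ Y pX.
pose Z1 : puremod xi := exist _ Z pZ.
have ip1 : @ses K (puremod xi) X1 Y1 Z1 i p.
  exact/(fullsub_sesE (gcat_abelian gT) (pure_serre Ac T xi)).
apply: (filtered_ext (Ind_ses ip1) (IH pX')).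
have dZ : irr_deg (irr_of sZ) = xi := irr_deg_uniq gA td (l := irr_of sZ) (isomorphic_refl Z) pZ.
exists (irr_of sZ) => //; apply: (Ind_iso (X := Z1)) => //=.
exact/isomorphic_sym/rep_irr_of.
Qed.

Lemma layer_filtered (N : gmod Ac) (bN : balanced_dim Am gA N) (k0 k : int) : k0 <= k ->
  filtered (fun V : GA => exists2 m, k0 <= irr_deg m & isomorphic V (Delta m))
    (sub_gmod (layerP N k)).
Proof.
have [n [_ nE]] := degree_bound gA N 0.
have [j jn] : exists j : nat, n%:Z <= k + j%:Z by exists (absz (n%:Z - k)); lia.
elim: j k jn => [|j IH] k jn k0k.
  apply/filtered_zero/is_zero_gmod => x; apply: (@sub_inc_inj _ _ _ _ _ (layerP N k)).
  rewrite raddf0; have : layer k (sub_inc (layerP N k) x) by apply/(sub_incP (layerP N k)); exists x.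
  apply: (layer_ind (gsubmod_ker (gmor1 N))) => i y ki yi.
  by apply: nE yi; lia.
have [Y [w [Sw w0]]] := layer_quotient bN k.
have Ii := @sub_inc_inj _ _ _ _ _ (layerP N (k + 1)).
have [|i iE] := @gmor_lift _ _ _ N (sub_gmod (layerP N k)) (sub_gmod (layerP N (k + 1)))
    (sub_inc (layerP N k)) (sub_inc (layerP N (k + 1))) (@sub_inc_inj _ _ _ _ _ (layerP N k)).
  by move=> x; apply/(sub_incP (layerP N k))/layerS/(sub_incP (layerP N (k + 1))); exists x.
have ses_iw : @ses K GA _ _ _ i w.
  apply: gses => // [x y xy|y]; first by apply: Ii; rewrite -!iE xy.
  split=> [/w0/(sub_incP (layerP N (k + 1)))[x xE]|[x <-]]; last first.
    by apply/w0; rewrite iE; apply/(sub_incP (layerP N (k + 1))); exists x.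
  by exists x; apply: (@sub_inc_inj _ _ _ _ _ (layerP N k)); rewrite iE.
apply: filtered_cat ses_iw _ _; first by apply: IH; lia.
by apply: filtered_sub (Ind_filtered Y) => V [m mk Vm]; exists m; rewrite ?mk.
Qed.

(** ** The standard filtration of a projective cover *)

(** A nonzero element of degree [xi] exhibits [L] as a quotient of [A] with
    generator placed in degree [xi], so the projective cover is a direct summand
    of this free module. *)
Lemma balanced_cover_ex (L : GA) xi (x : gcar L) : simple L -> gdeg xi x -> x <> 0 ->
  exists N : GA, [/\ projective_cover N L, balanced_dim Am gA N
    & forall y : gcar N, layer xi y].
Proof.
move=> sL xd x0; pose F : GA := free_gmod gA (fun _ : 'I_1 => xi).
have [g gE] := free_map gA (js := fun _ : 'I_1 => xi) (m := fun _ => x) (fun _ => xd).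
have Eg : @epi K GA F L g.
  by apply/gepiP; apply: simple_surj sL _ => g0; apply: x0; rewrite -(gE ord0) g0.
have [N [i [r [ri cN]]]] := projective_cover_ex (@free_projective _ _ _ gA _ _) Eg.
exists N; split; first exact: cN.
  by apply: (balanced_retract td ri); case: (free1_balanced gA td xi).
move=> y; have <- : gfun r (gfun i y) = y := congr1 (fun h : gmor N N => h y) ri.
have sP := gsubmod_preim (r : gmor F N) (layerP N xi).
suff all (z : gcar F) : layer xi (gfun r z) by apply: all.
rewrite (free_expand z); apply: (gs_sum _ sP) => j _; apply: (gsZ _ sP).
by apply: (layer_deg (lexx xi)); apply/gmor_deg/free_gen_deg.
Qed.

(** The top layer of the projective cover [N] of [L] is [Ind Y] for a semisimple
    [Y] mapping onto the degree [xi] part of [L]. A section [s] of this map shows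
    that the preimage in [N] of the image of [Ind s] maps onto [L], so it is all
    of [N]; hence [s] is an isomorphism. *)
Lemma standard_filtration (L : GA) xi (x0 : gcar L) (N : GA) : simple L ->
  gdeg xi x0 -> x0 <> 0 -> supp_le xi L -> projective_cover N L ->
  balanced_dim Am gA N -> (forall x : gcar N, layer xi x) ->
  exists (p : hom N (Ind (part_ob gA td xi L) : GA)) (M : GA) (i : hom M N),
    [/\ epi p, is_kernel p i
    & filtered (fun X => exists2 m, xi < irr_deg m & isomorphic X (Delta m)) M].
Proof.
move=> sL x0d x00 suppL [_ [p0 [/gepiP Sp0 cov]]] bN full.
have Iinc := @sub_inc_inj _ _ _ _ _ (layerP N xi).
have [Y [w0 [Sw0 w00]]] := layer_quotient bN xi.
have [|v vE] := @gmor_lift _ _ _ N (sub_gmod (layerP N xi)) N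
    (sub_inc (layerP N xi)) (gmor1 N) Iinc.
  by move=> x; apply/(sub_incP (layerP N xi)); apply: full.
pose w : gmor N (Ind Y) := gmor_comp w0 v.
have Sw : surj w.
  move=> y; have [z <-] := Sw0 y; exists (sub_inc (layerP N xi) z).
  by apply: (congr1 (gfun w0)); apply: Iinc; apply: vE.
have wz x : w x = 0 <-> layer (xi + 1) x.
  by have := w00 (v x); rewrite vE.
have p0z x : layer (xi + 1) x -> gfun p0 x = 0.
  apply: (layer_ind (gsubmod_ker p0)) => i z xii zi.
  by apply: (suppL i) (gmor_deg _ zi); rewrite -lezD1.
(* [L] has no component in degrees above [xi], so [N -> L] factors through the
   top layer. *)
have [p1 p1E] : exists p1 : gmor (Ind Y) L, forall x, p1 (w x) = gfun p0 x.
  by apply: (gmor_desc (p := w) (g := p0) Sw) => x /wz/p0z.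
pose R : puremod xi := part_ob gA td xi L.
have [v1 v1E] : exists v1 : gmor (sval Y) (part L xi),
    forall y, part_inc (v1 y) = p1 (eta (X := Y) y).
  apply: (part_lift gA td (u := fun y => p1 (eta (X := Y) y)) (svalP Y)) => [y z|t y|y].
  - by rewrite etaD raddfD.
  - by rewrite etaT gmorE.
  by apply: gmor_deg; apply: ieta_deg.
have Sp1 : surj p1.
  by move=> y; have [x <-] := Sp0 y; exists (w x).
have Sv1 : surj v1.
  move=> y; have [z zE] := Sp1 (part_inc y).
  have [u uE] := eta_top (gc_deg xi z); exists u; apply: part_inc_inj.
  by rewrite v1E -uE gmor_gc zE gc_id //; apply: part_inc_deg.
have [s vs] := @pure_surj_split _ _ _ _ ssT xi Y R v1 Sv1.
have vsE r : v1 (gfun s r) = r := congr1 (fun h : gmor (sval R) (sval R) => h r) vs.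
pose m := ind_map gA td (s : gmor (sval R) (sval Y)).
have mE r : m (eta (X := R) r) = eta (X := Y) (gfun s r) by apply: ind_mapE.
have p1m r : p1 (m (eta (X := R) r)) = part_inc r.
  by rewrite mE -v1E vsE.
have Sp1m : surj (gmor_comp p1 m).
  apply: (@simple_surj _ _ _ (Ind R : GA) L) sL _ => pm0; apply: x00.
  have [r <-] := part_incP gA td x0d; rewrite -p1m.
  exact: (congr1 (fun h : gmor (Ind R) L => h (eta (X := R) r)) pm0).
have sS := gsubmod_preim w (gsubmod_im m).
(* This is where [N] being a cover, and not just projective, is used. *)
have all x : exists z, m z = w x.
  apply/(sub_incP sS); move: x.
  apply/(@gepiP _ _ _ (sub_gmod sS : GA) N (sub_inc sS)); apply: cov.
  apply/gepiP => y; have [z zE] := Sp1m y; have [x xE] := Sw (m z).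
  have [x' x'E] : exists x', sub_inc sS x' = x by apply/(sub_incP sS); exists z.
  by exists x'; rewrite gcompE x'E -p1E xE.
have Ss : surj (gfun s).
  move=> y; have [x xE] := Sw (eta (X := Y) y); have [z zE] := all x.
  have [r rE] := eta_top (gc_deg xi z); exists r.
  apply/eqP; rewrite eq_sym -subr_eq0; apply/eqP; apply: (@eta_eq0 _ _ _ _ _ _ gA td _ Y).
  rewrite etaB -mE -rE gmor_gc zE xE gc_id ?subrr //; exact: ieta_deg.
have Is : injective (gfun s) by move=> r r' rr; rewrite -(vsE r) -(vsE r') rr.
have [g [u [ug gu]]] : @isomorphic K GA (Ind Y) (Ind R).
  by apply: Ind_iso => //; apply: isomorphic_sym; exists s; apply: gisomP.
have gB : injective (gfun g) /\ surj (gfun g) by apply: isom_bij; exists u.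
have ker0 x : gmor_comp (g : gmor _ _) w x = 0 <-> layer (xi + 1) x.
  rewrite -wz; split=> [gw|wx]; last by rewrite /= [w0 _]wx raddf0.
  by apply: (proj1 gB); rewrite raddf0.
exists (gmor_comp (g : gmor _ _) w), (sub_gmod (layerP N (xi + 1))), (sub_inc (layerP N (xi + 1))).
split.
- apply/gepiP => y; have [z <-] := proj2 gB y; have [x <-] := Sw z.
  by exists x.
- apply: gker_kernel; first exact: sub_inc_inj.
  by move=> x; rewrite ker0; apply: sub_incP.
apply: filtered_sub (layer_filtered bN (lexx (xi + 1))) => V [l xl Vl].
by exists l => //; rewrite -lezD1.
Qed.

End Filtration.

(** * The highest weight structure *)

Section HighestWeight.
Variables (K : fieldType) (A : falgType K) (Ac : int -> {vspace A}).
Variables (Am T Ap : {aspace A}).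
Hypothesis gA : graded_algebra Ac.
Hypothesis td : triangular_decomposition Ac Am T Ap.
Hypothesis ssT : semisimple_algebra (subvs_of T).
Notation Bc := (sub_grading Ac T).
Notation GT := (gcat Bc).
Notation GA := (gcat Ac).
Notation irr := (Irr GT).
Notation irr_deg := (@irr_deg K _ Bc).
Notation Lsimple := (Lsimple gA td).
Notation Delta := (Delta gA td).
Notation C_le := (C_le irr_deg Lsimple).
Notation C_lt := (C_lt irr_deg Lsimple).

Lemma is_induced_iso (X Y : GT) (V : GA) :
  isomorphic X Y -> is_induced Ap X V -> is_induced Ap Y V.
Proof.
move=> [f [g [gf fg]]] [phi [[Dl Dr B] univ phiM phid]].
have gfE x : gfun g (gfun f x) = x := congr1 (fun h : gmor X X => h x) gf.
have fgE y : gfun f (gfun g y) = y := congr1 (fun h : gmor Y Y => h y) fg.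
exists (fun a y => phi a (gfun g y)); split=> [|W psi [Dl' Dr' B']|a b y|i j a y ai yj].
- split=> [a a' y|a y y'|a b t y bt]; first exact: Dl.
    by rewrite raddfD; apply: Dr.
  by rewrite gmorE; apply: B.
- have [|h [hE hU]] := univ W (fun a x => psi a (gfun f x)).
    split=> [a a' y|a y y'|a b t y bt]; first exact: Dl'.
      by rewrite raddfD; apply: Dr'.
    by rewrite gmorE; apply: B'.
  exists h; split=> [a y|h' h'E]; first by rewrite hE fgE.
  by apply: hU => a x; rewrite -{1}(gfE x) h'E.
- exact: phiM.
by apply: phid => //; apply: gmor_deg.
Qed.

Lemma Delta_induced (l : irr) X : sval l X -> is_induced Ap X (Delta l).
Proof.
move=> /rep_class lX; apply: is_induced_iso lX _.
exact: (iob_is_induced (Ind gA td (prep gA td l))).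
Qed.

Lemma C_le_serre xi : serre (C_le xi). Proof. exact: serre_gen_serre. Qed.

Definition hw_pi xi := part_functor gA td (C_le xi) xi.
Definition hw_Delta xi : functor (puremod Ac T xi) (fullsub (C_le xi)) :=
  ind_functor gA td (@C_leE _ _ _ _ _ _ gA td ssT xi).

Lemma hw_pi_exact xi : exact (hw_pi xi).
Proof.
move=> X Y Z i p /(fullsub_sesE (gcat_abelian gA) (C_le_serre xi)) ip.
apply/(fullsub_sesE (gcat_abelian (gT gA td)) (pure_serre Ac T xi)).
exact: (part_exact gA td xi ip).
Qed.

(** Over the semisimple algebra [T] every short exact sequence splits. *)
Lemma hw_Delta_exact xi : exact (hw_Delta xi).
Proof. by apply: split_exact; apply: (puremod_ses_split gA td ssT). Qed.

Lemma hw_pi_zero xi (M : fullsub (C_le xi)) : C_lt xi (sval M) <-> is_zero (hw_pi xi M).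
Proof.
have sM := proj1 (C_leE gA td ssT xi (sval M)) (svalP M).
rewrite (C_ltE gA td ssT sM); split=> [M0|].
  apply/(is_zero_gmod (part_gmod gA td (sval M) xi : GT)) => x.
  by apply: part_inc_inj; rewrite part_inc0; apply: M0; apply: part_inc_deg.
move=> Mz x xd.
have M0 := proj1 (is_zero_gmod (part_gmod gA td (sval M) xi : GT)) Mz.
have [w <-] := part_incP gA td xd; rewrite (M0 w).
exact: part_inc0.
Qed.

Lemma hw_quotient xi :
  serre_quotient (fun X : fullsub (C_le xi) => C_lt xi (sval X)) (hw_pi xi).
Proof.
apply: (@adjoint_serre_quotient _ _ _ (hw_pi xi) (hw_Delta xi) _ _ _ _
  (@adj_unit _ _ _ _ _ _ gA td _ xi _)).
- exact: fullsub_abelian (gcat_abelian gA) (C_le_serre xi).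
- exact: puremod_abelian gA td xi.
- exact: hw_pi_exact.
- exact: hw_Delta_exact.
- by move=> X Y f; apply: adj_unit_nat.
- by move=> X Y f; apply: adj_unit_univ.
- by move=> X; apply: adj_unit_isom.
exact: hw_pi_zero.
Qed.

Lemma hw_adjoint xi : left_adjoint (hw_Delta xi) (hw_pi xi).
Proof.
exists (@adj_unit _ _ _ _ _ _ gA td _ xi _); split.
  by move=> X Y f; apply: adj_unit_nat.
by move=> X Y f; apply: adj_unit_univ.
Qed.

Lemma hw_cover_ex l : exists N : GA, [/\ projective_cover N (Lsimple l),
  balanced_dim Am gA N & forall y : gcar N, layer (irr_deg l) y].
Proof.
have [x xd x0] := Lsimple_top gA td l.
exact (balanced_cover_ex gA td (Lsimple_simple gA td l) xd x0).
Qed.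
Definition hw_cover l : GA := sval (cid (hw_cover_ex l)).
Lemma hw_coverP l : [/\ projective_cover (hw_cover l) (Lsimple l),
  balanced_dim Am gA (hw_cover l) & forall y : gcar (hw_cover l), layer (irr_deg l) y].
Proof. exact: svalP (cid (hw_cover_ex l)). Qed.

Lemma hw_projC l : projective_cover (hw_cover l) (Lsimple l).
Proof. by case: (hw_coverP l). Qed.

(** Every object of [puremod] is projective, so it is its own projective cover;
    this is why standard and proper standard objects agree. *)
Lemma hw_projQ l : projective_cover (hw_pi (irr_deg l) (L_le irr_deg Lsimple l))
  (hw_pi (irr_deg l) (L_le irr_deg Lsimple l)).
Proof.
split; first exact (@puremod_projective _ _ _ _ _ _ gA td ssT _ _).
by exists (idm _); split=> [|Y g]; [apply/isom_epi/isom_id | rewrite cmp1m].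
Qed.

Definition hw_strat : strat_data irr_deg Lsimple :=
  StratData hw_quotient hw_adjoint hw_Delta_exact hw_projC hw_projQ.

Lemma hw_Std l : isomorphic (Std hw_strat l) (Delta l).
Proof.
apply: (Ind_iso gA td (X := part_ob gA td (irr_deg l) (Lsimple l))) => //.
exact/isomorphic_sym/rep_part.
Qed.

Lemma hw_highest_weight : highest_weight hw_strat.
Proof.
split; last by move=> l; apply: isomorphic_refl.
split; first exact (gcat_hw_setting gA td ssT).
move=> l; have [cN bN full] := hw_coverP l.
have [x xd x0] := Lsimple_top gA td l.
have [p [M [i [Ep ki FM]]]] := standard_filtration td ssT (Lsimple_simple gA td l)
  xd x0 (@Lsimple_supp _ _ _ _ _ _ gA td l) cN bN full.
exists p, M, i; split; [exact Ep | exact ki |].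
refine (filtered_sub _ FM) => V [m lm Vm]; exists m; first exact lm.
exact (isomorphic_trans Vm (isomorphic_sym (hw_Std m))).
Qed.

End HighestWeight.

Theorem theorem1p1 (K : fieldType) (A : falgType K) (Ac : int -> {vspace A})
    (Am T Ap : {aspace A}) :
  graded_algebra Ac ->
  triangular_decomposition Ac Am T Ap ->
  semisimple_algebra (subvs_of T) ->
  exists (Delta L : Irr (gcat (sub_grading Ac T)) -> gcat Ac),
    [/\ forall (l : Irr (gcat (sub_grading Ac T))) X,
          sval l X -> is_induced Ap X (Delta l),
        forall l, is_head (Delta l) (L l)
      & exists S : strat_data (@irr_deg K _ (sub_grading Ac T)) L,
          highest_weight S /\ forall l, isomorphic (Std S l) (Delta l)].
Proof.
move=> gA td ssT; exists (Delta gA td), (Lsimple gA td); split.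
- exact: Delta_induced.
- move=> l; exact: (Lmod_head gA td (prep_simple gA td l)).
exists (hw_strat gA td ssT); split; first exact: hw_highest_weight.
exact: hw_Std.
Qed.
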